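(* Let $f(t,x):=\mathbb{E}\big[\exp\big(\int_t^T\sum_{i=1}^3u_i(s)p_i(X_s)ds+v(T)q(X_T)\big)\mid X_t=x\big]$ on $[0,T]\times\mathbb{R}$. If $f$ does not vanish, let $\log f$ be the continuous function on $[0,T]\times\mathbb{R}$ with $\exp(\log f)=f$ and $\log f(T,0)=v(T)q(0)$. Then \[ \phi_k(t):=\frac1{k!}\partial_x^k\log f(T-t,x)\Big|_{x=0},\quad t\ge0, \] solves the system \[ \phi_k'(t)=\sum_{i=1}^3u_i(T-t)(p_i)_k+bk\phi_k(t)+a(k+1)\phi_{k+1}(t)+\tfrac{c^2(k+2)(k+1)}{2}\phi_{k+2}(t)+\tfrac{c^2}{2}(\widetilde\phi(t)*\widetilde\phi(t))_k,\quad \widetilde\phi_k(t)=(k+1)\phi_{k+1}(t), \] with $\phi_k(0)=v(T)q_k$, $k\ge0$.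
   Context: Let $W$ be a Brownian motion; $a,b\in\mathbb{R}$, $c\ne0$, $T>0$; $dX_t=(a+bX_t)dt+c\,dW_t$. $(r)_k$ or $r_k$ denotes the coefficient of $x^k$ of a power series $r$; $(\alpha*\beta)_k=\sum_{l=0}^k\alpha_l\beta_{k-l}$. Negligible to double factorial: $\limsup_k(|p_k|(k-1)!!)^{1/k}=0$, $(-1)!!=0!!=1$. Standing assumptions: $u_1,u_2,u_3,v:[0,T]\to\mathbb{C}$ continuous with $\Re(u_1)\le0$, $\Re(u_2)=\Re(u_3)=\Re(v)=0$; $p_1=p^2$ for a real-coefficient power series $p$ negligible to double factorial; $p_2,p_3,q$ real-coefficient power series negligible to double factorial. *)

(* Defs.v *)
From HB Require Import structures.
From mathcomp Require Import all_boot all_order all_algebra.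
From mathcomp Require Import all_classical all_reals all_analysis.
From mathcomp Require Import complex.

Set Implicit Arguments.
Unset Strict Implicit.
Unset Printing Implicit Defensive.

Import Order.TTheory GRing.Theory Num.Theory.
Import numFieldTopology.Exports numFieldNormedType.Exports.
Local Open Scope classical_set_scope.
Local Open Scope ring_scope.

(* Complex numbers over R, with the modulus topology (via the regular
   structure ^o, which equips R[i] with its normed topology). *)
Notation CC R := ((complex R)^o).

Section defs.
Variable R : realType.

Definition Cre (z : CC R) : R := complex.Re (z : R[i]).
Definition Cim (z : CC R) : R := complex.Im (z : R[i]).
Definition Cmk (x y : R) : CC R := (Complex x y : R[i]).
Definition RtoC (x : R) : CC R := Cmk x 0.

Definition cexp (z : CC R) : CC R :=
  Cmk (expR (Cre z) * cos (Cim z)) (expR (Cre z) * sin (Cim z)).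

Fixpoint dfact (n : nat) : nat :=
  match n with
  | 0 => 1
  | 1 => 1
  | (m.+2) as n' => n' * dfact m
  end.
Definition dfact_pred (k : nat) : nat :=
  match k with 0 => 1 | j.+1 => dfact j end.

(* a (real-coefficient) power series is represented by its coefficient
   sequence; "negligible to double factorial":
   limsup_k (|p_k| (k-1)!!)^(1/k) = 0 *)
Definition negligible_dfact (p : nat -> R) : Prop :=
  limn_esup (fun k => ((`|p k| * (dfact_pred k)%:R) `^ (k%:R^-1))%:E)
  = 0%E.

Definition cauchy_prod (al be : nat -> R) (k : nat) : R :=
  \sum_(l < k.+1) al l * be (k - l)%N.

Definition psum (p : nat -> R) (y : R) : R :=
  limn (fun n => \sum_(k < n) p k * y ^+ k).

Definition cintegral d (T : measurableType d) (mu : {measure set T -> \bar R})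
  (D : set T) (g : T -> CC R) : CC R :=
  Cmk (Rintegral mu D (fun x => Cre (g x))) (Rintegral mu D (fun x => Cim (g x))).

Definition is_brownian_motion d (Omega : measurableType d)
  (P : probability Omega R) (W : R -> Omega -> R) : Prop :=
  [/\ (forall t, 0 <= t -> measurable_fun setT (W t)),
      (forall w, W 0 w = 0),
      (forall w, {within `[0, +oo[, continuous (fun t => W t w)}),
      (forall s t, 0 <= s -> s < t -> forall B : set R, measurable B ->
          P [set w | W t w - W s w \in B] = normal_prob 0 (Num.sqrt (t - s)) B) &
      (forall (n : nat) (ts : nat -> R), 0 <= ts 0%N ->
          (forall i, (i < n)%N -> ts i < ts i.+1) ->
          forall B : nat -> set R, (forall i, measurable (B i)) ->
          P (\bigcap_(i < n) [set w | W (ts i.+1) w - W (ts i) w \in B i])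
          = (\prod_(i < n) P [set w | (W (ts i.+1) w - W (ts i) w)%R \in B i])%E)].

(* X t x is the solution on [t, T] of dX_s = (a + b X_s) ds + c dW_s,
   X_t = x (for additive noise this is a pathwise integral equation). *)
Definition is_OU_flow d (Omega : measurableType d) (W : R -> Omega -> R)
  (a b c T : R) (X : R -> R -> R -> Omega -> R) : Prop :=
  forall t x, 0 <= t <= T -> forall w,
    {within `[t, T], continuous (fun s => X t x s w)} /\
    forall s, t <= s <= T ->
      X t x s w = x + Rintegral lebesgue_measure `[t, s]
                        (fun r => a + b * X t x r w)
                  + c * (W s w - W t w).

Definition has_deriv_within (T : R) (g : R -> CC R) (t : R) (l : CC R) : Prop :=
  (fun h : R => (RtoC h)^-1 * (g (t + h) - g t))
    @ within [set h : R | h != 0 /\ 0 <= t + h <= T] (nbhs (0 : R))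
  --> l.

(* f(t,x) = E[ exp( int_t^T sum_i u_i(s) p_i(X_s) ds + v(T) q(X_T) ) | X_t = x ],
   realized with the solution X t x started from x at time t. *)
Definition fk_f d (Omega : measurableType d) (P : probability Omega R)
  (X : R -> R -> R -> Omega -> R) (T : R) (u1 u2 u3 v : R -> CC R)
  (p1 p2 p3 q : nat -> R) (t x : R) : CC R :=
  cintegral P setT (fun w =>
    cexp (cintegral lebesgue_measure `[t, T]
            (fun s => u1 s * RtoC (psum p1 (X t x s w))
                    + u2 s * RtoC (psum p2 (X t x s w))
                    + u3 s * RtoC (psum p3 (X t x s w)))
          + v T * RtoC (psum q (X t x T w)))).

Definition phi_coef (L : R -> R -> CC R) (T : R) (k : nat) (t : R) : CC R :=
  RtoC (k`!%:R)^-1 *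
  Cmk (derive1n k (fun x => Cre (L (T - t) x)) 0)
      (derive1n k (fun x => Cim (L (T - t) x)) 0).

End defs.

(* Main.v *)
Require Import Defs.
From HB Require Import structures.
From mathcomp Require Import all_boot all_order all_algebra.
From mathcomp Require Import all_classical all_reals all_analysis.
From mathcomp Require Import complex.
From mathcomp Require Import measurable_realfun zify ring lra.
Import Order.TTheory GRing.Theory Num.Theory.
Import numFieldTopology.Exports numFieldNormedType.Exports.
Local Open Scope classical_set_scope.
Local Open Scope ring_scope.

(* The solution of the linear equation is explicit, [X t x s = e^(b s) (y + M s - M t)] with
   [y = e^(- b t) x] and [M] a continuous functional of the Brownian path, so that [f (t, x)]
   is the expectation of [exp] of a function of [y] and of the path.  Power series negligible to
   the double factorial grow more slowly than [exp (th y^2)] for every [th > 0], while a chaining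
   argument shows that [exp (e sup W^2)] is integrable for some [e > 0].  Hence all [y]-derivatives
   of [f] exist, are jointly continuous, and may be computed under the expectation.  The Markov
   property over [[s, t]], a second-order Taylor expansion in the Gaussian increment and dominated
   convergence turn difference quotients in time into the backward equation
     [f_t = - (a e^(- b t) f_y + c^2/2 e^(- 2 b t) f_yy + (sum u_i p_i) f)],
   which may be differentiated in [y]; it yields a linear system for the Taylor coefficients [F_k]
   of [f].  Finally [F' = F Phi'] as formal series in [x], with [Phi] the Taylor series of
   [log f], and substituting this in the linear system and dividing by [F] gives the Riccati
   system, the differentiability in time of [Phi_k] being obtained by induction on [k]. *)

Set Implicit Arguments.
Unset Strict Implicit.
Unset Printing Implicit Defensive.

(** Everything rests on pathwise objects: the noise is additive, so neither a stochastic integral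
    nor Ito's formula occurs, only the law and the independence of Brownian increments. In the
    coordinate [y] the flow is a translation by an increment of [M], so the functions in play have
    the form [g t (y + shift)], and regularity in [y] passes through composition, time integration
    and expectation alike. The conditions [Re u1 <= 0], [p1 = p^2] and imaginary [u2], [u3], [v]
    keep the exponential bounded by 1. Its [y]-derivatives are unbounded but grow more slowly than
    every Gaussian exponential, whereas the path offers only one small exponent [e]; this is why
    growth is quantified over all [th > 0]. The other obstacles are the ends of [[0, T]], where only
    one-sided time derivatives make sense, and the logarithm, known only as a continuous solution of
    [exp L = f]. Time data are therefore clamped to [[0, T]] and limits are taken along sequences,
    while the derivatives of [L] are recovered from those of [f] because continuity keeps [L] on one
    branch. *)

Section calculus.
Variable R : realType.
Implicit Types k K : R -> R.
Local Notation mu := (@lebesgue_measure R).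

Lemma continuous_itv_integrable k (t s : R) :
  continuous k -> mu.-integrable `[t, s] (EFin \o k).
Proof.
move=> ck; apply: continuous_compact_integrable; first exact: segment_compact.
exact: continuous_subspaceT.
Qed.

(** The base point -1 makes 0 an interior point, so that two-sided derivatives are available at
    every time of [[0, T]]. *)
Lemma continuous_antiderivative k : continuous k ->
  exists K : R -> R,
    (forall s : R, -1 < s -> is_derive s 1 K (k s)) /\
    (forall t s : R, -1 < t -> t <= s -> \int[mu]_(r in `[t, s]) k r = K s - K t).
Proof.
move=> ck; exists (fun s => \int[mu]_(r in `[-1, s]) k r); split.
  move=> s s1.
  have su : s < s + 1 by rewrite ltrDl.
  have [|d e] := continuous_FTC1_closed su (continuous_itv_integrable (-1) (s + 1) ck) s1.
    exact: ck.
  by apply: DeriveDef; [exact: d|rewrite -derive1E e].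
move=> t s t1 ts.
rewrite (@Rintegral_itvB _ k (BLeft (-1)) (BRight s) t) ?bnd_simp//.
- rewrite Rintegral_itv_obnd_cbnd//.
  apply: integrableS (continuous_itv_integrable t s ck) => //.
  by apply: subset_itvr; rewrite bnd_simp.
- exact: continuous_itv_integrable.
- exact: ltW.
Qed.

Lemma mean_value K k (t s : R) : t <= s ->
  (forall r : R, t <= r <= s -> is_derive r 1 K (k r)) ->
  exists2 c, t <= c <= s & K s - K t = k c * (s - t).
Proof.
move=> ts dK.
have [||c] := @MVT_segment R K k t s ts.
- by move=> x /subset_itv_oo_cc; rewrite in_itv/= => /dK.
- apply: derivable_within_continuous => x; rewrite in_itv/= => xI.
  by have [] := dK x xI.
by rewrite in_itv/= => cI e; exists c.
Qed.

Lemma derivable_continuous_at K (s l : R) : is_derive s 1 K l -> {for s, continuous K}.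
Proof. by case=> /derivable1_diffP/differentiable_continuous. Qed.

(** Locating the intermediate point by its distance to [x] avoids ordering the two points, and lets
    it converge to [x] when [y] does. *)
Lemma mean_value_dist K k (x y : R) : (forall r : R, is_derive r 1 K (k r)) ->
  exists2 c, `|c - x| <= `|y - x| & K y - K x = k c * (y - x).
Proof.
move=> dK; have [xy|/ltW yx] := leP x y.
  have [c /andP[xc cy] e] := mean_value xy (fun r _ => dK r).
  by exists c => //; rewrite !ger0_norm ?subr_ge0// lerB.
have [c /andP[yc cx] e] := mean_value yx (fun r _ => dK r).
exists c; last by rewrite -[RHS]opprK -mulrN opprB -e opprB.
by rewrite distrC (distrC y) !ger0_norm ?subr_ge0// lerB.
Qed.

Lemma Rintegral_mean k (t s : R) : continuous k -> -1 < t -> t <= s ->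
  exists2 c, t <= c <= s & \int[mu]_(r in `[t, s]) k r = k c * (s - t).
Proof.
move=> ck t1 ts; have [K [dK ->//]] := continuous_antiderivative ck.
by apply: mean_value => // r /andP[tr _]; exact: dK (lt_le_trans t1 tr).
Qed.

End calculus.

Section joint_measurability.
Context {R : realType} d (Z : measurableType d).

(* A Caratheodory function is the limit of its discretizations in the continuous variable. *)
Lemma caratheodory_measurable (h : R -> Z -> R) :
  (forall z, continuous (h ^~ z)) -> (forall s, measurable_fun setT (h s)) ->
  measurable_fun [set: Z * R] (fun zs => h zs.2 zs.1).
Proof.
move=> ch mh.
pose p (n : nat) (s : R) : R := (Num.floor (n.+1%:R * s))%:~R / n.+1%:R.
apply: (measurable_fun_cvg (h := fun n (zs : Z * R) => h (p n zs.2) zs.1)).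
  move=> n _ B mB; rewrite setTI.
  rewrite (_ : _ @^-1` _ = \bigcup_(i : int)
     ((h (i%:~R / n.+1%:R) @^-1` B) `*` [set s : R | Num.floor (n.+1%:R * s) = i])).
    apply: countable_bigcupT_measurable => // i; apply: measurableX.
      by rewrite -[X in measurable X]setTI; exact: mh.
    rewrite (_ : [set s | _] = `[i%:~R / n.+1%:R, (i + 1)%:~R / n.+1%:R[%classic)//.
    apply/seteqP; split => s /=; rewrite in_itv/= ler_pdivrMr// ltr_pdivlMr// (mulrC s).
      by move=> <-; rewrite floor_le floorD1_gt.
    by move=> ?; apply/eqP; rewrite floor_eq.
  apply/seteqP; split => [[z s]/= hB|[z s]/= [i _ [/= hB si]]].
    by exists (Num.floor (n.+1%:R * s)).
  by rewrite /p si.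
move=> [z s] _ /=.
suff ps : p n s @[n --> \oo] --> (s : R) by exact: (cvg_comp _ _ ps (ch z s)).
apply/cvgrPdist_lt => e e0.
near=> n.
have n0 : (0 : R) < n.+1%:R by [].
have -> : s - p n s = (n.+1%:R * s - (Num.floor (n.+1%:R * s))%:~R) / n.+1%:R.
  by rewrite /p mulrBl mulrAC divff ?mul1r// gt_eqF.
have := floorD1_gt (n.+1%:R * s); have := floor_le (n.+1%:R * s).
rewrite intrD => h1 h2.
rewrite ger0_norm; last by rewrite divr_ge0// subr_ge0.
rewrite ltr_pdivrMr// (lt_le_trans (y := 1))//; first by rewrite ltrBlDl.
rewrite mulrC -ler_pdivrMr//.
apply: le_trans (_ : n%:R <= _); last by rewrite ler_nat.
by near: n; exact: nbhs_infty_ger.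
Unshelve. all: by end_near. Qed.

End joint_measurability.

(** * Differentiation under the integral sign *)

Section dominated.
Context d (Z : measurableType d) (R : realType).
Variables (mu : {measure set Z -> \bar R}) (D : set Z).
Hypothesis mD : measurable D.

Lemma Rintegral_dominated_cvg (f_ : nat -> Z -> R) (f g : Z -> R) :
  (forall n, measurable_fun D (f_ n)) ->
  (forall z, D z -> f_ n z @[n --> \oo] --> f z) ->
  (forall n z, D z -> `|f_ n z| <= g z) ->
  mu.-integrable D (EFin \o g) ->
  \int[mu]_(z in D) f_ n z @[n --> \oo] --> \int[mu]_(z in D) f z.
Proof.
move=> mf cf fg ig.
have mf' : measurable_fun D f by exact: (measurable_fun_cvg mf cf).
have [] := @dominated_convergence _ _ _ mu D mD (fun n => EFin \o f_ n) (EFin \o f)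
  (EFin \o g).
- by move=> n; apply/measurable_EFinP.
- exact/measurable_EFinP.
- by apply: aeW => z Dz; apply/fine_cvgP; split; [exact: nearW|exact: cf].
- exact: ig.
- by apply: aeW => z n Dz; rewrite lee_fin fg.
move=> intf _ cvgf; apply: fine_cvg; rewrite fineK//.
exact: (integrable_fin_num _ intf).
Qed.

Lemma dominated_integrable_real (f g : Z -> R) : measurable_fun D f ->
  (forall z, D z -> `|f z| <= g z) -> mu.-integrable D (EFin \o g) ->
  mu.-integrable D (EFin \o f).
Proof.
move=> mf fg; apply: le_integrable => //; first exact/measurable_EFinP.
by move=> z Dz /=; rewrite lee_fin (le_trans (fg z Dz))// ler_norm.
Qed.

Lemma integrable_scale (k : R) (f : Z -> R) : mu.-integrable D (EFin \o f) ->
  mu.-integrable D (EFin \o (fun z => k * f z)).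
Proof.
move=> intf; rewrite (_ : _ \o _ = (fun z => k%:E * (EFin \o f) z)%E); last first.
  by apply/funext => z /=; rewrite EFinM.
exact: integrableZl.
Qed.

End dominated.

Section admissible.
Context {R : realType} d (Z : measurableType d).
Variable S : Z -> R.
Implicit Types F G : R -> R -> Z -> R.

(** Joint continuity is phrased with sequences because dominated convergence, which must preserve
    it, is sequential. *)
Definition seqcont (F : R -> R -> R) := forall (tn yn : nat -> R) (t y : R),
  tn n @[n --> \oo] --> t -> yn n @[n --> \oo] --> y ->
  F (tn n) (yn n) @[n --> \oo] --> F t y.

(* Coefficients negligible to the double factorial give power series growing more slowly
   than [expR (th * y ^+ 2)] for every [th > 0]; [S z] will be the range of a path. *)
Definition subgaussian F := forall th : R, 0 < th -> exists C : R,
  forall t y z, `|F t y z| <= C * expR (th * (y ^+ 2 + S z ^+ 2)).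

Definition adm F := [/\ forall t y, measurable_fun setT (F t y),
  forall z, seqcont (fun t y => F t y z) & subgaussian F].

(** The derivative is an existential witness that must again lie in the class, so each closure
    property is an induction on [n] that exhibits a formula for the derivative. *)
Fixpoint sadm n F : Prop := adm F /\
  match n with
  | 0 => True
  | m.+1 => exists F' : R -> R -> Z -> R,
      (forall (t y : R) z, is_derive y 1 (fun x : R => F t x z) (F' t y z)) /\ sadm m F'
  end.

Lemma sadm_adm n F : sadm n F -> adm F.
Proof. by case: n => [|n] []. Qed.

Lemma sadmW n F : sadm n.+1 F -> sadm n F.
Proof.
elim: n F => [|n IH] F; first by case.
case=> aF [F' [dF /IH sF']]; split=> //.
by exists F'.
Qed.

Lemma adm_time (h : R -> R) (B : R) : continuous h -> (forall t, `|h t| <= B) ->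
  adm (fun t _ _ => h t).
Proof.
move=> ch hB; split.
- by move=> t y; exact: measurable_cst.
- by move=> z tn yn t y tnt _; exact: (cvg_comp _ _ tnt (ch t)).
- move=> th th0; exists B => t y z; rewrite (le_trans (hB t))// ler_peMr//.
    exact: le_trans (hB 0).
  by rewrite -expR0 ler_expR mulr_ge0 ?(ltW th0)// addr_ge0// sqr_ge0.
Qed.

Lemma sadm_time n (h : R -> R) (B : R) : continuous h -> (forall t, `|h t| <= B) ->
  sadm n (fun t _ _ => h t).
Proof.
elim: n h B => [|n IH] h B ch hB; first by split => //; exact: adm_time ch hB.
split; first exact: adm_time ch hB.
exists (fun _ _ _ => 0); split => [t y z|]; first exact: is_derive_cst.
by apply: (IH (cst 0) 0); [exact: cst_continuous|move=> ?; rewrite normr0].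
Qed.

Lemma sadm_cst n (c : R) : sadm n (fun _ _ _ => c).
Proof. by apply: (@sadm_time n (cst c) `|c|); [exact: cst_continuous|]. Qed.

Lemma admD F G : adm F -> adm G -> adm (fun t y z => F t y z + G t y z).
Proof.
move=> [mF cF gF] [mG cG gG]; split.
- by move=> t y; exact: measurable_funD.
- by move=> z tn yn t y tnt yny; apply: cvgD; [exact: cF|exact: cG].
- move=> th th0; have [C HC] := gF _ th0; have [C' HC'] := gG _ th0.
  by exists (C + C') => t y z; rewrite (le_trans (ler_normD _ _))// mulrDl lerD.
Qed.

Lemma admM F G : adm F -> adm G -> adm (fun t y z => F t y z * G t y z).
Proof.
move=> [mF cF gF] [mG cG gG]; split.
- by move=> t y; exact: measurable_funM.
- by move=> z tn yn t y tnt yny; apply: cvgM; [exact: cF|exact: cG].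
(* The allowed exponent [th] is shared equally between the two factors. *)
- move=> th th0; have th2 : 0 < th / 2 by rewrite divr_gt0.
  have [C HC] := gF _ th2; have [C' HC'] := gG _ th2.
  exists (C * C') => t y z; rewrite normrM.
  rewrite (_ : th * _ = th / 2 * (y ^+ 2 + S z ^+ 2) + th / 2 * (y ^+ 2 + S z ^+ 2)).
    by rewrite expRD mulrACA ler_pM.
  by rewrite -mulrDl -splitr.
Qed.

Lemma sadmD n F G : sadm n F -> sadm n G -> sadm n (fun t y z => F t y z + G t y z).
Proof.
elim: n F G => [|n IH] F G /=; first by move=> [? _] [? _]; split => //; exact: admD.
move=> [aF [F' [dF sF]]] [aG [G' [dG sG]]]; split; first exact: admD.
exists (fun t y z => F' t y z + G' t y z); split; last exact: IH.
by move=> t y z; apply: is_deriveD.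
Qed.

Lemma sadmM n F G : sadm n F -> sadm n G -> sadm n (fun t y z => F t y z * G t y z).
Proof.
elim: n F G => [|n IH] F G.
  by move=> [? _] [? _]; split => //; exact: admM.
move=> sF0 sG0; have [aF [F' [dF sF]]] := sF0; have [aG [G' [dG sG]]] := sG0.
split; first exact: admM.
exists (fun t y z => F t y z * G' t y z + G t y z * F' t y z); split.
  by move=> t y z; apply: is_deriveM.
by apply: sadmD; apply: IH => //; exact: sadmW.
Qed.

Lemma sadmN n F : sadm n F -> sadm n (fun t y z => - F t y z).
Proof.
move=> sF; rewrite (_ : (fun _ _ _ => _) = (fun t y z => -1 * F t y z)).
  exact: sadmM (sadm_cst _ _) sF.
by apply/funext => t; apply/funext => y; apply/funext => z; rewrite mulN1r.
Qed.

Lemma sadmB n F G : sadm n F -> sadm n G -> sadm n (fun t y z => F t y z - G t y z).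
Proof. by move=> sF sG; apply: sadmD => //; exact: sadmN. Qed.

End admissible.

Section integrate_out.
Context {R : realType} d1 d2 (Z1 : measurableType d1) (Z2 : measurableType d2).
Variable mu : {sigma_finite_measure set Z2 -> \bar R}.
Variable D : set Z2.
Hypothesis mD : measurable D.

Lemma measurable_Rintegral (F : Z1 * Z2 -> R) : measurable_fun setT F ->
  measurable_fun setT (fun z1 => \int[mu]_(z2 in D) F (z1, z2)).
Proof.
move=> mF; rewrite /Rintegral.
apply: (measurableT_comp (fine_measurable measurableT)).
pose f := (EFin \o F) \_ (setT `*` D).
have mf : measurable_fun setT f.
  apply/(measurable_restrictT _ _).1; first exact: measurableX.
  by apply/measurable_EFinP; exact: measurable_funTS.
have -> : (fun z1 => \int[mu]_(z2 in D) (F (z1, z2))%:E)%E =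
  (fun z1 => fubini_F mu f^\+ z1 - fubini_F mu f^\- z1)%E.
  apply/funext => z1; rewrite integral_mkcond integralE; congr (_ - _)%E;
    apply: eq_integral => z2 _; rewrite ?funeposE ?funenegE /f /patch;
    by rewrite in_setX in_setT.
apply: emeasurable_funB.
  apply: measurable_fun_fubini_tonelli_F => //.
  exact: measurable_funepos.
apply: measurable_fun_fubini_tonelli_F => //.
exact: measurable_funeneg.
Qed.

Variables (S1 : Z1 -> R) (S2 : Z2 -> R) (S : Z1 * Z2 -> R) (e0 : R).
Hypothesis S12 : forall z1 z2, S (z1, z2) ^+ 2 <= S1 z1 ^+ 2 + S2 z2 ^+ 2.
Hypothesis e0_gt0 : 0 < e0.
Hypothesis mS2 : measurable_fun D S2.
Hypothesis int_S2 : mu.-integrable D (fun z => (expR (e0 * S2 z ^+ 2))%:E).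

Let dom (F : R -> R -> Z1 * Z2 -> R) (C th : R) : 0 <= th ->
  (forall t y z, `|F t y z| <= C * expR (th * (y ^+ 2 + S z ^+ 2))) ->
  forall t y z1 z2, `|F t y (z1, z2)| <=
    C * expR (th * (y ^+ 2 + S1 z1 ^+ 2)) * expR (th * S2 z2 ^+ 2).
Proof.
move=> th0 HC t y z1 z2.
have C0 : 0 <= C.
  by rewrite -(pmulr_lge0 _ (expR_gt0 (th * (y ^+ 2 + S (z1, z2) ^+ 2))));
    exact: le_trans (HC t y (z1, z2)).
rewrite (le_trans (HC _ _ _))// -mulrA ler_wpM2l// -expRD ler_expR -mulrDr.
by rewrite ler_wpM2l// -addrA lerD2l.
Qed.

Let int_th (th : R) : 0 <= th -> th <= e0 ->
  mu.-integrable D (fun z => (expR (th * S2 z ^+ 2))%:E).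
Proof.
move=> th0 the; apply: (dominated_integrable_real mD (g := fun z => expR (e0 * S2 z ^+ 2))) => //.
  apply: measurableT_comp; first exact: measurable_expR.
  by apply: measurable_funM => //; exact: measurable_funX.
by move=> z _; rewrite ger0_norm ?expR_ge0// ler_expR ler_wpM2r// sqr_ge0.
Qed.

Let int_F F t y z1 : adm S F -> mu.-integrable D (EFin \o (fun z2 => F t y (z1, z2))).
Proof.
move=> [mF cF gF]; have [C HC] := gF _ e0_gt0.
apply: (dominated_integrable_real mD (g := fun z2 =>
  C * expR (e0 * (y ^+ 2 + S1 z1 ^+ 2)) * expR (e0 * S2 z2 ^+ 2))).
- by apply: measurable_funTS; exact: measurable_fun_pair2.
- by move=> z2 _; apply: dom => //; exact: ltW.
- by apply: integrable_scale => //; apply: int_th => //; exact: ltW.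
Qed.

(** The measure dictates one exponent [e0] for which [expR (e0 * S2 ^ 2)] is integrable. Since
    growth holds for every positive exponent, one not exceeding [e0] can be used, and the bound then
    factors into a function of [(y, z1)] and an integrable function of [z2]. *)
Lemma adm_integral F : adm S F ->
  adm S1 (fun t y z1 => \int[mu]_(z2 in D) F t y (z1, z2)).
Proof.
move=> aF; have [mF cF gF] := aF; split.
- by move=> t y; exact: measurable_Rintegral.
- move=> z1 tn yn t y tnt yny; have [C HC] := gF _ e0_gt0.
  have /cvg_seq_bounded [B [_ HB]] : cvgn yn by apply/cvg_ex; exists y.
  (* A bound for the convergent sequence [yn] makes the dominating function independent of [n]. *)
  pose Y : R := `|B| + 1.
  have yY n : `|yn n| <= Y.
    by apply: HB => //; rewrite (le_lt_trans (ler_norm B))// ltrDl.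
  apply: (Rintegral_dominated_cvg mD (g := fun z2 =>
    C * expR (e0 * (Y ^+ 2 + S1 z1 ^+ 2)) * expR (e0 * S2 z2 ^+ 2))).
  + by move=> n; apply: measurable_funTS; exact: measurable_fun_pair2.
  + by move=> z2 _; exact: cF.
  + move=> n z2 _; rewrite (le_trans (dom (ltW e0_gt0) HC _ _ _ _))//.
    have C0 : 0 <= C.
      rewrite -(pmulr_lge0 _ (expR_gt0 (e0 * (0 ^+ 2 + S (z1, z2) ^+ 2)))).
      exact: le_trans (HC 0 0 (z1, z2)).
    rewrite ler_wpM2r ?expR_ge0// ler_wpM2l// ler_expR (ler_wpM2l (ltW e0_gt0))// lerD2r.
    by rewrite -[yn n ^+ 2]real_normK ?num_real// lerXn2r ?nnegrE// addr_ge0.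
  + by apply: integrable_scale => //; apply: int_th => //; exact: ltW.
(* At most [e0] for integrability in [z2], at most [th] for the required growth. *)
- move=> th th0; pose th' := Num.min th e0.
  have th'0 : 0 < th' by rewrite lt_min th0.
  have [C HC] := gF _ th'0.
  exists (C * \int[mu]_(z2 in D) expR (th' * S2 z2 ^+ 2)) => t y z1.
  have th'e : th' <= e0 by rewrite ge_min lexx orbT.
  have i1 := int_th (ltW th'0) th'e.
  have C0' (z2 : Z2) : 0 <= C.
    rewrite -(pmulr_lge0 _ (expR_gt0 (th' * (0 ^+ 2 + S (z1, z2) ^+ 2)))).
    exact: le_trans (HC 0 0 (z1, z2)).
  rewrite (le_trans (le_normr_Rintegral mD (int_F t y z1 aF)))//.
  apply: le_trans (_ : \int[mu]_(z2 in D)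
     (C * expR (th' * (y ^+ 2 + S1 z1 ^+ 2)) * expR (th' * S2 z2 ^+ 2)) <= _).
    apply: le_Rintegral => //.
    + by apply: integrable_norm; exact: int_F.
    + by apply: integrable_scale.
    + by move=> z2 _; apply: dom => //; exact: ltW.
  (* Nonnegativity of [C] is read off at a point of [Z2], hence the separate case of an empty
     [D]. *)
  rewrite RintegralZl// mulrAC; have [D0|/set0P[z2 _]] := eqVneq D set0.
    by rewrite D0 Rintegral_set0 !(mulr0,mul0r).
  rewrite ler_wpM2l ?mulr_ge0 ?(C0' z2)//.
    by apply: Rintegral_ge0 => ? _; exact: expR_ge0.
  by rewrite ler_expR ler_wpM2r ?addr_ge0 ?sqr_ge0// ge_min lexx.
Qed.

Lemma sadm_integral n F : sadm S n F ->
  sadm S1 n (fun t y z1 => \int[mu]_(z2 in D) F t y (z1, z2)).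
Proof.
elim: n F => [|n IH] F; first by move=> [/adm_integral].
move=> [aF [F' [dF sF]]]; split; first exact: adm_integral.
exists (fun t y z1 => \int[mu]_(z2 in D) F' t y (z1, z2)); split; last exact: IH.
move=> t y z1; have aF' := sadm_adm sF.
have [_ _ gF'] := aF'; have [C HC] := gF' _ e0_gt0.
have yI : `]y - 1, y + 1[%classic y by rewrite /= in_itv/= ltrBlDr !ltrDl ltr01.
have intf (x : R) (_ : `]y - 1, y + 1[%classic x) :
  mu.-integrable D (EFin \o (fun z2 => F t x (z1, z2))) by exact: int_F.
have der (x : R) (z2 : Z2) (_ : `]y - 1, y + 1[%classic x) (_ : D z2) :
  derivable (fun x => F t x (z1, z2)) x 1 by case: (dF t x (z1, z2)).
(* On the unit neighbourhood of [y] the variable is bounded by [|y| + 1], which gives a dominating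
   function for the derivative that does not depend on [x]. *)
pose G z2 := `|C| * expR (e0 * ((`|y| + 1) ^+ 2 + S1 z1 ^+ 2)) * expR (e0 * S2 z2 ^+ 2).
have G0 z2 : 0 <= G z2 by rewrite !mulr_ge0// expR_ge0.
have iG : mu.-integrable D (EFin \o G).
  by apply: integrable_scale => //; apply: int_th => //; exact: ltW.
have pE (x : R) (z2 : Z2) : partial1of2 (fun x z2 => F t x (z1, z2)) x z2 = F' t x (z1, z2).
  by rewrite partial1of2E; case: (dF t x (z1, z2)).
have Gub (x : R) (z2 : Z2) (xI : `]y - 1, y + 1[%classic x) (_ : D z2) :
  `|partial1of2 (fun x z2 => F t x (z1, z2)) x z2| <= G z2.
  rewrite pE (le_trans (dom (ltW e0_gt0) HC _ _ _ _))//.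
  rewrite ler_wpM2r ?expR_ge0// ler_pM ?expR_ge0 ?ler_norm//.
    rewrite -(pmulr_lge0 _ (expR_gt0 (e0 * (0 ^+ 2 + S (z1, z2) ^+ 2)))).
    exact: le_trans (HC 0 0 (z1, z2)).
  rewrite ler_expR (ler_wpM2l (ltW e0_gt0))// lerD2r -[x ^+ 2]real_normK ?num_real//.
  rewrite lerXn2r ?nnegrE ?addr_ge0//.
  have -> : x = y + (x - y) by rewrite addrC subrK.
  rewrite (le_trans (ler_normD _ _))// lerD2l ler_norml.
  by move: xI; rewrite /= in_itv/= => /andP[? ?]; apply/andP; split; lra.
apply: DeriveDef.
  exact: (derivable_under_integral mD yI intf der G0 iG Gub).
rewrite -derive1E (differentiation_under_integral mD yI intf der G0 iG Gub).
by apply: eq_Rintegral => z2 _; rewrite pE.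
Qed.

End integrate_out.

(** * Composition with a path and integration in time *)

Section composition.
Context {R : realType}.

Lemma continuous_maxr (f g : R -> R) : continuous f -> continuous g ->
  continuous (fun x => Num.max (f x) (g x)).
Proof. by move=> cf cg x; exact: (@continuous_max R _ f g x (cf x) (cg x)). Qed.

Lemma continuous_minr (f g : R -> R) : continuous f -> continuous g ->
  continuous (fun x => Num.min (f x) (g x)).
Proof. by move=> cf cg x; exact: (@continuous_min R _ f g x (cf x) (cg x)). Qed.

Lemma continuous_compR (f g : R -> R) : continuous f -> continuous g ->
  continuous (fun x => g (f x)).
Proof. by move=> cf cg x; exact: (@continuous_comp R R R f g x (cf x) (cg (f x))). Qed.

Lemma continuous_addr (f g : R -> R) : continuous f -> continuous g ->
  continuous (fun x => f x + g x).
Proof. by move=> cf cg x; exact: (@continuousD R R R f g x (cf x) (cg x)). Qed.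

Lemma continuous_subr (f g : R -> R) : continuous f -> continuous g ->
  continuous (fun x => f x - g x).
Proof. by move=> cf cg x; exact: (@continuousB R R R f g x (cf x) (cg x)). Qed.

Lemma continuous_mulr (f g : R -> R) : continuous f -> continuous g ->
  continuous (fun x => f x * g x).
Proof. by move=> cf cg x; exact: (@continuousM R R f g x (cf x) (cg x)). Qed.

Local Notation mu := (@lebesgue_measure R).
Implicit Types g q : R -> R -> R.

(** Deterministic functions are the case of a one-point path space with range 0, so that all closure
    properties of [sadm] apply to them. *)
Definition dadm n g := sadm (fun _ : unit => 0 : R) n (fun t y _ => g t y).

Lemma dadm_seqcont n g : dadm n g -> seqcont g.
Proof. by case/sadm_adm => _ /(_ tt). Qed.

Lemma dadm_subgaussian n g (th : R) : dadm n g -> 0 < th ->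
  exists C : R, forall t y, `|g t y| <= C * expR (th * y ^+ 2).
Proof.
case/sadm_adm => _ _ gg th0; have [C HC] := gg _ th0; exists C => t y.
by have := HC t y tt; rewrite expr0n/= addr0.
Qed.

Lemma seqcont1 g t : seqcont g -> continuous (g t).
Proof.
by move=> cg y; apply/(@cvg_nbhsP _ R^o) => u uy; apply: cg => //; exact: cvg_cst.
Qed.

Lemma seqcont2 g y : seqcont g -> continuous (g ^~ y).
Proof.
by move=> cg t; apply/(@cvg_nbhsP _ R^o) => u ut; apply: cg => //; exact: cvg_cst.
Qed.

Lemma seqcont_path g (x y : R -> R) : seqcont g -> continuous x -> continuous y ->
  continuous (fun r => g (x r) (y r)).
Proof.
move=> cg cx cy t; apply/(@cvg_nbhsP _ R^o) => u ut; apply: cg.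
  exact: (cvg_comp _ _ ut (cx t)).
exact: (cvg_comp _ _ ut (cy t)).
Qed.

Lemma seqcont_measurable g d (Z : measurableType d) (x y : Z -> R) : seqcont g ->
  measurable_fun setT x -> measurable_fun setT y ->
  measurable_fun setT (fun z => g (x z) (y z)).
Proof.
move=> cg mx my.
have mg : measurable_fun setT (fun zs : R * R => g zs.2 zs.1).
  apply: (caratheodory_measurable (h := g)) => [y0|t]; first exact: seqcont2.
  by apply: continuous_measurable_fun; exact: seqcont1.
exact: (measurableT_comp mg (measurable_fun_pair my mx)).
Qed.

Context d (Z : measurableType d).

Lemma sadm_comp n g (S : Z -> R) (tau nu : R -> Z -> R) : dadm n g ->
  (forall z, continuous (tau ^~ z)) -> (forall z, continuous (nu ^~ z)) ->
  (forall t, measurable_fun setT (tau t)) -> (forall t, measurable_fun setT (nu t)) ->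
  (forall t z, `|nu t z| <= S z) ->
  sadm S n (fun t y z => g (tau t z) (y + nu t z)).
Proof.
move=> gn ctau cnu mtau mnu nuS.
have adm_comp m g' : dadm m g' -> adm S (fun t y z => g' (tau t z) (y + nu t z)).
  move=> gm; have cg := dadm_seqcont gm; split.
  - move=> t y; apply: seqcont_measurable => //.
    by apply: measurable_funD => //; exact: measurable_cst.
  - move=> z tn yn t y tnt yny; apply: cg.
      exact: (cvg_comp _ _ tnt (ctau z t)).
    by apply: cvgD => //; exact: (cvg_comp _ _ tnt (cnu z t)).
  (* Half of [th] suffices because [(y + nu)^2 <= 2 (y^2 + nu^2)] and [nu] is bounded by the range
     [S]. *)
  - move=> th th0; have th2 : 0 < th / 2 by rewrite divr_gt0.
    have [C HC] := dadm_subgaussian gm th2.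
    have C0 : 0 <= C.
      rewrite -(pmulr_lge0 _ (expR_gt0 (th / 2 * (0 ^+ 2)))).
      exact: le_trans (HC 0 0).
    exists C => t y z; rewrite (le_trans (HC _ _))// ler_wpM2l// ler_expR.
    rewrite -mulrA ler_wpM2l ?(ltW th0)// ler_pdivrMl//.
    have : nu t z ^+ 2 <= S z ^+ 2.
      rewrite -[nu t z ^+ 2]real_normK ?num_real// lerXn2r ?nnegrE//.
      exact: le_trans (nuS t z).
    have := sqr_ge0 (y - nu t z); nra.
elim: n g gn => [|n IH] g gn; first by split => //; exact: (adm_comp 0%N).
split; first exact: (adm_comp n.+1).
case: gn => _ [g' [dg gn]]; exists (fun t y z => g' (tau t z) (y + nu t z) tt); split.
  move=> t y z.
  have := dg (tau t z) (y + nu t z) tt => dg1.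
  have h : is_derive y 1 (fun x : R => x + nu t z) (1 + 0) by apply: is_deriveD.
  have := @is_derive1_comp R (g (tau t z)) (fun x => x + nu t z) y _ _ dg1 h.
  by rewrite addr0 mulr1.
apply: (IH (fun t y => g' t y tt)).
by rewrite /dadm (_ : (fun _ _ _ => _) = g')//; apply/funext => t;
  apply/funext => y; apply/funext => -[].
Qed.

End composition.

Section time_integral.
Context {R : realType} (T : R).
Hypothesis T0 : 0 < T.
Local Notation mu := (@lebesgue_measure R).

(** A continuous retraction onto [[0, T]]: composing with it turns data given on the interval into
    continuous functions on the line. *)
Definition clamp (t : R) : R := Num.max 0 (Num.min t T).

Lemma clamp_itv t : 0 <= clamp t <= T.
Proof.
by rewrite /clamp le_max lexx/= ge_max (ltW T0)/= ge_min lexx orbT.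
Qed.

Lemma clamp_id t : 0 <= t <= T -> clamp t = t.
Proof. by case/andP=> t0 tT; rewrite /clamp min_l// max_r. Qed.

Lemma clamp_continuous : continuous clamp.
Proof.
apply: continuous_maxr; first exact: cst_continuous.
by apply: continuous_minr; [move=> ?; exact: cvg_id|exact: cst_continuous].
Qed.

Context d (Z : measurableType d) (N : R -> Z -> R) (S : Z -> R).
Hypothesis cN : forall z, continuous (N ^~ z).
Hypothesis mN : forall s, measurable_fun setT (N s).
Hypothesis NS : forall s t z, `|N s z - N t z| <= S z.

Definition time_integral (g : R -> R -> R) (t y : R) (z : Z) : R :=
  \int[mu]_(s in `[clamp t, T]) g s (y + (N s z - N (clamp t) z)).

(* Freezing the integrand before time [clamp t] makes the domain of integration independent of [t]. *)
Lemma time_integralE g t y z : seqcont g ->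
  time_integral g t y z = \int[mu]_(s in `[0, T])
    g (Num.max s (clamp t)) (y + (N (Num.max s (clamp t)) z - N (clamp t) z))
   - clamp t * g (clamp t) y.
Proof.
move=> cg; have /andP[t0 tT] := clamp_itv t.
set k := fun s => g (Num.max s (clamp t)) _.
have ck : continuous k.
  have cm : continuous (fun s : R => Num.max s (clamp t)).
    by apply: continuous_maxr; [move=> ?; exact: cvg_id|exact: cst_continuous].
  apply: seqcont_path => //; apply: continuous_addr; first exact: cst_continuous.
  have cNm : continuous (fun s => N (Num.max s (clamp t)) z) := continuous_compR cm (@cN z).
  by apply: continuous_subr; [exact: cNm|exact: cst_continuous].
have [K [_ KE]] := continuous_antiderivative ck.
have lt1 : -1 < clamp t by rewrite (lt_le_trans _ t0)// ltrN10.
have -> : time_integral g t y z = \int[mu]_(s in `[clamp t, T]) k s.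
  apply: eq_Rintegral => s; rewrite inE/= in_itv/= => /andP[ts _].
  by rewrite /k max_l.
have -> : clamp t * g (clamp t) y = \int[mu]_(s in `[0, clamp t]) k s.
  rewrite (_ : \int[mu]_(s in _) _ = \int[mu]_(s in `[0, clamp t]) g (clamp t) y).
    have [r _ ->] := @Rintegral_mean _ (cst (g (clamp t) y)) 0 (clamp t)
      (@cst_continuous _ _ _) (ltrN10 _) t0.
    by rewrite subr0 mulrC.
  apply: eq_Rintegral => s; rewrite inE/= in_itv/= => /andP[_ ts].
  by rewrite /k max_r// subrr addr0.
rewrite !KE ?ltrN10 ?(ltW T0)//; ring.
Qed.

(** Once the domain of integration is fixed, the integrand is a composition with a path over the
    space [Z * R], and the time coordinate is integrated out as if it were random. *)
Lemma sadm_time_integral n g : dadm n g -> sadm S n (time_integral g).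
Proof.
move=> gn; have cg := dadm_seqcont gn.
have cm (s : R) : continuous (fun t : R => Num.max s (clamp t)).
  by apply: continuous_maxr; [exact: cst_continuous|exact: clamp_continuous].
rewrite (_ : time_integral g = fun t y z => \int[mu]_(s in `[0, T])
    (fun t y (zs : Z * R) => g (Num.max zs.2 (clamp t))
       (y + (N (Num.max zs.2 (clamp t)) zs.1 - N (clamp t) zs.1))) t y (z, s)
   - clamp t * g (clamp t) (y + 0)); last first.
  apply/funext => t; apply/funext => y; apply/funext => z.
  by rewrite time_integralE// addr0.
apply: sadmB; last first.
  apply: sadmM.
    apply: (@sadm_time _ _ _ _ n clamp T); first exact: clamp_continuous.
    by move=> t; have /andP[? ?] := clamp_itv t; rewrite ger0_norm.
  apply: (sadm_comp (tau := fun t _ => clamp t) (nu := fun _ _ => 0)) => //.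
  - by move=> z; exact: clamp_continuous.
  - by move=> z; exact: cst_continuous.
  - by move=> t z; rewrite normr0 (le_trans _ (NS 0 0 z)).
(* The time coordinate contributes range 0, so any exponent is integrable over [[0, T]]; 1 is
   taken. *)
refine (@sadm_integral R _ _ Z _ mu `[0, T]%classic (measurable_itv _) S (fun=> 0)
  (fun zs => S zs.1) 1 _ _ _ _ n (fun t y (zs : Z * R) => g (Num.max zs.2 (clamp t))
       (y + (N (Num.max zs.2 (clamp t)) zs.1 - N (clamp t) zs.1))) _) => //.
- by move=> z1 z2 /=; rewrite lerDl sqr_ge0.
- rewrite expr0n/= mulr0 expR0.
  apply: (continuous_itv_integrable 0 T (k := cst 1)); exact: cst_continuous.
apply: sadm_comp => //.
- move=> [z s] /=; apply: continuous_subr; first exact: (continuous_compR (cm s) (@cN z)).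
  exact: (continuous_compR clamp_continuous (@cN z)).
- by move=> t; apply: measurable_maxr => //; exact: measurable_cst.
- move=> t; apply: measurable_funB; last by apply: measurableT_comp.
  apply: (caratheodory_measurable (h := fun s z => N (Num.max s (clamp t)) z)) => //.
  have cm' : continuous (fun s : R => Num.max s (clamp t)).
    by apply: continuous_maxr; [move=> ?; exact: cvg_id|exact: cst_continuous].
  by move=> z; exact: (continuous_compR cm' (@cN z)).
Qed.

End time_integral.

Section exponential.
Context {R : realType} d (Z : measurableType d) (S : Z -> R).
Variables h1 h2 : R -> R -> Z -> R.
Hypothesis h1_le0 : forall t y z, h1 t y z <= 0.
Hypothesis sh1 : forall n, sadm S n h1.
Hypothesis sh2 : forall n, sadm S n h2.

Lemma adm_bounded (k : R -> R -> Z -> R) : (forall t y, measurable_fun setT (k t y)) ->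
  (forall z, seqcont (fun t y => k t y z)) -> (forall t y z, `|k t y z| <= 1) -> adm S k.
Proof.
move=> mk ck k1; split => // th th0; exists 1 => t y z; rewrite mul1r (le_trans (k1 _ _ _))//.
by rewrite -expR0 ler_expR mulr_ge0 ?(ltW th0)// addr_ge0// sqr_ge0.
Qed.

Let expcos t y z := expR (h1 t y z) * cos (h2 t y z).
Let expsin t y z := expR (h1 t y z) * sin (h2 t y z).

(** The sign of [h1] bounds the exponential by 1, and differentiation only multiplies by derivatives
    of [h1] and [h2], which stay in the class. Each component occurs in the derivative of the other,
    hence the joint induction. *)
Lemma sadm_exp n : sadm S n expcos /\ sadm S n expsin.
Proof.
have [mh1 ch1 _] := sadm_adm (sh1 0); have [mh2 ch2 _] := sadm_adm (sh2 0).
have le1 (u v : R) : u <= 0 -> `|v| <= 1 -> `|expR u * v| <= 1.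
  move=> u0 v1; rewrite normrM -[leRHS]mulr1 ler_pM// ger0_norm ?expR_ge0//.
  by rewrite -expR0 ler_expR.
have aC : adm S expcos.
  apply: adm_bounded => [t y|z tn yn t y tnt yny|t y z].
  - apply: measurable_funM; apply: measurableT_comp => //.
    by apply: continuous_measurable_fun; exact: continuous_cos.
  - apply: cvgM; first exact: (cvg_comp _ _ (ch1 z _ _ _ _ tnt yny) (@continuous_expR R _)).
    exact: (cvg_comp _ _ (ch2 z _ _ _ _ tnt yny) (@continuous_cos R _)).
  - by apply: le1 => //; exact: cos_max.
have aS : adm S expsin.
  apply: adm_bounded => [t y|z tn yn t y tnt yny|t y z].
  - apply: measurable_funM; apply: measurableT_comp => //.
    by apply: continuous_measurable_fun; exact: continuous_sin.
  - apply: cvgM; first exact: (cvg_comp _ _ (ch1 z _ _ _ _ tnt yny) (@continuous_expR R _)).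
    exact: (cvg_comp _ _ (ch2 z _ _ _ _ tnt yny) (@continuous_sin R _)).
  - by apply: le1 => //; exact: sin_max.
elim: n => [|n [IHc IHs]]; first by split.
have [_ [h1' [dh1 sh1']]] := sh1 n.+1; have [_ [h2' [dh2 sh2']]] := sh2 n.+1.
have dexp (t y : R) (z : Z) : is_derive y 1 (fun x : R => expR (h1 t x z)) (expR (h1 t y z) * h1' t y z).
  exact: (@is_derive1_comp R expR (fun x => h1 t x z) y _ _ (is_derive_expR _) (dh1 t y z)).
have dcos (t y : R) (z : Z) : is_derive y 1 (fun x : R => cos (h2 t x z)) (- sin (h2 t y z) * h2' t y z).
  exact: (@is_derive1_comp R cos (fun x => h2 t x z) y _ _ (is_derive_cos _) (dh2 t y z)).
have dsin (t y : R) (z : Z) : is_derive y 1 (fun x : R => sin (h2 t x z)) (cos (h2 t y z) * h2' t y z).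
  exact: (@is_derive1_comp R sin (fun x => h2 t x z) y _ _ (is_derive_sin _) (dh2 t y z)).
split; split => //.
- exists (fun t y z => h1' t y z * expcos t y z - h2' t y z * expsin t y z); split.
    move=> t y z; apply: (is_derive_eq (is_deriveM (dexp t y z) (dcos t y z))).
    by rewrite /GRing.scale/= /expcos /expsin; ring.
  by apply: sadmB; apply: sadmM.
- exists (fun t y z => h1' t y z * expsin t y z + h2' t y z * expcos t y z); split.
    move=> t y z; apply: (is_derive_eq (is_deriveM (dexp t y z) (dsin t y z))).
    by rewrite /GRing.scale/= /expcos /expsin; ring.
  by apply: sadmD; apply: sadmM.
Qed.

End exponential.

(** * Exponential integrability of the Brownian path *)

Section normal_moments.
Context {R : realType}.
Local Notation mu := (@lebesgue_measure R).

(** The Radon-Nikodym derivative of [normal_prob] agrees almost everywhere with the Gaussian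
    density, since both have the same integral over every measurable set. *)
Lemma integral_normal_prob (sg : R) (f : R -> \bar R) :
  measurable_fun setT f -> (forall x, 0 <= f x)%E ->
  (\int[normal_prob 0%R sg]_x f x = \int[mu]_x (f x * (normal_pdf 0%R sg x)%:E))%E.
Proof.
move=> mf f0; have dom := @normal_prob_dominates R 0 sg.
rewrite -(Radon_Nikodym_SigmaFinite.change_of_variables dom)//.
apply: ae_eq_integral => //.
- apply: emeasurable_funM => //.
  exact: (measurable_int _ (Radon_Nikodym_SigmaFinite.f_integrable dom)).
- by apply: emeasurable_funM => //; apply/measurable_EFinP; exact: measurable_normal_pdf.
apply: ae_eqe_mul2l.
apply: integral_ae_eq => //.
- exact: Radon_Nikodym_SigmaFinite.f_integrable.
- by apply/measurable_EFinP; exact: measurable_normal_pdf.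
- by move=> A _ mA; rewrite -Radon_Nikodym_SigmaFinite.f_integral.
Qed.

Lemma ge0_integral_opp (f : R -> \bar R) : measurable_fun setT f ->
  (forall x, 0 <= f x)%E -> (\int[mu]_x f (- x)%R = \int[mu]_x f x)%E.
Proof.
move=> mf f0.
have := @ge0_integral_pushforward _ _ (measurableTypeR R) (measurableTypeR R) R -%R
  (@oppr_measurable R setT) mu setT f measurableT mf (fun x _ => f0 x).
rewrite preimage_setT => <-.
by apply: eq_measure_integral => //= A mA _; exact: lebesgue_measureN.
Qed.

Lemma normal_peakE (s : R) : 0 < s -> normal_peak s = (s * Num.sqrt (pi *+ 2))^-1.
Proof.
move=> s0; rewrite /normal_peak -mulrnAr sqrtrM ?sqr_ge0// sqrtr_sqr gtr0_norm//.
Qed.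

(** The factor turns the density of deviation [s] into [r] times the density of deviation [r * s],
    whose mass is 1. This single family of identities provides both exponential integrability and
    the variance. *)
Lemma normal_exp_tilt (s r : R) : 0 < s -> 0 < r ->
  (\int[normal_prob 0%R s]_x (expR (x ^+ 2 * ((1 - r ^- 2) / (2 * s ^+ 2))))%:E = r%:E)%E.
Proof.
move=> s0 r0; rewrite integral_normal_prob; last 2 first.
- by apply/measurable_EFinP/measurableT_comp => //; apply: measurable_funM => //;
    exact: measurable_funX.
- by move=> x; rewrite lee_fin expR_ge0.
have rs0 : r * s != 0 by rewrite mulf_neq0// gt_eqF.
transitivity (\int[mu]_x (r%:E * (normal_pdf 0%R (r * s)%R x)%:E))%E; last first.
  rewrite ge0_integralZl//; last 3 first.
  - by apply/measurable_EFinP; exact: measurable_normal_pdf.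
  - by move=> x _; rewrite lee_fin normal_pdf_ge0.
  - by rewrite lee_fin ltW.
  by rewrite integral_normal_pdf mule1.
apply: eq_integral; move=> x _; rewrite !normal_pdfE ?(gt_eqF s0)// -!EFinM; congr EFin.
rewrite !normal_peakE ?mulr_gt0// /normal_fun subr0 mulrCA -expRD mulrA.
rewrite [RHS]mulrA; congr (_ * expR _); last by field; rewrite !gt_eqF.
have h0 : Num.sqrt (pi *+ 2) != 0 :> R by rewrite sqrtr_eq0 -ltNge mulrn_wgt0// pi_gt0.
by field; rewrite h0 !gt_eqF.
Qed.

Context d (Om : measurableType d) (P : probability Om R) (X : Om -> R) (s : R).
Hypothesis mX : measurable_fun setT X.
Hypothesis s0 : 0 < s.
Hypothesis lawX : forall B : set R, measurable B ->
  P [set w | X w \in B] = normal_prob 0 s B.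

Lemma ge0_integral_normal (f : R -> \bar R) : measurable_fun setT f ->
  (forall x, 0 <= f x)%E ->
  (\int[P]_w f (X w) = \int[normal_prob 0%R s]_x f x)%E.
Proof.
move=> mf f0; have := @ge0_integral_pushforward _ _ _ (measurableTypeR R) R X mX P setT f measurableT mf (fun x _ => f0 x).
rewrite preimage_setT => <-.
apply: eq_measure_integral => //= A mA _; rewrite -lawX// /pushforward.
by congr (P _); apply/seteqP; split => w /=; rewrite inE.
Qed.

Lemma normal_exp_tilt_integral (r : R) : 0 < r ->
  (\int[P]_w (expR (X w ^+ 2 * ((1 - r ^- 2) / (2 * s ^+ 2))))%:E = r%:E)%E.
Proof.
move=> r0; rewrite -(normal_exp_tilt s0 r0).
apply: (ge0_integral_normal (f := fun x => (expR (x ^+ 2 * ((1 - r ^- 2) / (2 * s ^+ 2))))%:E)) => [|x].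
- by apply/measurable_EFinP/measurableT_comp => //; apply: measurable_funM => //;
    exact: measurable_funX.
- by rewrite lee_fin expR_ge0.
Qed.

(** The tilt with [r = sqrt 2], whose exponent is a convenient positive one. *)
Let tiltE : (1 - (Num.sqrt 2) ^- 2) / (2 * s ^+ 2) = (4 * s ^+ 2)^-1 :> R.
Proof. by rewrite sqr_sqrtr ?ler0n//; field; rewrite gt_eqF. Qed.

Lemma normal_exp_integrable : P.-integrable setT
  (fun w => (expR (X w ^+ 2 / (4 * s ^+ 2)))%:E).
Proof.
apply/integrableP; split.
  apply/measurable_EFinP/measurableT_comp => //; apply: measurable_funM => //.
  exact: measurable_funX.
under eq_integral do rewrite gee0_abs ?lee_fin ?expR_ge0// -tiltE.
by rewrite normal_exp_tilt_integral ?ltry// sqrtr_gt0 ltr0n.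
Qed.

Lemma normal_exp_Rintegral : \int[P]_w expR (X w ^+ 2 / (4 * s ^+ 2)) = Num.sqrt 2.
Proof.
by rewrite /Rintegral -tiltE normal_exp_tilt_integral.
Qed.

Lemma sqr_le_4expR (u : R) : 0 <= u -> u ^+ 2 <= 4 * expR u.
Proof.
move=> u0; have := expR_ge1Dx (u / 2).
have -> : expR u = expR (u / 2) ^+ 2 by rewrite expr2 -expRD -splitr.
 set v := expR _ => h.
have := sqr_ge0 (v - (1 + u / 2)); nra.
Qed.

(** The fourth power costs only half of the integrable exponent [1 / (4 s^2)]; chaining spends the
    other half on a further exponential. *)
Lemma normal_pow4_bound (w : Om) :
  X w ^+ 4 <= 2 ^+ 8 * s ^+ 4 * expR (X w ^+ 2 / (8 * s ^+ 2)).
Proof.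
have := @sqr_le_4expR (X w ^+ 2 / (8 * s ^+ 2)).
have s2 : 0 < 8 * s ^+ 2 by rewrite mulr_gt0// exprn_gt0.
rewrite divr_ge0 ?sqr_ge0 ?(ltW s2)// => /(_ isT).
rewrite expr_div_n ler_pdivrMr ?exprn_gt0// -exprM exprMn -exprM /=.
have -> : 8 ^+ 2 = 64 :> R by ring.
move=> h; apply: le_trans h _; rewrite le_eqVlt; apply/orP; left; apply/eqP; ring.
Qed.

Lemma normal_second_integrable : P.-integrable setT (fun w => (X w ^+ 2)%:E).
Proof.
apply: (dominated_integrable_real measurableT (g := fun w =>
   (4 * s ^+ 2) * expR (X w ^+ 2 / (4 * s ^+ 2)))).
- exact: measurable_funX.
- move=> w _; rewrite ger0_norm ?sqr_ge0// mulrC -ler_pdivrMr ?mulr_gt0 ?exprn_gt0//.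
  by rewrite (le_trans _ (expR_ge1Dx _))// lerDr.
- by apply: integrable_scale => //; exact: normal_exp_integrable.
Qed.

Lemma normal_first_integrable : P.-integrable setT (fun w => (X w)%:E).
Proof.
apply: (dominated_integrable_real measurableT (g := fun w => 1 + X w ^+ 2)).
- exact: mX.
- by move=> w _; have := real_normK (num_real (X w)); have := normr_ge0 (X w); nra.
- rewrite (_ : _ \o _ = (fun w => 1%:E + (X w ^+ 2)%:E)%E)//.
  apply: integrableD => //; last exact: normal_second_integrable.
  exact: finite_measure_integrable_cst.
Qed.

Lemma normal_mean0 : \int[P]_w X w = 0.
Proof.
rewrite /Rintegral integralE.
have mf (g : R -> R) : measurable_fun setT g -> measurable_fun setT (fun x => (g x)%:E).
  by move=> ?; exact/measurable_EFinP.
have m1 : measurable_fun setT (fun x : R => (Num.max x 0)%:E).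
  by apply: mf; apply: measurable_maxr => //; exact: measurable_cst.
have m2 : measurable_fun setT (fun x : R => (Num.max (- x) 0)%:E).
  by apply: mf; apply: measurable_maxr => //; exact: measurable_cst.
have p1 (x : R) : (0 <= (Num.max x 0)%:E)%E by rewrite lee_fin le_max lexx orbT.
have p2 (x : R) : (0 <= (Num.max (- x) 0)%:E)%E by rewrite lee_fin le_max lexx orbT.
have -> : (\int[P]_w (fun w => (X w)%:E)^\+ w = \int[normal_prob 0%R s]_x (Num.max x 0)%:E)%E.
  rewrite -(ge0_integral_normal m1 p1); apply: eq_integral => w _.
  by rewrite funeposE -EFin_max.
have -> : (\int[P]_w (fun w => (X w)%:E)^\- w = \int[normal_prob 0%R s]_x (Num.max x 0)%:E)%E.
  transitivity (\int[normal_prob 0%R s]_x (Num.max (- x) 0)%:E)%E.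
    rewrite -(ge0_integral_normal m2 p2); apply: eq_integral => w _.
    by rewrite funenegE -EFinN -EFin_max.
  rewrite !integral_normal_prob// -[RHS]ge0_integral_opp.
  - apply: eq_integral => x _; congr (_ * _%:E)%E.
    by rewrite !normal_pdfE ?gt_eqF// /normal_fun !subr0 sqrrN.
  - by apply: emeasurable_funM => //; apply: mf; exact: measurable_normal_pdf.
  - by move=> x; rewrite mule_ge0// lee_fin normal_pdf_ge0.
set i := integral _ _ _.
(* Both parts have the same integral [i], by symmetry of the density. If [i] is infinite, [fine]
   sends the infinite difference to 0 as well. *)
have : i \is a fin_num \/ i = +oo%E.
  have : (0 <= i)%E by apply: integral_ge0.
  by case: i => [r| |]; [left|right|].
by case=> [ifin|->//]; rewrite subee.
Qed.

(** Integrating [1 + u <= exp u] against the tilt gives, for the second moment [V], an inequality in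
    [r] which is an equality at [r = 1]. Letting [r] approach 1 from above and from below compares
    the first-order terms and yields the two bounds on [V / s^2]. *)
Lemma normal_variance : \int[P]_w X w ^+ 2 = s ^+ 2.
Proof.
set V := \int[P]_w X w ^+ 2.
have key (r : R) : 0 < r -> 1 + V * ((1 - r ^- 2) / (2 * s ^+ 2)) <= r.
  move=> r0; set k := _ / _.
  have fin : P.-integrable setT (fun w => (expR (X w ^+ 2 * k))%:E).
    apply/integrableP; split.
      by apply/measurable_EFinP/measurableT_comp => //; apply: measurable_funM => //;
         exact: measurable_funX.
    under eq_integral do rewrite gee0_abs ?lee_fin ?expR_ge0//.
    by rewrite normal_exp_tilt_integral// ltry.
  have i2 : P.-integrable setT (fun w => (k * X w ^+ 2)%:E).
    exact: (integrable_scale measurableT k normal_second_integrable).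
  have i1 : P.-integrable setT (EFin \o (fun w : Om => 1 : R)).
    exact: finite_measure_integrable_cst.
  have -> : 1 + V * k = \int[P]_w (1 + k * X w ^+ 2).
    rewrite RintegralD// RintegralZl//; last exact: normal_second_integrable.
    have -> : \int[P]_w 1 = 1 by rewrite /Rintegral integral_cst// mul1e [X in fine X]probability_setT.
    by rewrite (mulrC k).
  have -> : r = \int[P]_w expR (X w ^+ 2 * k).
    by rewrite /Rintegral normal_exp_tilt_integral.
  apply: le_Rintegral => //.
    rewrite (_ : _ \o _ = (fun w => 1%:E + (k * X w ^+ 2)%:E)%E)//.
    exact: integrableD.
  by move=> w _; rewrite mulrC; exact: expR_ge1Dx.
pose v := V / s ^+ 2.
have s2 : 0 < s ^+ 2 by rewrite exprn_gt0.
have key' (r : R) : 0 < r -> v * (r ^+ 2 - 1) <= 2 * r ^+ 2 * (r - 1).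
  move=> r0; have r2 : 0 < 2 * r ^+ 2 by rewrite mulr_gt0// exprn_gt0.
  have := key r r0; rewrite -lerBrDl -(ler_pM2l r2); apply: le_trans.
  rewrite le_eqVlt; apply/orP; left; apply/eqP.
  by rewrite /v; field; rewrite !gt_eqF.
suff v1 : v = 1 by rewrite -[V](divfK (lt0r_neq0 s2)) -/v v1 mul1r.
have v0 : 0 <= v.
  rewrite divr_ge0 ?(ltW s2)//; apply: Rintegral_ge0 => w _; exact: sqr_ge0.
have up (e : R) : 0 < e -> v * (2 + e) <= 2 * (1 + e) ^+ 2.
  move=> e0; have := key' (1 + e); rewrite addr_gt0// => /(_ isT) h.
  rewrite -(ler_pM2r e0); move: h; congr (_ <= _); ring.
have lo (e : R) : 0 < e -> e < 1 -> 2 * (1 - e) ^+ 2 <= v * (2 - e).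
  move=> e0 e1; have := key' (1 - e); rewrite subr_gt0 e1 => /(_ isT) h.
  rewrite -(ler_pM2r e0) -lerN2; move: h; congr (_ <= _); ring.
apply/eqP; rewrite eq_le; apply/andP; split; rewrite leNgt; apply/negP => hv.
  (* So small that the gap [2 (v - 1)] exceeds all terms of order [e] in the inequality. *)
  have e0 : 0 < (v - 1) / (v + 10) by rewrite divr_gt0 ?subr_gt0// ltr_wpDl.
  have e1 : (v - 1) / (v + 10) < 1 by rewrite ltr_pdivrMr ?ltr_wpDl// mul1r; lra.
  have := up _ e0; move: e0 e1; set e := _ / _ => e0 e1.
  have ee : e * (v + 10) = v - 1 by rewrite /e divfK// gt_eqF// ltr_wpDl.
  nra.
have e0 : 0 < (1 - v) / 10 by rewrite divr_gt0 ?subr_gt0.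
have e1 : (1 - v) / 10 < 1 by rewrite ltr_pdivrMr// mul1r; lra.
have := lo _ e0 e1; move: e0 e1; set e := _ / _ => e0 e1.
have ee : e * 10 = 1 - v by rewrite /e divfK// gt_eqF.
nra.
Qed.

End normal_moments.

Lemma within_continuous_compose (T1 T2 U : topologicalType) (A : set T1)
    (f : T1 -> U) (h : T2 -> T1) :
  {within A, continuous f} -> continuous h -> (forall x, A (h x)) ->
  continuous (fun x => f (h x)).
Proof.
move=> /subspace_continuousP cf ch Ah x.
suff hw : h y @[y --> x] --> within A (nbhs (h x)) by exact: (cvg_comp _ _ hw (cf _ (Ah x))).
move=> V hV; have : nbhs x (h @^-1` [set y | A y -> V y]) by exact: (ch x _ hV).
by apply: filterS => y; apply; exact: Ah.
Qed.

Lemma cvgn_le_bound (R : realType) (u : nat -> R) (l M : R) :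
  u n @[n --> \oo] --> l -> (forall n, u n <= M) -> l <= M.
Proof.
move=> ul uM; rewrite -(cvg_lim (@Rhausdorff R) ul).
by apply: limr_le; [apply/cvg_ex; exists l|exact: nearW].
Qed.

Section dyadic.
Context {R : realType} (T : R).
Hypothesis T0 : 0 < T.

Definition dyadic (n j : nat) : R := T * j%:R / 2 ^+ n.

Lemma dyadic_itv n j : (j <= 2 ^ n)%N -> 0 <= dyadic n j <= T.
Proof.
move=> jn; have p : 0 < 2 ^+ n :> R by rewrite exprn_gt0.
rewrite /dyadic divr_ge0 ?mulr_ge0 ?(ltW T0) ?(ltW p)//= ler_pdivrMr// ler_pM2l//.
by rewrite -natrX ler_nat.
Qed.

Lemma dyadicS n j : dyadic n.+1 j.*2 = dyadic n j.
Proof.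
rewrite /dyadic -mul2n natrM exprS; field.
by rewrite expf_neq0.
Qed.

Lemma dyadic_step n j : dyadic n j.+1 - dyadic n j = T / 2 ^+ n.
Proof. by rewrite /dyadic -natr1; field; rewrite expf_neq0. Qed.

Lemma dyadic_approx (s : R) : 0 <= s <= T -> exists j : nat -> nat,
  (forall n, (j n <= 2 ^ n)%N) /\ dyadic n (j n) @[n --> \oo] --> s.
Proof.
move=> /andP[s0 sT].
pose j n := Num.truncn (2 ^+ n * s / T).
have p n : 0 < 2 ^+ n :> R by rewrite exprn_gt0.
have arg0 n : 0 <= 2 ^+ n * s / T by rewrite divr_ge0 ?mulr_ge0 ?(ltW T0) ?(ltW (p n)).
have jn n : (j n <= 2 ^ n)%N.
  rewrite -(ler_nat R) (le_trans (_ : _ <= 2 ^+ n * s / T))//.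
    by rewrite truncn_le.
  by rewrite natrX ler_pdivrMr// ler_pM2l.
exists j; split => //.
  have Tgeo : T * 2^-1 ^+ n @[n --> \oo] --> (0 : R).
    by apply: (@cvg_geometric R T 2^-1); rewrite ger0_norm ?invr_ge0// invf_lt1// ltr1n.
  apply/cvgrPdist_lt => e e0; near=> n.
  have nT : T * 2^-1 ^+ n < e.
    near: n; exact: (cvgr_lt 0 Tgeo).
  rewrite (le_lt_trans _ nT)// exprVn.
  have -> : s - dyadic n (j n) = T / 2 ^+ n * (2 ^+ n * s / T - (j n)%:R).
    by rewrite /dyadic; field; rewrite expf_neq0// gt_eqF.
  rewrite normrM ger0_norm ?divr_ge0 ?(ltW T0) ?(ltW (p n))//.
  rewrite ler_piMr// ?divr_ge0 ?(ltW T0) ?(ltW (p n))//.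
  have := truncn_le (2 ^+ n * s / T); have := truncnS_gt (2 ^+ n * s / T).
  rewrite arg0 -[(Num.truncn _).+1%:R]natr1 => h1 h2; rewrite ger0_norm ?subr_ge0// lerBlDl; exact: (ltW h1).
Unshelve. all: by end_near. Qed.

Lemma dyadic_dense (w : R -> R) (l : R) : continuous w ->
  (forall n j, (j <= 2 ^ n)%N -> `|w (dyadic n j)| <= l) ->
  forall s, 0 <= s <= T -> `|w s| <= l.
Proof.
move=> cw wl s sI; have [j [jn ds]] := dyadic_approx sI.
have ws : `|w (dyadic n (j n))| @[n --> \oo] --> `|w s|.
  by apply: cvg_norm; exact: (cvg_comp _ _ ds (cw s)).
by apply: (cvgn_le_bound ws) => n; exact: wl.
Qed.

(* Chaining: the increments over dyadic intervals of level [n] are allowed to be as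
   large as [l * (9/10)^n / 10], and these weights sum to [l]. *)
Lemma dyadic_chaining (w : R -> R) (l : R) : continuous w -> w 0 = 0 -> 0 <= l ->
  (forall n j, (j < 2 ^ n)%N ->
     `|w (dyadic n j.+1) - w (dyadic n j)| <= l * ((9 / 10) ^+ n / 10)) ->
  forall s, 0 <= s <= T -> `|w s| <= l.
Proof.
move=> cw w0 l0 wl; apply: dyadic_dense => // n j jn.
(* The partial sum of the weights up to level [n]; this sharper bound is what the induction
   carries. *)
apply: le_trans (_ : l * (1 - (9 / 10) ^+ n.+1) <= _); last first.
  by rewrite ler_piMr// lerBlDr lerDl exprn_ge0.
elim: n j jn => [|n IH] j.
  rewrite expn0; case: j => [|[|//]] _.
    rewrite /dyadic mulr0 mul0r w0 normr0 mulr_ge0// subr_ge0 exprn_ile1//; lra.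
  have := wl 0%N 0%N isT; rewrite {2}/dyadic mulr0 mul0r w0 subr0 => h.
  rewrite (le_trans h)// ler_wpM2l// expr0; lra.
(* An even index already belongs to the previous level; an odd one is a single increment away from
   its left neighbour there. *)
rewrite -(odd_double_half j); set i := j./2; case: (odd j) => /= ji; last first.
  rewrite add0n dyadicS (le_trans (IH _ _))//.
    by move: ji; rewrite add0n expnS -mul2n leq_pmul2l.
  rewrite ler_wpM2l// lerD2l lerN2 [leLHS]exprS ler_piMl ?exprn_ge0//; lra.
have i2 : (i < 2 ^ n)%N by move: ji; rewrite add1n expnS -mul2n ltn_pmul2l.
rewrite add1n; have := wl n.+1 i.*2.
rewrite expnS -mul2n ltn_pmul2l// mul2n i2 dyadicS => /(_ isT) h1.
have h2 := IH i (ltnW i2).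
rewrite -[w _](subrK (w (dyadic n i))) (le_trans (ler_normD _ _))//.
rewrite (le_trans (lerD h1 h2))// -mulrDr ler_wpM2l//.
rewrite (exprS _ n.+1) le_eqVlt; apply/orP; left; apply/eqP; by field.
Qed.

End dyadic.

Section supremum.
Context {R : realType} d (Om : measurableType d) (P : probability Om R).
Variables (T : R) (w : R -> Om -> R).
Hypothesis T0 : 0 < T.
Hypothesis cw : forall o, continuous (w ^~ o).
Hypothesis mw : forall s, measurable_fun setT (w s).
Hypothesis w0 : forall o, w 0 o = 0.
Hypothesis normal_incr : forall s t : R, 0 <= s -> s < t -> t <= T -> forall B : set R, measurable B ->
  P [set o | w t o - w s o \in B] = normal_prob 0 (Num.sqrt (t - s)) B.

(** Invalid codes give 0, which is itself a point of [[0, T]], so the enumeration never leaves the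
    interval. *)
Definition dyadic_enum (k : nat) : R :=
  if unpickle k is Some (n, j) then if (j <= 2 ^ n)%N then dyadic T n j else 0 else 0.

Lemma dyadic_enum_itv k : 0 <= dyadic_enum k <= T.
Proof.
rewrite /dyadic_enum; case: unpickle => [[n j]|]; last by rewrite lexx ltW.
by case: ifPn => [/dyadic_itv|_]; [exact|rewrite lexx ltW].
Qed.

(** A countable supremum, hence measurable; by continuity of the path it bounds the path on all of
    [[0, T]]. *)
Definition path_sup (o : Om) : R := sups (fun k => `|w (dyadic_enum k) o|) 0.

Let path_ubound o : has_ubound (range (fun k => `|w (dyadic_enum k) o|)).
Proof.
have cn : {within `[0, T], continuous (fun s => `|w s o|)}.
  apply: continuous_subspaceT => s.
  by apply: (@continuous_comp _ _ _ (w ^~ o) Num.norm); [exact: cw|exact: norm_continuous].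
have [c _ cm] := EVT_max (ltW T0) cn.
by exists `|w c o| => _ [k _ <-]; apply: cm; rewrite in_itv/= dyadic_enum_itv.
Qed.

Lemma measurable_path_sup : measurable_fun setT path_sup.
Proof.
apply: measurable_fun_sups => [z _|m]; first exact: path_ubound.
exact: measurableT_comp.
Qed.

Lemma path_supE o : path_sup o = sup (range (fun k => `|w (dyadic_enum k) o|)).
Proof.
rewrite /path_sup /sups/=; congr sup; apply/seteqP; split => x [k].
  by move=> _ <-; exists k.
by move=> _ <-; exists k.
Qed.

Lemma path_sup_ge o s : 0 <= s <= T -> `|w s o| <= path_sup o.
Proof.
move=> sI; apply: (@dyadic_dense R T T0 (w ^~ o) (path_sup o) (@cw o) _ s sI) => n j jn.
rewrite path_supE; apply: ub_le_sup => //.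
by exists (pickle (n, j)) => //; rewrite /dyadic_enum pickleK jn.
Qed.

(** The factor [10^2] undoes the [1 / 10] in [lvl], and [(9/10)^2 >= 1/2]; hence
    [e0 (x / lvl n)^2 <= x^2 / (8 T / 2^n)], half of the exponent in [normal_exp_integrable] for an
    increment of level [n]. *)
Let e0 := (8 * 10 ^+ 2 * T)^-1.
Let e0_gt0 : 0 < e0. Proof. by rewrite invr_gt0 !mulr_gt0 ?exprn_gt0. Qed.
(** The fourth power yields a factor [4^-n] at level [n], which beats the [2^n] increments and the
    growth [(10/9)^(4n)] caused by the weights. *)
Let psi (x : R) := x ^+ 4 * expR (e0 * x ^+ 2).
Let lvl n : R := (9 / 10) ^+ n / 10.
Let incr n j o := w (dyadic T n j.+1) o - w (dyadic T n j) o.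

Let psi_ge0 x : 0 <= psi x.
Proof. by rewrite mulr_ge0 ?expR_ge0// (exprM _ 2 2) sqr_ge0. Qed.

Let psi_le (x y : R) : 0 <= x -> x <= `|y| -> psi x <= psi y.
Proof.
move=> x0 xy; have xy2 : x ^+ 2 <= y ^+ 2.
  by rewrite -[y ^+ 2]real_normK ?num_real// lerXn2r// nnegrE.
rewrite /psi ler_pM ?expR_ge0//.
- by rewrite exprn_ge0.
- by rewrite !(exprM _ 2 2) lerXn2r ?nnegrE ?sqr_ge0.
- by rewrite ler_expR ler_wpM2l// ltW.
Qed.

Let mincr n j : measurable_fun setT (incr n j).
Proof. exact: measurable_funB. Qed.

Let mpsi n j : measurable_fun setT (fun o => psi (incr n j o / lvl n)).
Proof.
have m1 : measurable_fun setT (fun o => incr n j o / lvl n) by apply: measurable_funM.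
apply: measurable_funM; first exact: measurable_funX.
by apply: measurableT_comp => //; apply: measurable_funM => //; exact: measurable_funX.
Qed.

Let Psi n o := (\sum_(j < 2 ^ n) (psi (incr n j o / lvl n))%:E)%E.

Let lvl_gt0 n : 0 < lvl n. Proof. by rewrite divr_gt0// exprn_gt0// divr_gt0. Qed.

Let psi_bound n j : (j < 2 ^ n)%N ->
  (\int[P]_o (psi (incr n j o / lvl n))%:E <=
    (2 ^+ 9 * T ^+ 2 * 10 ^+ 4 * ((10 / 9) ^+ 4 / 4) ^+ n)%:E)%E.
Proof.
move=> jn; set s := Num.sqrt (T / 2 ^+ n).
have p n' : 0 < 2 ^+ n' :> R by rewrite exprn_gt0.
have s0 : 0 < s by rewrite sqrtr_gt0 divr_gt0.
have s2 : s ^+ 2 = T / 2 ^+ n by rewrite sqr_sqrtr// divr_ge0 ?ltW.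
have law B : measurable B -> P [set o | incr n j o \in B] = normal_prob 0 s B.
  move=> mB; have /andP[d0 _] := dyadic_itv T0 (ltnW jn).
  have /andP[_ dT] := dyadic_itv T0 jn.
  rewrite /s -(dyadic_step T n j); apply: normal_incr => //.
  by rewrite -subr_gt0 dyadic_step divr_gt0.
have bnd o : psi (incr n j o / lvl n) <=
    2 ^+ 8 * s ^+ 4 / lvl n ^+ 4 * expR (incr n j o ^+ 2 / (4 * s ^+ 2)).
  rewrite /psi expr_div_n mulrAC [leRHS]mulrAC ler_wpM2r ?invr_ge0 ?exprn_ge0 ?(ltW (lvl_gt0 n))//.
  (* Half of the exponent absorbs the fourth power, the other half the exponential in [psi]. *)
  apply: le_trans (_ : 2 ^+ 8 * s ^+ 4 * expR (incr n j o ^+ 2 / (8 * s ^+ 2)) *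
     expR (incr n j o ^+ 2 / (8 * s ^+ 2)) <= _); last first.
    rewrite -mulrA -expRD le_eqVlt; apply/orP; left; apply/eqP; congr (_ * expR _).
    by field; rewrite gt_eqF.
  rewrite ler_pM ?expR_ge0//.
  - by rewrite (exprM _ 2 2) sqr_ge0.
  - exact: (normal_pow4_bound (incr n j) s0 o).
  - rewrite ler_expR expr_div_n mulrCA ler_wpM2l ?sqr_ge0// s2 /e0 /lvl.
    rewrite -invfM lef_pV2 ?posrE ?mulr_gt0 ?exprn_gt0 ?divr_gt0 ?exprn_gt0 ?divr_gt0//.
    rewrite -subr_ge0 (_ : _ - _ = 8 * T * (((9 / 10) ^+ 2) ^+ n - 2^-1 ^+ n)); last first.
      by rewrite -exprM mulnC exprM exprVn; field; rewrite expf_neq0.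
    have T8 : 0 <= 8 * T by rewrite mulr_ge0 ?(ltW T0).
    rewrite (mulr_ge0 T8)// subr_ge0 lerXn2r ?nnegrE//; lra.
have mf : measurable_fun setT (fun o => (psi (incr n j o / lvl n))%:E).
  by apply/measurable_EFinP; exact: mpsi.
apply: (@le_trans _ _ (\int[P]_o (2 ^+ 8 * s ^+ 4 / lvl n ^+ 4 *
   expR (incr n j o ^+ 2 / (4 * s ^+ 2)))%:E)%E).
  apply: ge0_le_integral => //.
  - by move=> o _; rewrite lee_fin.
  - apply/measurable_EFinP/measurable_funM => //; apply: measurableT_comp => //.
    by apply: measurable_funM => //; exact: measurable_funX.
  - by move=> o _; rewrite lee_fin.
have c0 : 0 <= 2 ^+ 8 * s ^+ 4 / lvl n ^+ 4.
  by rewrite divr_ge0 ?mulr_ge0 ?exprn_ge0// ltW.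
under eq_integral do rewrite EFinM.
rewrite ge0_integralZl//; last first.
  apply/measurable_EFinP/measurableT_comp => //.
  by apply: measurable_funM => //; exact: measurable_funX.
have i1 := normal_exp_integrable (mincr n j) s0 law.
rewrite -[integral _ _ _]fineK; last exact: (integrable_fin_num _ i1).
have -> : fine (\int[P]_o (expR (incr n j o ^+ 2 / (4 * s ^+ 2)))%:E)%E = Num.sqrt 2.
  exact: (normal_exp_Rintegral (mincr n j) s0 law).
rewrite -EFinM lee_fin.
apply: le_trans (_ : 2 ^+ 8 * s ^+ 4 / lvl n ^+ 4 * 2 <= _).
  rewrite ler_wpM2l// -(@ler_pXn2r _ 2)// ?nnegrE ?sqrtr_ge0// sqr_sqrtr//; lra.
rewrite le_eqVlt; apply/orP; left; apply/eqP.
rewrite (exprM s 2 2) s2 /lvl !expr_div_n -!exprM.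
rewrite (_ : 4 ^+ n = 2 ^+ n * 2 ^+ n :> R); last by rewrite -exprMn; congr (_ ^+ _); ring.
rewrite (mulnC n 4) !exprM.
by field; rewrite !expf_neq0.
Qed.

(** If every increment were within its weight for the level [|w s| / 2], chaining would give
    [|w s| <= |w s| / 2]. So some increment is too large, and its [psi] alone dominates; summing
    over all increments removes the dependence on which one it is. *)
Lemma psi_le_chaining o s : 0 <= s <= T ->
  ((psi (`|w s o| / 2))%:E <= \sum_(n <oo) Psi n o)%E.
Proof.
move=> sI; have [->|ws0] := eqVneq (w s o) 0.
  rewrite normr0 mul0r /psi expr0n/= mul0r; apply: nneseries_ge0 => n _ _.
  by apply: sume_ge0 => j _; rewrite lee_fin.
have nw0 : 0 < `|w s o| by rewrite normr_gt0.
have [n [j [jn big]]] : exists n j, (j < 2 ^ n)%N /\ `|w s o| / 2 * lvl n < `|incr n j o|.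
  apply: contrapT => nex.
  have : `|w s o| <= `|w s o| / 2.
    apply: (@dyadic_chaining R T T0 (w ^~ o) _ (@cw o) (w0 o) _ _ s sI); first by rewrite divr_ge0.
    move=> n j jn; rewrite leNgt; apply/negP => h; apply: nex.
    by exists n, j; split.
  by move: nw0; lra.
apply: le_trans (_ : (Psi n o <= _)%E); last first.
  have Psi0 k : (0 <= Psi k o)%E by apply: sume_ge0 => i _; rewrite lee_fin.
  apply: le_trans (nneseries_lim_ge n.+1 (fun k _ _ => Psi0 k)).
  by rewrite big_nat_recr//= leeDr// sume_ge0.
rewrite /Psi (bigD1 (Ordinal jn))//= -[leLHS]adde0 leeD//.
  rewrite lee_fin psi_le ?divr_ge0// normrM normfV (gtr0_norm (lvl_gt0 n)).
  by rewrite ler_pdivlMr// ltW.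
by apply: sume_ge0 => i _; rewrite lee_fin.
Qed.

Lemma path_sup_exp_integrable : exists2 e : R, 0 < e &
  P.-integrable setT (fun o => (expR (e * path_sup o ^+ 2))%:E).
Proof.
(* The division by 4 comes from evaluating [psi] at half the supremum. *)
exists (e0 / 4); first by rewrite divr_gt0.
have mS := measurable_path_sup.
have mexp : measurable_fun setT (fun o => (expR (e0 / 4 * path_sup o ^+ 2))%:E).
  apply/measurable_EFinP/measurableT_comp => //; apply: measurable_funM => //.
  exact: measurable_funX.
apply/integrableP; split => //.
under eq_integral do rewrite gee0_abs ?lee_fin ?expR_ge0//.
have Psi0 n o : (0 <= Psi n o)%E by apply: sume_ge0 => j _; rewrite lee_fin.
have mPsi n : measurable_fun setT (Psi n).
  by apply: emeasurable_sum => j; apply/measurable_EFinP; exact: mpsi.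
have mPsis : measurable_fun setT (fun o => \sum_(n <oo) Psi n o)%E.
  by apply: ge0_emeasurable_sum => // n o _ _; exact: Psi0.
apply: (@le_lt_trans _ _ (\int[P]_o ((expR e0)%:E + \sum_(n <oo) Psi n o))%E).
  apply: ge0_le_integral => //.
  - by apply: emeasurable_funD.
  - move=> o _; have [s sI Ss] : exists2 s, 0 <= s <= T & path_sup o = `|w s o|.
      have cn : {within `[0, T], continuous (fun s => `|w s o|)}.
        apply: continuous_subspaceT => s.
        by apply: (@continuous_comp _ _ _ (w ^~ o) Num.norm); [exact: cw|exact: norm_continuous].
      have [c cI cm] := EVT_max (ltW T0) cn; exists c; first by rewrite in_itv/= in cI.
      apply/eqP; rewrite eq_le path_sup_ge ?andbT; last by rewrite in_itv/= in cI.
      rewrite path_supE; apply: ge_sup.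
        by exists `|w (dyadic_enum 0) o|; exists 0%N.
      by move=> _ [k _ <-]; apply: cm; rewrite in_itv/= dyadic_enum_itv.
    (* Up to 2 the exponential is at most [expR e0]; beyond 2 the fourth power in [psi (|w s| / 2)]
       is at least 1, so [psi] dominates the exponential. *)
    rewrite Ss; have [w2|w2] := leP `|w s o| 2.
      rewrite -[leLHS]adde0 leeD//; last by apply: nneseries_ge0.
      rewrite lee_fin ler_expR mulrAC ler_pdivrMr// ler_pM2l//.
      by have := normr_ge0 (w s o); nra.
    rewrite -[leLHS]add0e leeD ?lee_fin ?expR_ge0//.
    apply: le_trans (psi_le_chaining o sI); rewrite lee_fin /psi.
    rewrite (_ : e0 / 4 * _ = e0 * (`|w s o| / 2) ^+ 2); last by field.
    rewrite ler_peMl ?expR_ge0// exprn_ege1// ler_pdivlMr// mul1r ltW//.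
rewrite ge0_integralD//; last by move=> o _; exact: nneseries_ge0.
have -> : (\int[P]_o (expR e0)%:E = (expR e0)%:E)%E.
  by rewrite integral_cst// [X in (_ * X)%E]probability_setT mule1.
rewrite lte_add_pinfty ?ltry//.
rewrite integral_nneseries//.
(* Ratio per level: [2^n] increments, each contributing [((10/9)^4 / 4)^n]. It is smaller than 1. *)
set r : R := (10 / 9) ^+ 4 / 2; set K : R := 2 ^+ 9 * T ^+ 2 * 10 ^+ 4.
have K0 : 0 <= K by rewrite !mulr_ge0 ?exprn_ge0// ltW.
have r01 : 0 <= r < 1 by rewrite /r; apply/andP; split; lra.
have Psi_int n : (\int[P]_o Psi n o <= (K * r ^+ n)%:E)%E.
  rewrite ge0_integral_sum//; last 2 first.
  - by move=> j; apply/measurable_EFinP; exact: mpsi.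
  - by move=> j o _; rewrite lee_fin.
  apply: le_trans (_ : (\sum_(j < 2 ^ n) (K * ((10 / 9) ^+ 4 / 4) ^+ n)%:E <= _)%E).
    by apply: lee_sum => j _; exact: psi_bound.
  rewrite sumEFin sumr_const card_ord lee_fin -[leLHS]mulr_natr natrX -mulrA -exprMn.
  by rewrite ler_wpM2l// lerXn2r ?nnegrE// /r; lra.
apply: (@le_lt_trans _ _ (K * (1 - r)^-1)%:E); last exact: ltry.
apply: lime_le.
  by apply: is_cvg_nneseries => n _ _; apply: integral_ge0 => o _; exact: Psi0.
apply: nearW => n; apply: le_trans (_ : (\sum_(0 <= i < n) (K * r ^+ i)%:E <= _)%E).
  by apply: lee_sum => i _; exact: Psi_int.
rewrite sumEFin lee_fin.
have -> : \sum_(0 <= i < n) K * r ^+ i = K * (1 - r ^+ n) / (1 - r).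
  have := @geometric_seriesE R K r; rewrite lt_eqF; last by case/andP: r01.
  by move=> /(_ isT)/(congr1 (fun f => f n)).
case/andP: r01 => r0 r1.
rewrite ler_wpM2r ?invr_ge0 ?subr_ge0 ?(ltW r1)// ler_piMr// lerBlDr lerDl exprn_ge0//.
Qed.

End supremum.

(** * The Markov property *)

Section bounded_expectation.
Context {R : realType} d (Om : measurableType d) (P : probability Om R).

Lemma Rintegral_prob_cst (C : R) : \int[P]_w C = C.
Proof.
rewrite /Rintegral (eq_integral (cst C%:E))// integral_cst//.
by rewrite [X in (_ * X)%E]probability_setT mule1.
Qed.

Lemma bounded_integrable (f : Om -> R) (C : R) : measurable_fun setT f ->
  (forall w, `|f w| <= C) -> P.-integrable setT (EFin \o f).
Proof.
move=> mf fC; apply: (dominated_integrable_real measurableT (g := cst C)) => //.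
exact: finite_measure_integrable_cst.
Qed.

Lemma bounded_expectation (f : Om -> R) (C : R) : measurable_fun setT f ->
  (forall w, `|f w| <= C) -> `|\int[P]_w f w| <= C.
Proof.
move=> mf fC; have intf := bounded_integrable mf fC.
rewrite (le_trans (le_normr_Rintegral _ intf))// -[leRHS]Rintegral_prob_cst.
apply: le_Rintegral => //; first exact: integrable_norm.
exact: finite_measure_integrable_cst.
Qed.

End bounded_expectation.

Section independence.
Context {R : realType} d (Om : measurableType d) (P : probability Om R).

(** Dynkin's argument in one variable: the sets independent of a fixed [B] are stable under
    complement and disjoint union, so they include the sigma-algebra of a pi-system as soon as they
    include the pi-system. *)
Lemma independent_sigma_l (G : set (set Om)) (B : set Om) :
  setI_closed G -> G `<=` measurable -> measurable B ->
  (forall A, G A -> P (A `&` B) = (P A * P B)%E) ->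
  forall A, <<s G >> A -> P (A `&` B) = (P A * P B)%E.
Proof.
move=> GI Gm mB GB A sA.
have sm A' : <<s G >> A' -> measurable A'.
  by apply: smallest_sub => //; exact: sigma_algebra_measurable.
have compl (S : set Om) : measurable S -> P (S `&` B) = (P S * P B)%E ->
    P (~` S `&` B) = (P (~` S) * P B)%E.
  move=> mS PS.
  have -> : ~` S `&` B = B `\` (S `&` B).
    by apply/seteqP; split => x /= [h1 h2]; split => //; [case|move=> Sx; apply: h2].
  rewrite measureD//; last 2 first.
  - exact: measurableI.
  - by rewrite (le_lt_trans (probability_le1 _ _))// ltry.
  have -> : B `&` (S `&` B) = S `&` B.
    by apply/seteqP; split => x /= [] // ? [] //.
  rewrite [X in (_ - X)%E]PS [P (~` S)]probability_setC// muleBl ?mul1e//.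
  by rewrite fin_num_measure.
have union (F : (set Om)^nat) : (forall n, measurable (F n)) -> trivIset setT F ->
    (forall n, P (F n `&` B) = (P (F n) * P B)%E) ->
    P (\bigcup_k F k `&` B) = (P (\bigcup_k F k) * P B)%E.
  move=> mF tF PF.
  rewrite setI_bigcupl measure_semi_bigcup//; last 3 first.
  - by move=> n; exact: measurableI.
  - exact: trivIset_setIr.
  - by apply: bigcupT_measurable => n; exact: measurableI.
  rewrite measure_semi_bigcup//; last exact: bigcupT_measurable.
  have PB : P B = (fine (P B))%:E by rewrite fineK// fin_num_measure.
  rewrite muleC PB -nneseriesZl//; apply: eq_eseriesr => k _.
  by rewrite [LHS]PF muleC -PB.
apply: (@dynkin_induction _ (g_sigma_algebraType G) G
   (fun A => P (A `&` B) = (P A * P B)%E)) sA => //.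
- by rewrite setTI [X in (X * _)%E]probability_setT mul1e.
- by move=> S /sm mS; exact: compl.
- by move=> F mF; apply: union => n; exact: sm (mF n).
Qed.

Lemma independent_sigma (G1 G2 : set (set Om)) :
  setI_closed G1 -> setI_closed G2 -> G1 `<=` measurable -> G2 `<=` measurable ->
  (forall A B, G1 A -> G2 B -> P (A `&` B) = (P A * P B)%E) ->
  forall A B, <<s G1 >> A -> <<s G2 >> B -> P (A `&` B) = (P A * P B)%E.
Proof.
move=> I1 I2 m1 m2 H A B sA sB.
have mA : measurable A.
  by move: sA; apply: smallest_sub => //; exact: sigma_algebra_measurable.
rewrite setIC muleC; apply: (independent_sigma_l I2) sB => // B' GB'.
rewrite setIC muleC; apply: (independent_sigma_l I1) sA => //; first exact: m2.
by move=> A' GA'; exact: H.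
Qed.

Context d1 d2 (Z1 : measurableType d1) (Z2 : measurableType d2).
Variables (X1 : Om -> Z1) (X2 : Om -> Z2).
Hypotheses (mX1 : measurable_fun setT X1) (mX2 : measurable_fun setT X2).
HB.instance Definition _ := isMeasurableFun.Build _ _ _ _ X1 mX1.
HB.instance Definition _ := isMeasurableFun.Build _ _ _ _ X2 mX2.

Hypothesis indep : forall A B, measurable A -> measurable B ->
  P (X1 @^-1` A `&` X2 @^-1` B) = (P (X1 @^-1` A) * P (X2 @^-1` B))%E.

(** Independence makes the joint law a product measure, and Fubini applies. The result is pulled
    back to [Om], so that the past is frozen at [w1] while the future is averaged over [w2]. *)
Lemma independent_Rintegral (K : Z1 * Z2 -> R) (C : R) : measurable_fun setT K ->
  (forall z, `|K z| <= C) ->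
  \int[P]_w K (X1 w, X2 w) = \int[P]_w1 \int[P]_w2 K (X1 w1, X2 w2).
Proof.
move=> mK KC; pose X w := (X1 w, X2 w).
have mX : measurable_fun setT X by exact: measurable_fun_pair.
pose m1 : probability Z1 R := distribution P X1.
pose m2 : probability Z2 R := distribution P X2.
have mKE : measurable_fun setT (EFin \o K) by exact/measurable_EFinP.
have intK : (m1 \x m2)%E.-integrable setT (EFin \o K).
  apply: (dominated_integrable_real measurableT (g := cst C)) => //.
  apply/integrableP; split; first by apply/measurable_EFinP; exact: measurable_cst.
  rewrite (eq_integral (cst `|C|%:E))// integral_cst// -setXTT.
  rewrite [X in (_ * X)%E]product_measure1E//.
  by rewrite [X in (_ * (X * _))%E](probability_setT m1)
    [X in (_ * (_ * X))%E](probability_setT m2) !mule1 ltry.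
have intKX : P.-integrable setT (EFin \o K \o X).
  by apply: (bounded_integrable P (f := K \o X) (C := C)) => [|w]; [exact: measurableT_comp|exact: KC].
have -> : \int[P]_w K (X1 w, X2 w) = fine (\int[m1 \x m2]_z (EFin \o K) z)%E.
  congr fine.
  have := @integral_pushforward _ _ _ _ R X mX P setT (EFin \o K) mKE.
  rewrite preimage_setT => /(_ intKX measurableT) <-.
  apply: eq_measure_integral => A mA _; apply/esym.
  exact: product_measure_unique.
rewrite -integral12_prod_meas1// /Rintegral; congr fine.
rewrite /fubini_F.
have inner (z1 : Z1) : (\int[m2]_z2 (K (z1, z2))%:E = (\int[P]_w2 K (z1, X2 w2))%:E)%E.
  have mz : measurable_fun setT (fun z2 => K (z1, z2)) by exact: measurable_fun_pair2.
  have iz : P.-integrable setT (EFin \o (fun w2 => K (z1, X2 w2))).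
    apply: (dominated_integrable_real measurableT (g := cst C)).
    - exact: (measurableT_comp mz).
    - by move=> w _; exact: KC.
    - exact: finite_measure_integrable_cst.
  rewrite fineK; last exact: integrable_fin_num.
  have := @integral_pushforward _ _ _ _ R X2 mX2 P setT (fun z2 => (K (z1, z2))%:E).
  by rewrite preimage_setT; apply => //; exact/measurable_EFinP.
transitivity (\int[m1]_z1 (\int[P]_w2 K (z1, X2 w2))%:E)%E.
  by apply: eq_integral => z1 _; rewrite /= inner.
pose k z1 := \int[P]_w2 K (z1, X2 w2).
have mk : measurable_fun setT k.
  rewrite (_ : k = fine \o (fubini_F m2 (EFin \o K))).
    apply: measurableT_comp; first exact: (fine_measurable measurableT).
    exact: (measurable_fubini_F intK).
  by apply/funext => z1 /=; rewrite /fubini_F /= inner.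
have kC z1 : `|k z1| <= C.
  apply: bounded_expectation => [|w]; last exact: KC.
  by apply: (measurableT_comp (f := fun z2 => K (z1, z2))) => //; exact: measurable_fun_pair2.
have ik : P.-integrable setT (EFin \o k \o X1).
  by apply: (bounded_integrable P (f := k \o X1) (C := C)) => [|w]; [exact: measurableT_comp|exact: kC].
have := @integral_pushforward _ _ _ _ R X1 mX1 P setT (EFin \o k).
by rewrite preimage_setT; apply => //; exact/measurable_EFinP.
Qed.

End independence.

Section increments.
Context {R : realType} d (Om : measurableType d) (P : probability Om R).
Variable W : R -> Om -> R.
Hypothesis mW : forall t, 0 <= t -> measurable_fun setT (W t).
Hypothesis indepW : forall (n : nat) (ts : nat -> R), 0 <= ts 0%N ->
  (forall i, (i < n)%N -> ts i < ts i.+1) ->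
  forall B : nat -> set R, (forall i, measurable (B i)) ->
  P (\bigcap_(i < n) [set w | W (ts i.+1) w - W (ts i) w \in B i])
  = (\prod_(i < n) P [set w | (W (ts i.+1) w - W (ts i) w)%R \in B i])%E.

Definition cylinder (ts : nat -> R) (n : nat) (B : nat -> set R) : set Om :=
  \bigcap_(i < n) [set w | W (ts i.+1) w - W (ts i) w \in B i].

Lemma measurable_increment (x y : R) (B : set R) : 0 <= x -> 0 <= y -> measurable B ->
  measurable [set w | W y w - W x w \in B].
Proof.
move=> x0 y0 mB; rewrite (_ : [set w | _] = (fun w => W y w - W x w) @^-1` B).
  rewrite -[X in measurable X]setTI.
  by apply: measurable_funB => //; exact: mW.
by apply/seteqP; split => w /=; rewrite inE.
Qed.

(** The two cylinders together form one cylinder over the concatenated grid, so all three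
    probabilities factor into the same increments. *)
Lemma cylinder_independent (ts : nat -> R) (n m : nat) (B B' : nat -> set R) :
  0 <= ts 0%N -> (forall i, (i < n + m)%N -> ts i < ts i.+1) ->
  (forall i, measurable (B i)) -> (forall i, measurable (B' i)) ->
  P (cylinder ts n B `&` cylinder (fun i => ts (n + i)%N) m B') =
  (P (cylinder ts n B) * P (cylinder (fun i => ts (n + i)%N) m B'))%E.
Proof.
move=> ts0 tsS mB mB'.
have ts_ge0 i : (i <= n + m)%N -> 0 <= ts i.
  elim: i => // i IH im; apply: le_trans (IH (ltnW im)) _; exact: ltW (tsS _ im).
rewrite {2 3}/cylinder indepW//; last by move=> i im; rewrite tsS// (leq_trans im)// leq_addr.
rewrite indepW//; last 2 first.
- by rewrite addn0 ts_ge0// leq_addr.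
- by move=> i im; rewrite addnS tsS// ltn_add2l.
pose C i := if (i < n)%N then B i else B' (i - n)%N.
have CE i : C (n + i)%N = B' i by rewrite /C ltnNge leq_addr/= addKn.
have -> : cylinder ts n B `&` cylinder (fun i => ts (n + i)%N) m B' = cylinder ts (n + m) C.
  apply/seteqP; split => w.
    move=> [h1 h2] i /= inm; rewrite /C; case: ifPn => ni; first exact: h1.
    have ni' : (n <= i)%N by rewrite leqNgt.
    have im : (i - n < m)%N by rewrite ltn_subLR.
    by have := h2 (i - n)%N im; rewrite /= addnS (subnKC ni').
  move=> h; split => i /= im.
    by have := h i (leq_trans im (leq_addr _ _)); rewrite /= /C im.
  have im' : (n + i < n + m)%N by rewrite ltn_add2l.
  by have := h (n + i)%N im'; rewrite /= CE addnS.
rewrite /cylinder indepW//; last by move=> i; rewrite /C; case: ifP.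
rewrite big_split_ord/=; congr (_ * _)%E; apply: eq_bigr => -[i im] _ /=.
  by rewrite /C im.
by rewrite CE addnS.
Qed.

Section interval.
Variables s t : R.
Hypothesis s0 : 0 <= s.
Hypothesis st : s < t.

Definition grid (n j : nat) : R := s + dyadic (t - s) n j.

Lemma gridS n j : grid n.+1 j.*2 = grid n j.
Proof. by rewrite /grid dyadicS. Qed.

Lemma grid_lt n j : grid n j < grid n j.+1.
Proof. by rewrite ltrD2l -subr_gt0 dyadic_step divr_gt0 ?exprn_gt0// subr_gt0. Qed.

Lemma grid0 n : grid n 0 = s.
Proof. by rewrite /grid /dyadic mulr0 mul0r addr0. Qed.

Lemma grid_ge0 n j : 0 <= grid n j.
Proof.
elim: j => [|j IH]; first by rewrite grid0.
exact: le_trans IH (ltW (grid_lt n j)).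
Qed.

Lemma grid_last n : grid n (2 ^ n) = t.
Proof. by rewrite /grid /dyadic natrX mulfK ?expf_neq0// addrC subrK. Qed.

Definition cylinders (n : nat) : set (set Om) :=
  [set A | exists2 B : nat -> set R, (forall i, measurable (B i)) &
     A = cylinder (grid n) (2 ^ n) B].

(** The sigma-algebras of the dyadic grids of [[s, t]] increase with [n], so their union is a
    pi-system generating the increments of the path on [[s, t]]. With [t] and a later time as
    parameters it describes the future of [t]. *)
Definition past : set (set Om) := \bigcup_n <<s cylinders n >>.

Lemma cylinders_setI n : setI_closed (cylinders n).
Proof.
move=> _ _ [B mB ->] [B' mB' ->]; exists (fun i => B i `&` B' i).
  by move=> i; exact: measurableI.
rewrite /cylinder -bigcapI; apply: eq_bigcapr => i _.
by apply/seteqP; split => w /=; rewrite !inE.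
Qed.

Lemma cylinders_measurable n : cylinders n `<=` measurable.
Proof.
move=> _ [B mB ->]; apply: bigcap_measurableType => i _.
by apply: measurable_increment => //; exact: grid_ge0.
Qed.

Lemma increment_cylinders n j (B : set R) : (j < 2 ^ n)%N -> measurable B ->
  cylinders n [set w | W (grid n j.+1) w - W (grid n j) w \in B].
Proof.
move=> jn mB; exists (fun i => if i == j then B else setT).
  by move=> i; case: ifP.
apply/seteqP; split => w /=.
  by move=> h i _; case: eqP => [->//|_] /=; rewrite in_setT.
by move=> /(_ j jn) /=; rewrite eqxx.
Qed.

Lemma measurable_grid_increment n j : (j < 2 ^ n)%N ->
  @measurable_fun _ _ (g_sigma_algebraType (cylinders n)) R setT
    (fun w : Om => W (grid n j.+1) w - W (grid n j) w).
Proof.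
move=> jn _ B mB; rewrite setTI.
apply: sub_gen_smallest.
rewrite (_ : _ @^-1` _ = [set w | W (grid n j.+1) w - W (grid n j) w \in B]).
  exact: increment_cylinders.
by apply/seteqP; split => w /=; rewrite inE.
Qed.

(** An increment of a coarse grid is the sum of two increments of the next one. *)
Lemma cylinders_sub n : <<s cylinders n >> `<=` <<s cylinders n.+1 >>.
Proof.
apply: smallest_sub; first exact: smallest_sigma_algebra.
move=> _ [B mB ->].
have h i : (i < 2 ^ n)%N ->
    <<s cylinders n.+1 >> [set w | W (grid n i.+1) w - W (grid n i) w \in B i].
  move=> i2.
  have m1 := @measurable_grid_increment n.+1 i.*2; have m2 := @measurable_grid_increment n.+1 i.*2.+1.
  have i1' : (i.*2 < 2 ^ n.+1)%N by rewrite expnS -mul2n ltn_pmul2l.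
  have i2' : (i.*2.+1 < 2 ^ n.+1)%N by rewrite -doubleS expnS -mul2n leq_pmul2l.
  have := measurable_funD (m1 i1') (m2 i2') measurableT (mB i).
  rewrite setTI; congr (<<s _ >> _).
  have E w : (W (grid n.+1 i.*2.+1) w - W (grid n.+1 i.*2) w) +
     (W (grid n.+1 i.*2.+2) w - W (grid n.+1 i.*2.+1) w) = W (grid n i.+1) w - W (grid n i) w.
    by rewrite -(gridS n i.+1) -(gridS n i) doubleS; ring.
  by apply/seteqP; split => w /=; rewrite inE E.
rewrite /cylinder.
have -> : \bigcap_(i < 2 ^ n) [set w | W (grid n i.+1) w - W (grid n i) w \in B i] =
  \bigcap_i (if (i < 2 ^ n)%N then [set w | W (grid n i.+1) w - W (grid n i) w \in B i] else setT).
  apply/seteqP; split => w hw i; first by move=> _; case: ifPn => // /hw.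
  by move=> /= i2; have := hw i Logic.I; rewrite i2.
apply: (@bigcapT_measurable _ (g_sigma_algebraType (cylinders n.+1))) => i.
case: ifPn => [/h//|_]; exact: (@measurableT _ (g_sigma_algebraType (cylinders n.+1))).
Qed.

Lemma cylinders_le n m : (n <= m)%N -> <<s cylinders n >> `<=` <<s cylinders m >>.
Proof.
move=> /subnK <-; elim: (m - n)%N => // k IH; rewrite addSn.
exact: subset_trans IH (@cylinders_sub _).
Qed.

Lemma past_setI : setI_closed past.
Proof.
move=> A B [n _ An] [m _ Bm]; exists (maxn n m) => //.
apply: (@measurableI _ (g_sigma_algebraType (cylinders (maxn n m)))).
  exact: (cylinders_le (leq_maxl n m)).
exact: (cylinders_le (leq_maxr n m)).
Qed.

Lemma past_measurable : past `<=` measurable.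
Proof.
move=> A [n _]; apply: smallest_sub; last exact: cylinders_measurable.
exact: sigma_algebra_measurable.
Qed.

Lemma measurable_past_grid n j : (j <= 2 ^ n)%N ->
  @measurable_fun _ _ (g_sigma_algebraType past) R setT
    (fun w : Om => W (grid n j) w - W s w).
Proof.
elim: j => [|j IH] jn.
  rewrite grid0 (_ : (fun _ => _) = cst 0); first exact: measurable_cst.
  by apply/funext => w; rewrite subrr.
rewrite (_ : (fun _ => _) =
   (fun w => (W (grid n j.+1) w - W (grid n j) w) + (W (grid n j) w - W s w))); last first.
  by apply/funext => w; rewrite addrA subrK.
apply: measurable_funD; last exact: IH (ltnW jn).
move=> _ B mB; apply: sub_gen_smallest; exists n => //.
exact: (measurable_grid_increment jn measurableT mB).
Qed.

(** Every time is a limit of grid points, and continuity of the path transports measurability to the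
    limit. *)
Lemma measurable_past (r : R) : (forall w, continuous (W ^~ w \o Num.max 0)) -> s <= r <= t ->
  @measurable_fun _ _ (g_sigma_algebraType past) R setT (fun w : Om => W r w - W s w).
Proof.
move=> cW /andP[sr rt].
have ts : 0 < t - s by rewrite subr_gt0.
have rI : 0 <= r - s <= t - s by rewrite subr_ge0 sr lerD2r.
have [j [jn jr]] := dyadic_approx ts rI.
apply: (measurable_fun_cvg (h := fun n (w : g_sigma_algebraType past) => W (grid n (j n)) w - W s w)).
  by move=> n; exact: measurable_past_grid.
move=> w _; apply: cvgB; last exact: cvg_cst.
have gr : grid n (j n) @[n --> \oo] --> r.
  by rewrite -[r](subrK s) addrC; apply: cvgD; [exact: cvg_cst|exact: jr].
have := cvg_comp _ _ gr (cW w r); rewrite /comp /=.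
rewrite (max_r (le_trans s0 sr)); apply: cvg_trans; apply: near_eq_cvg.
by apply: nearW => n /=; rewrite max_r// grid_ge0.
Qed.

End interval.

Lemma past_independent (s t u : R) : 0 <= s -> s < t -> t < u ->
  forall A B, <<s past s t >> A -> <<s past t u >> B -> P (A `&` B) = (P A * P B)%E.
Proof.
move=> s0 st tu; have t0 : 0 <= t by rewrite (le_trans s0)// ltW.
apply: independent_sigma; [exact: past_setI|exact: past_setI|exact: past_measurable|
  exact: past_measurable|].
move=> A B [n _ An] [m _ Bm].
pose N := maxn n m.
have {}An := cylinders_le (leq_maxl n m) An; have {}Bm := cylinders_le (leq_maxr n m) Bm.
apply: independent_sigma An Bm; [exact: cylinders_setI|exact: cylinders_setI|
  exact: cylinders_measurable|exact: cylinders_measurable|].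
move=> _ _ [B1 mB1 ->] [B2 mB2 ->].
(* At a common level the two grids are glued at index [2 ^ N], where both take the value [t]. *)
pose ts i := if (i <= 2 ^ N)%N then grid s t N i else grid t u N (i - 2 ^ N).
have -> : cylinder (grid s t N) (2 ^ N) B1 = cylinder ts (2 ^ N) B1.
  by apply: eq_bigcapr => i /= iN; rewrite /ts iN (ltnW iN).
have -> : cylinder (grid t u N) (2 ^ N) B2 = cylinder (fun i => ts (2 ^ N + i)%N) (2 ^ N) B2.
  have tsE i : ts (2 ^ N + i)%N = grid t u N i.
    rewrite /ts; case: ifPn => [|_]; last by rewrite addKn.
    by rewrite -[leqRHS]addn0 leq_add2l leqn0 => /eqP ->; rewrite addn0 grid_last grid0.
  by apply: eq_bigcapr => i /= iN; rewrite !tsE.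
apply: cylinder_independent => //; first by rewrite /ts leq0n grid0.
move=> i _; rewrite /ts; case: (ltngtP i (2 ^ N)) => iN.
- exact: grid_lt.
- by rewrite subSn ?(ltnW iN)//; exact: grid_lt.
- by rewrite iN subSnn grid_last -{1}(grid0 t u N); exact: grid_lt.
Qed.

(** Independence is applied to the identity of [Om] taken twice, its target carrying the
    sigma-algebra of the past in one copy and of the future in the other. *)
Lemma markov_Rintegral (s t u : R) (K : Om -> Om -> R) (C : R) : 0 <= s -> s < t -> t < u ->
  @measurable_fun _ _ (g_sigma_algebraType (past s t) * g_sigma_algebraType (past t u))%type R setT
    (fun z => K z.1 z.2) ->
  (forall w1 w2, `|K w1 w2| <= C) ->
  \int[P]_w K w w = \int[P]_w1 \int[P]_w2 K w1 w2.
Proof.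
move=> s0 st tu mK KC; have t0 : 0 <= t by rewrite (le_trans s0)// ltW.
have mid (G : set (set Om)) : G `<=` measurable ->
    @measurable_fun _ _ Om (g_sigma_algebraType G) setT id.
  move=> Gm _ B; rewrite setTI preimage_id; apply: smallest_sub => //.
  exact: sigma_algebra_measurable.
have m1 := mid _ (past_measurable s0 st); have m2 := mid _ (past_measurable t0 tu).
have := @independent_Rintegral R _ Om P _ _ _ _ _ _ m1 m2 _ (fun z => K z.1 z.2) C mK.
apply => [A B sA sB|z]; last exact: KC.
by have := past_independent s0 st tu sA sB; rewrite !preimage_id.
Qed.

End increments.

(** * The Feynman-Kac functional *)

Section power_series.
Context {R : realType}.
Implicit Types p : nat -> R.

(* Equivalent form of [negligible_dfact] that is stable under differentiation. *)
Definition dfact_small p := forall e : R, 0 < e ->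
  exists C : R, forall k, `|p k| * (dfact_pred k)%:R <= C * e ^+ k.

Lemma negligible_dfact_small p : negligible_dfact p -> dfact_small p.
Proof.
rewrite /negligible_dfact /limn_esup limf_esupE => infE e e0.
have : (ereal_inf [set ereal_sup [set ((`|p k| * (dfact_pred k)%:R) `^ k%:R^-1)%:E | k in V] |
    V in \oo] < e%:E)%E by rewrite infE lte_fin.
move=> /ereal_inf_lt[_ [V [N _ NV] <-] supe].
pose x k := `|p k| * (dfact_pred k)%:R.
have x0 k : 0 <= x k by rewrite mulr_ge0.
have big k : (N.+1 <= k)%N -> x k <= 1 * e ^+ k.
  move=> Nk; have k0 : (0 < k)%N by exact: leq_trans Nk.
  have h : x k `^ k%:R^-1 <= e.
    rewrite -lee_fin (le_trans _ (ltW supe))//; apply: ereal_sup_ubound.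
    by exists k => //; apply: NV => /=; exact: ltnW.
  rewrite mul1r -[x k]powRr1// -(@mulVf _ k%:R) ?pnatr_eq0 -?lt0n// powRrM powR_mulrn ?powR_ge0//.
  by rewrite lerXn2r ?nnegrE ?powR_ge0// ltW.
(* The finite sum covers the indices up to [N], where the bound from the limit superior says
   nothing. *)
exists (1 + \sum_(i < N.+1) x i / e ^+ i) => k.
have s0 (I : Type) (r : seq I) (f : I -> nat) (Q : pred I) :
   0 <= \sum_(i <- r | Q i) x (f i) / e ^+ (f i).
  by apply: sumr_ge0 => i _; rewrite divr_ge0// exprn_ge0// ltW.
have [kN|kN] := ltnP k N.+1; last first.
  rewrite (le_trans (big k kN))// ler_wpM2r ?exprn_ge0 ?(ltW e0)// lerDl.
  exact: (s0 _ _ (fun i : 'I_N.+1 => val i)).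
rewrite -ler_pdivrMr ?exprn_gt0// -[leLHS]add0r lerD//.
rewrite (bigD1 (Ordinal kN))//= lerDl.
exact: (s0 _ _ (fun i : 'I_N.+1 => val i)).
Qed.

Lemma dfactSS n : dfact n.+2 = (n.+2 * dfact n)%N.
Proof. by []. Qed.

Lemma dfact_le n : (dfact n <= dfact n.+1)%N.
Proof.
suff [] : (dfact n <= dfact n.+1)%N /\ (dfact n.+1 <= dfact n.+2)%N by [].
elim: n => [|n [IH1 IH2]]; first by [].
by split => //; rewrite !dfactSS; apply: leq_mul.
Qed.

Lemma dfact_predS k : (dfact_pred k <= dfact_pred k.+1)%N.
Proof. by case: k => // k; exact: dfact_le. Qed.

Lemma fact_le_dfact m : (m`! <= dfact_pred m.*2)%N /\ (m`! <= dfact_pred m.*2.+1)%N.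
Proof.
suff [h1 h2] : (m`! <= dfact_pred m.*2)%N /\ (m.+1`! <= dfact_pred m.*2.+2)%N.
  split => //; exact: leq_trans h1 (dfact_predS _).
elim: m => [|m [IH1 IH2]]; first by [].
split => //; rewrite doubleS /= factS leq_mul// -addnn !ltnS leqW// leq_addr//.
Qed.

Lemma dfact_small_diffs p : dfact_small p -> dfact_small (pseries_diffs p).
Proof.
(* The factor [k + 1] from differentiation is at most [2^(k+1)], which halving [e] compensates. *)
move=> sp e e0; have e2 : 0 < e / 2 by rewrite divr_gt0.
have [C HC] := sp _ e2; have C0 : 0 <= C.
  by have := HC 0%N; rewrite expr0 mulr1; apply: le_trans; rewrite mulr_ge0.
exists (C * e) => k; rewrite /pseries_diffs normrM normr_nat.
have h := HC k.+1.
have h1 : (dfact_pred k)%:R <= (dfact_pred k.+1)%:R :> R by rewrite ler_nat dfact_predS.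
have h2 : k.+1%:R <= 2 ^+ k.+1 :> R by rewrite -natrX ler_nat ltnW// ltn_expl.
rewrite (_ : _ * _ = `|p k.+1| * (dfact_pred k)%:R * k.+1%:R); last by ring.
apply: le_trans (_ : C * (e / 2) ^+ k.+1 * 2 ^+ k.+1 <= _).
  apply: ler_pM => //.
  by rewrite (le_trans _ h)// ler_wpM2l.
by rewrite -mulrA -exprMn divfK// exprS mulrA.
Qed.

(** Since [dfact_pred (2m)] and [dfact_pred (2m+1)] are at least [m!], pairing the terms of index
    [2m] and [2m+1] compares the sum with [(1 + z) exp (z^2)] for [z = e |x|]. With [e^2 = th / 2]
    half of the exponent remains to absorb [1 + z]. The bound on all absolute partial sums serves
    both convergence and growth. *)
Lemma dfact_small_term p (th : R) : dfact_small p -> 0 < th -> exists2 C : R, 0 <= C &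
  forall x N, \sum_(k < N) `|p k * x ^+ k| <= C * expR (th * x ^+ 2).
Proof.
move=> sp th0; pose e := Num.sqrt (th / 2).
have e0 : 0 < e by rewrite sqrtr_gt0 divr_gt0.
have e2 : e ^+ 2 = th / 2 by rewrite sqr_sqrtr// divr_ge0// ltW.
have [C HC] := sp e e0.
have C0 : 0 <= C by have := HC 0%N; rewrite expr0 mulr1; apply: le_trans; rewrite mulr_ge0.
exists (C * 2) => [|x N]; first by rewrite mulr_ge0.
pose z := e * `|x|; have z0 : 0 <= z by rewrite mulr_ge0// ltW.
have df0 k : 0 < (dfact_pred k)%:R :> R.
  rewrite ltr0n; case: k => // k; elim: k => // k IH; exact: leq_trans IH (dfact_le _).
have term k : `|p k * x ^+ k| <= C * (z ^+ k / (dfact_pred k)%:R).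
  rewrite normrM normrX mulrA ler_pdivlMr// mulrAC exprMn mulrA.
  by rewrite ler_wpM2r// exprn_ge0.
apply: (@le_trans _ _ (\sum_(m < N) C * (1 + z) * (z ^+ 2) ^+ m / m`!%:R)).
  apply: le_trans (_ : \sum_(k < N.*2) `|p k * x ^+ k| <= _).
    rewrite -!(big_mkord predT (fun k => `|p k * x ^+ k|)).
    rewrite [leRHS](big_cat_nat (leq0n N)) -?addnn ?leq_addl//=.
    by rewrite lerDl sumr_ge0.
  elim: N => [|N IH]; first by rewrite !big_ord0.
  rewrite doubleS !big_ord_recr/= -addrA lerD//.
  have [f1 f2] := fact_le_dfact N.
  have f0 : 0 < N`!%:R :> R by rewrite ltr0n fact_gt0.
  rewrite mulrDr mulr1 !mulrDl lerD//.
    rewrite (le_trans (term _))// -mulrA ler_wpM2l// -exprM mul2n.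
    by rewrite ler_wpM2l ?exprn_ge0// lef_pV2 ?posrE// ler_nat.
  rewrite (le_trans (term _))// -[leRHS]mulrA -[in leRHS](mulrA C) ler_wpM2l//.
  rewrite mulrA -exprM mul2n -exprS.
  by rewrite ler_wpM2l ?exprn_ge0// lef_pV2 ?posrE// ler_nat.
under eq_bigr do rewrite -mulrA.
rewrite -mulr_sumr -!mulrA ler_wpM2l//.
have expE : \sum_(m < N) (z ^+ 2) ^+ m / m`!%:R <= expR (z ^+ 2).
  rewrite -(big_mkord predT (fun m => (z ^+ 2) ^+ m / m`!%:R)).
  have nd : {homo series (exp_coeff (z ^+ 2)) : n m / (n <= m)%N >-> n <= m}.
    apply/nondecreasing_seqP => n; rewrite /series /= big_nat_recr//= lerDl.
    by apply: exp_coeff_ge0; exact: sqr_ge0.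
  exact: (nondecreasing_cvgn_le nd (is_cvg_series_exp_coeff _) N).
have -> : th * x ^+ 2 = z ^+ 2 + z ^+ 2.
  by rewrite /z exprMn e2 real_normK ?num_real//; field.
rewrite expRD mulrA; apply: ler_pM => //; first by rewrite addr_ge0.
  by apply: sumr_ge0 => m _; rewrite divr_ge0// exprn_ge0// sqr_ge0.
have := expR_ge1Dx (z ^+ 2); have := sqr_ge0 (z - 1); nra.
Qed.

Lemma dfact_small_cvg p x : dfact_small p -> cvgn (pseries p x).
Proof.
move=> sp; have [C C0 HC] := dfact_small_term sp ltr01.
apply: (@normed_cvg _ _ (fun k => p k * x ^+ k)).
suff : cvgn (series (fun k => `|p k * x ^+ k|)) by [].
apply: nondecreasing_is_cvgn.
  by apply/nondecreasing_seqP => n; rewrite /series /= big_nat_recr//= lerDl.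
by exists (C * expR (1 * x ^+ 2)) => _ [n _ <-]; rewrite /series/= big_mkord.
Qed.

Lemma psumE p x : psum p x = limn (pseries p x).
Proof.
rewrite /psum; congr (limn _); apply/funext => n.
by rewrite /pseries/series/= big_mkord.
Qed.

Lemma psum_cvg p x : dfact_small p -> (\sum_(k < n) p k * x ^+ k) @[n --> \oo] --> psum p x.
Proof.
move=> sp; rewrite psumE (_ : (fun n => _) = pseries p x); first exact: dfact_small_cvg.
by apply/funext => n; rewrite /pseries/series/= big_mkord.
Qed.

Lemma psum_bound p (th : R) : dfact_small p -> 0 < th ->
  exists2 C : R, 0 <= C & forall x, `|psum p x| <= C * expR (th * x ^+ 2).
Proof.
move=> sp th0; have [C C0 HC] := dfact_small_term sp th0; exists C => // x.
have h : `|\sum_(k < n) p k * x ^+ k| @[n --> \oo] --> `|psum p x|.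
  by apply: cvg_norm; exact: psum_cvg.
apply: (cvgn_le_bound h) => n /=; exact: le_trans (ler_norm_sum _ _ _) (HC x n).
Qed.

Lemma is_derive_psum p (x : R) : dfact_small p ->
  is_derive x 1 (psum p) (psum (pseries_diffs p) x).
Proof.
move=> sp; have sd := dfact_small_diffs sp; have sdd := dfact_small_diffs sd.
have -> : psum p = (fun x => limn (pseries p x)) by apply/funext => ?; rewrite psumE.
rewrite psumE; apply: (@pseries_snd_diffs _ p (`|x| + 1)); try exact: dfact_small_cvg.
by rewrite [ltRHS]ger0_norm ?addr_ge0// ltrDl.
Qed.

Lemma psum0 p : psum p 0 = p 0%N.
Proof.
apply/cvg_lim => //; rewrite -(cvg_shiftn 1)/=.
rewrite (_ : (fun n => _) = cst (p 0%N)); first exact: cvg_cst.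
apply/funext => n /=; rewrite addn1 big_ord_recl expr0 mulr1 big1 ?addr0// => i _.
by rewrite expr0n mulr0.
Qed.

Lemma continuous_psum p : dfact_small p -> continuous (psum p).
Proof. by move=> sp x; exact: derivable_continuous_at (is_derive_psum x sp). Qed.

Lemma derive1n_psum p k : dfact_small p ->
  derive1n k (psum p) = psum (iter k (@pseries_diffs R) p).
Proof.
elim: k p => // k IH p sp; rewrite /derive1n iterSr iterSr -/(derive1n k _) -IH.
  congr derive1n; apply/funext => x; rewrite derive1E.
  by case: (is_derive_psum x sp).
exact: dfact_small_diffs.
Qed.

Lemma iter_pseries_diffs0 p k : iter k (@pseries_diffs R) p 0%N = k`!%:R * p k.
Proof.
suff h m : iter k (@pseries_diffs R) p m * m`!%:R = (m + k)`!%:R * p (m + k)%N.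
  by have := h 0%N; rewrite mulr1 add0n.
elim: k m => [|k IH] m; first by rewrite addn0 mulrC.
rewrite iterS /pseries_diffs mulrAC -natrM -factS mulrC -/(pseries_diffs).
by rewrite (IH m.+1) addSnnS.
Qed.

(** The ratio [1/4] is chosen so that [n^2] products of total degree at least [n] still sum to a
    null sequence. *)
Lemma dfact_small_geometric p : dfact_small p -> forall x : R, exists2 C : R, 0 <= C &
  forall k, `|p k * x ^+ k| <= C * 4^-1 ^+ k.
Proof.
move=> sp x; have e0 : 0 < (4 * (`|x| + 1))^-1 by rewrite invr_gt0 mulr_gt0// ltr_wpDl.
have [C HC] := sp _ e0.
have C0 : 0 <= C by have := HC 0%N; rewrite expr0 mulr1; apply: le_trans; rewrite mulr_ge0.
exists C => // k; rewrite normrM normrX.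
have df1 : 1 <= (dfact_pred k)%:R :> R.
  rewrite ler1n; case: k => // k; elim: k => // k IH; exact: leq_trans IH (dfact_le _).
have := HC k; rewrite invfM exprMn => h.
apply: le_trans (_ : C * (4^-1 ^+ k * (`|x| + 1)^-1 ^+ k) * `|x| ^+ k <= _).
  rewrite ler_wpM2r ?exprn_ge0// (le_trans _ h)// ler_peMr//.
rewrite mulrA -[leRHS]mulr1 -!mulrA ler_wpM2l// ler_wpM2l ?exprn_ge0// -exprMn.
rewrite exprn_ile1// ?mulr_ge0// mulrC ler_pdivrMr ?ltr_wpDl// mul1r lerDl//.
Qed.

(* The square of partial sums minus the triangle has geometrically small terms only. *)
Lemma psum_cauchy_prod p (x : R) : dfact_small p ->
  psum (cauchy_prod p p) x = psum p x ^+ 2.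
Proof.
move=> sp; have [C C0 HC] := dfact_small_geometric sp x.
apply/cvg_lim => //.
pose a k := p k * x ^+ k.
pose s n := \sum_(k < n) a k.
have sq : s n * s n @[n --> \oo] --> psum p x ^+ 2.
  by rewrite expr2; apply: cvgM; exact: psum_cvg.
have conv k : cauchy_prod p p k * x ^+ k = \sum_(l < k.+1) a l * a (k - l)%N.
  rewrite /cauchy_prod mulr_suml; apply: eq_bigr => -[l lk] _ /=.
  by rewrite /a mulrACA -exprD subnKC.
have tri n : \sum_(k < n) cauchy_prod p p k * x ^+ k =
    \sum_(i < n) \sum_(j < n | (i + j < n)%N) a i * a j.
  under eq_bigr do rewrite conv.
  rewrite -(big_mkord predT (fun k => \sum_(l < k.+1) a l * a (k - l)%N)).
  elim: n => [|n IH]; first by rewrite big_nil big_ord0.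
  rewrite big_nat_recr//= IH big_ord_recr/= [in RHS]big_ord_recr/=.
  rewrite [X in _ = _ + X](_ : _ = a n * a 0%N); last first.
    rewrite (bigD1 ord0) ?addn0//= big1 ?addr0// => i /andP[+ i0].
    by rewrite -[X in (_ < X)%N]addn1 ltn_add2l; case: i i0 => -[].
  rewrite subnn addrA; congr (_ + _).
  rewrite -big_split/=; apply: eq_bigr => -[i ilt] _ /=.
  rewrite [in RHS]big_mkcond big_ord_recr/= -big_mkcond/=.
  have -> : (i + n < n.+1)%N = (i == 0)%N.
    by rewrite -[X in (_ < X)%N]add1n ltn_add2r ltnS leqn0.
  rewrite [X in _ = X + _](bigID (fun j : 'I_n => (i + j < n)%N))/=.
  rewrite [X in _ = X + _ + _](eq_bigl (fun j : 'I_n => (i + j < n)%N)); last first.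
    by move=> j /=; rewrite andb_idl// => /ltnW.
  rewrite -addrA; congr (_ + _).
  have [->|i0] := posnP i.
    by rewrite subn0 big1 ?add0r// => j; rewrite add0n ltn_ord andbF.
  rewrite addr0.
  have h : (n - i < n)%N by rewrite ltn_subrL i0 (leq_ltn_trans _ ilt).
  rewrite (big_pred1 (Ordinal h))// => j /=.
  rewrite -leqNgt ltnS -eqn_leq -val_eqE /=.
  by rewrite -(eqn_add2l i (val j)) subnKC// ltnW.
have diff n : `|s n * s n - \sum_(k < n) cauchy_prod p p k * x ^+ k| <=
    C ^+ 2 * (n%:R ^+ 2 * 4^-1 ^+ n).
  have -> : s n * s n - \sum_(k < n) cauchy_prod p p k * x ^+ k =
      \sum_(i < n) \sum_(j < n | ~~ (i + j < n)%N) a i * a j.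
    rewrite tri /s mulr_suml -sumrB; apply: eq_bigr => i _.
    rewrite mulr_sumr (bigID (fun j : 'I_n => (i + j < n)%N))/=.
    by rewrite [X in X - _]addrC addrK.
  apply: le_trans (_ : \sum_(i < n) \sum_(j < n) C ^+ 2 * 4^-1 ^+ n <= _); last first.
    by rewrite !sumr_const !card_ord -mulrnA -[leLHS]mulr_natr natrM; rewrite le_eqVlt; apply/orP; left; apply/eqP; ring.
  rewrite (le_trans (ler_norm_sum _ _ _))// ler_sum// => i _.
  rewrite (le_trans (ler_norm_sum _ _ _))// [leLHS]big_mkcond ler_sum// => j _.
  have c0 : 0 <= C ^+ 2 * 4^-1 ^+ n by rewrite mulr_ge0 ?sqr_ge0// exprn_ge0.
  case: ifPn => // ij; rewrite normrM (le_trans (ler_pM _ _ (HC i) (HC j)))//.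
  rewrite mulrACA -expr2 -exprD ler_wpM2l ?sqr_ge0// ler_wiXn2l// -?leqNgt//; last by rewrite leqNgt.
  by rewrite invf_le1// ler1n.
rewrite (_ : psum p x ^+ 2 = psum p x ^+ 2 - 0); last by rewrite subr0.
rewrite (_ : (fun n => _) = (fun n => s n * s n -
    (s n * s n - \sum_(k < n) cauchy_prod p p k * x ^+ k))); last first.
  by apply/funext => n; rewrite subKr.
apply: cvgB => //; apply: norm_cvg0.
apply: (@squeeze_cvgr _ _ _ _ (cst 0) (fun n => C ^+ 2 * 2^-1 ^+ n * 4)).
- apply: nearW => n; rewrite normr_ge0/= (le_trans (diff n))//.
  rewrite -mulrA ler_wpM2l ?sqr_ge0//.
  (* One factor [2^-n] of the decay [4^-n] pays for the number of pairs. *)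
  have h2 : n%:R ^+ 2 <= 4 * 2 ^+ n :> R.
    rewrite -!natrX -natrM ler_nat.
    elim: n => // -[|[|[|n]]] IH //.
    rewrite (expnS 2 n.+3); move: IH; rewrite -!mulnn; set u := (2 ^ _)%N; nia.
  have -> : 4^-1 ^+ n = 2^-1 ^+ n * 2^-1 ^+ n :> R.
    by rewrite -exprMn; congr (_ ^+ _); field.
  have p2 : 0 < 2^-1 ^+ n :> R by rewrite exprn_gt0.
  rewrite mulrA (mulrC (2^-1 ^+ n)) ler_wpM2r ?(ltW p2)//.
  by rewrite exprVn ler_pdivrMr// exprn_gt0.
- exact: cvg_cst.
- rewrite (_ : (fun n => _) = geometric (C ^+ 2 * 4) 2^-1); last first.
    by apply/funext => n /=; rewrite mulrAC.
  by apply: cvg_geometric; rewrite ger0_norm ?invr_ge0// invf_lt1// ltr1n.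
Qed.

End power_series.

Section psum_class.
Context {R : realType}.

Lemma dadm_psum (be : R -> R) (B : R) n (p : nat -> R) : continuous be ->
  (forall s, `|be s| <= B) -> dfact_small p -> dadm n (fun s y => psum p (be s * y)).
Proof.
move=> cb bB; elim: n p => [|n IH] p sp.
- split => //; split.
  + by move=> t y; exact: measurable_cst.
  + move=> _ tn yn t y tnt yny.
    have h : be (tn n) * yn n @[n --> \oo] --> be t * y.
      by apply: cvgM => //; exact: (cvg_comp _ _ tnt (cb t)).
    exact: (cvg_comp _ _ h (@continuous_psum R p sp _)).
  (* Since [(be y)^2 <= B^2 y^2], the exponent must be divided by at least [B^2]; the added 1 keeps
     the divisor positive. *)
  + move=> th th0; have th' : 0 < th / (B ^+ 2 + 1).
      by rewrite divr_gt0// ltr_wpDl// sqr_ge0.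
    have [C C0 HC] := psum_bound sp th'; exists C => t y _.
    rewrite (le_trans (HC _))// ler_wpM2l// ler_expR expr0n/= addr0 -mulrA ler_wpM2l ?(ltW th0)//.
    rewrite mulrC ler_pdivrMr ?ltr_wpDl ?sqr_ge0// exprMn mulrC ler_wpM2l ?sqr_ge0//.
    apply: le_trans (_ : B ^+ 2 <= _); last by rewrite lerDl.
    rewrite -[be t ^+ 2]real_normK ?num_real// lerXn2r ?nnegrE//.
    exact: le_trans (bB t).
- have a0 := sadm_adm (IH p sp); split => //.
  exists (fun s y _ => be s * psum (pseries_diffs p) (be s * y)); split.
    move=> t y _.
    have h : is_derive y 1 (fun x : R => be t * x) (be t).
      by apply: (is_derive_eq (is_deriveZ (be t) (is_derive_id y 1))); rewrite /GRing.scale/= mulr1.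
    have := @is_derive1_comp R (psum p) (fun x => be t * x) y _ _ (is_derive_psum _ sp) h.
    by rewrite mulrC.
  apply: sadmM; first exact: (sadm_time _ _ cb bB).
  exact: IH (dfact_small_diffs sp).
Qed.

Lemma sadm_snd d1 d2 (Z1 : measurableType d1) (Z2 : measurableType d2) (S : Z2 -> R) n F :
  sadm S n F -> sadm (fun z : Z1 * Z2 => S z.2) n (fun t y z => F t y z.2).
Proof.
have h G : adm S G -> adm (fun z : Z1 * Z2 => S z.2) (fun t y z => G t y z.2).
  move=> [mG cG gG]; split => [t y|z|th th0].
  - exact: (measurableT_comp (mG t y) measurable_snd).
  - exact: cG.
  - by have [C HC] := gG th th0; exists C => t y z; exact: HC.
elim: n F => [|n IH] F /=; first by move=> [aF _]; split => //; exact: h.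
move=> [aF [F' [dF sF]]]; split; first exact: h.
by exists (fun t y z => F' t y z.2); split; last exact: IH.
Qed.

End psum_class.

(** * The driving process as a functional of the Brownian path *)

Section driving_process.
Context {R : realType} d (Om : measurableType d) (P : probability Om R).
Variables (W : R -> Om -> R) (a b c T : R).
Hypothesis bW : is_brownian_motion P W.
Hypothesis T0 : 0 < T.
Local Notation mu := (@lebesgue_measure R).
Local Notation cl := (clamp T).

Lemma brownian_measurable t : 0 <= t -> measurable_fun setT (W t).
Proof. by case: bW => + _ _ _ _; exact. Qed.

Lemma brownian_max0_continuous w : continuous (W ^~ w \o Num.max 0).
Proof.
case: bW => _ _ cW _ _.
apply: (within_continuous_compose (cW w)).
  by apply: continuous_maxr; [exact: cst_continuous|move=> ?; exact: cvg_id].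
by move=> x; rewrite /= in_itv/= andbT le_max lexx.
Qed.

Definition Wc (s : R) (w : Om) : R := W (cl s) w.

Lemma Wc_continuous w : continuous (Wc ^~ w).
Proof.
case: bW => _ _ cW _ _.
apply: (within_continuous_compose (cW w)); first exact: clamp_continuous.
by move=> x; rewrite /= in_itv/= andbT; have /andP[] := clamp_itv T0 x.
Qed.

Lemma Wc_measurable s : measurable_fun setT (Wc s).
Proof. by apply: brownian_measurable; have /andP[] := clamp_itv T0 s. Qed.

Let drift (s : R) (w : Om) : R := expR (- b * s) * (a + b * c * Wc s w).

(* Integrating the noise by parts, the solution started from [x] at time [t] is
   [X t x s = e^(b s) * (e^(- b t) * x + (Mproc s - Mproc t))]. *)
Definition Mproc (s : R) (w : Om) : R :=
  c * expR (- b * cl s) * Wc s w + \int[mu]_(r in `[0, cl s]) drift r w.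

Lemma continuous_expM (k : R) : continuous (fun s : R => expR (k * s)).
Proof.
apply: continuous_compR (@continuous_expR R).
by apply: continuous_mulr; [exact: cst_continuous|move=> ?; exact: cvg_id].
Qed.

Let drift_continuous w : continuous (drift ^~ w).
Proof.
apply: continuous_mulr; first exact: continuous_expM.
apply: continuous_addr; first exact: cst_continuous.
by apply: continuous_mulr; [exact: cst_continuous|exact: Wc_continuous].
Qed.

Lemma Mproc_continuous w : continuous (Mproc ^~ w).
Proof.
have [K [dK KE]] := continuous_antiderivative (@drift_continuous w).
have cK : continuous (fun s => K (cl s)).
  move=> s; have /andP[s0 _] := clamp_itv T0 s.
  apply: (@continuous_comp R R R cl K s); first exact: clamp_continuous.
  apply: derivable_continuous_at (dK _ _); exact: lt_le_trans (ltrN10 _) s0.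
rewrite (_ : Mproc ^~ w = fun s => c * expR (- b * cl s) * Wc s w + (K (cl s) - K 0)).
  apply: continuous_addr; last by apply: continuous_subr => //; exact: cst_continuous.
  apply: continuous_mulr; last exact: Wc_continuous.
  apply: continuous_mulr; first exact: cst_continuous.
  exact: (continuous_compR (@clamp_continuous _ _) (@continuous_expM (- b))).
apply/funext => s; rewrite /Mproc KE ?ltrN10//.
by have /andP[] := clamp_itv T0 s.
Qed.

Lemma Mproc_measurable s : measurable_fun setT (Mproc s).
Proof.
apply: measurable_funD.
  by apply: measurable_funM => //; exact: Wc_measurable.
apply: (@measurable_Rintegral R _ _ Om _ mu _ (measurable_itv _) (fun wr => drift wr.2 wr.1)).
apply: (caratheodory_measurable (h := drift)) => [w|r]; first exact: drift_continuous.
apply: measurable_funM => //; apply: measurable_funD => //.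
by apply: measurable_funM => //; exact: Wc_measurable.
Qed.

Lemma expM_integral (k : R) (s r : R) : k != 0 -> -1 < s -> s <= r ->
  \int[mu]_(x in `[s, r]) expR (k * x) = (expR (k * r) - expR (k * s)) / k.
Proof.
move=> k0 s1 sr; have [K [dK KE]] := continuous_antiderivative (@continuous_expM k).
rewrite KE//.
have d0 (x : R) : -1 < x -> is_derive x 1 (fun x : R => K x - expR (k * x) / k) 0.
  move=> x1; have h : is_derive x 1 (fun x : R => k * x) k.
    by apply: (is_derive_eq (is_deriveZ k (is_derive_id x 1))); rewrite /GRing.scale/= mulr1.
  have h2 := @is_derive1_comp R expR (fun x => k * x) x _ _ (is_derive_expR _) h.
  have h3 : is_derive x 1 (fun x : R => expR (k * x) / k) (expR (k * x)).
    have := is_deriveZ k^-1 h2; rewrite /GRing.scale/= mulrCA mulVf// mulr1.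
    congr (is_derive _ _ _ _); by apply/funext => y /=; rewrite [RHS]mulrC.
  by apply: (is_derive_eq (is_deriveB (dK x x1) h3)); rewrite subrr.
have [|z _] := mean_value (k := fun=> 0) sr (K := fun x : R => K x - expR (k * x) / k).
  by move=> x /andP[sx _]; exact: d0 (lt_le_trans s1 sx).
rewrite mul0r mulrBl => /eqP; rewrite subr_eq0 => /eqP h; rewrite -[K r](subrK (expR (k * r) / k)) h; ring.
Qed.

(* This form exhibits the increment as a functional of the increments of [W] after
   time [s], as the Markov property requires. *)
Lemma Mproc_increment (s r : R) w : 0 <= s -> s <= r -> r <= T ->
  Mproc r w - Mproc s w = c * expR (- b * r) * (W r w - W s w) +
    \int[mu]_(x in `[s, r]) (expR (- b * x) * (a + b * c * (Wc x w - W s w))).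
Proof.
move=> s0 sr rT.
have clr : cl r = r by rewrite clamp_id// (le_trans s0 sr).
have cls : cl s = s by rewrite clamp_id// s0 (le_trans sr rT).
have [K [dK KE]] := continuous_antiderivative (@drift_continuous w).
have s1 : -1 < s by rewrite (lt_le_trans _ s0)// ltrN10.
have r1 : -1 < r by rewrite (lt_le_trans s1).
rewrite /Mproc /Wc clr cls !KE ?ltrN10//; last exact: le_trans sr.
have -> : \int[mu]_(x in `[s, r]) (expR (- b * x) * (a + b * c * (Wc x w - W s w))) =
   K r - K s - b * c * W s w * \int[mu]_(x in `[s, r]) expR (- b * x).
  rewrite -KE// -RintegralZl//; last exact: continuous_itv_integrable (@continuous_expM (- b)).
  rewrite -RintegralB//.
  - by apply: eq_Rintegral => x _; rewrite /drift; ring.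
  - exact: continuous_itv_integrable.
  - apply: continuous_itv_integrable.
    by apply: continuous_mulr; [exact: cst_continuous|exact: continuous_expM].
have [->|b0] := eqVneq b 0.
  by rewrite !oppr0 !mul0r !expR0; ring.
by rewrite expM_integral ?oppr_eq0//; field.
Qed.

Lemma measurable_past_path (s t : R) : 0 <= s -> s < t -> forall r, s <= r <= t ->
  @measurable_fun _ _ (g_sigma_algebraType (past W s t)) R setT (fun w : Om => W r w - W s w).
Proof.
by move=> s0 st r rI; apply: measurable_past => // w; exact: brownian_max0_continuous.
Qed.

Lemma measurable_past_Mproc (s t r : R) : 0 <= s -> s < t -> s <= r <= t -> r <= T ->
  @measurable_fun _ _ (g_sigma_algebraType (past W s t)) R setT
    (fun w : Om => Mproc r w - Mproc s w).
Proof.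
move=> s0 st /andP[sr rt] rT.
(* Clamping the integration variable to [[s, r]] keeps the integrand measurable for the past at
   every value of that variable, not only inside the domain. *)
rewrite (_ : (fun w => _) = (fun w => c * expR (- b * r) * (W r w - W s w) +
    \int[mu]_(x in `[s, r])
      (fun wx : Om * R => expR (- b * wx.2) * (a + b * c * (Wc (Num.max s (Num.min wx.2 r)) wx.1 - W s wx.1))) (w, x))); last first.
  apply/funext => w; rewrite Mproc_increment//; congr (_ + _).
  apply: eq_Rintegral => x; rewrite inE/= in_itv/= => /andP[sx xr].
  by rewrite min_l// max_r.
apply: measurable_funD.
  by apply: measurable_funM => //; apply: measurable_past_path => //; rewrite sr.
apply: (@measurable_Rintegral R _ _ (g_sigma_algebraType (past W s t)) _ mu _ (measurable_itv _)
  (fun wx => expR (- b * wx.2) * (a + b * c * (Wc (Num.max s (Num.min wx.2 r)) wx.1 - W s wx.1)))).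
apply: (@caratheodory_measurable R _ (g_sigma_algebraType (past W s t))
  (fun x w => expR (- b * x) * (a + b * c * (Wc (Num.max s (Num.min x r)) w - W s w)))).
  move=> w; apply: continuous_mulr; first exact: continuous_expM.
  apply: continuous_addr; first exact: cst_continuous.
  apply: continuous_mulr; first exact: cst_continuous.
  apply: continuous_subr; last exact: cst_continuous.
  have cm : continuous (fun x : R => Num.max s (Num.min x r)).
    apply: continuous_maxr; first exact: cst_continuous.
    by apply: continuous_minr; [move=> ?; exact: cvg_id|exact: cst_continuous].
  exact: (continuous_compR cm (@Wc_continuous w)).
move=> x; apply: measurable_funM => //; apply: measurable_funD => //.
apply: measurable_funM => //.
set x' := Num.max s (Num.min x r).
have xI : s <= x' <= r.
  by rewrite /x' le_max lexx/= ge_max sr/= ge_min lexx orbT.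
have /andP[sx xr] := xI.
rewrite /Wc clamp_id; last by rewrite (le_trans s0 sx) (le_trans xr rT).
by apply: measurable_past_path => //; rewrite sx (le_trans xr rt).
Qed.

Let Wpath_bound s w : `|Wc s w| <= path_sup T Wc w.
Proof.
have h := @path_sup_ge R _ Om T Wc T0 Wc_continuous w (cl s) (clamp_itv T0 s).
by move: h; rewrite /Wc (clamp_id (clamp_itv T0 s)).
Qed.

Lemma Mproc_bound : exists2 K : R, 0 <= K & forall s w, `|Mproc s w| <= K * (1 + path_sup T Wc w).
Proof.
pose E : R := expR (`|b| * T).
have expE s : 0 <= s -> s <= T -> expR (- b * s) <= E.
  move=> s0 sT; rewrite ler_expR (le_trans (ler_norm _))// normrM normrN (ger0_norm s0).
  by rewrite ler_wpM2l.
have E0 : 0 <= E by exact: expR_ge0.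
exists (`|c| * E + E * (`|a| + `|b * c|) * T).
  by rewrite addr_ge0 ?mulr_ge0 ?addr_ge0// ltW.
move=> s w; have S0 : 0 <= path_sup T Wc w by apply: le_trans (Wpath_bound 0 w).
have /andP[s0 sT] := clamp_itv T0 s.
rewrite (le_trans (ler_normD _ _))// mulrDl lerD//.
  rewrite !normrM (ger0_norm (expR_ge0 _)) ler_pM ?mulr_ge0 ?expR_ge0//.
    by rewrite ler_wpM2l// expE.
  by rewrite (le_trans (Wpath_bound _ _))// lerDr.
have [r /andP[r0 rs] ->] := Rintegral_mean (@drift_continuous w) (ltrN10 _) s0.
rewrite subr0 normrM (ger0_norm s0) mulrAC ler_pM//.
rewrite normrM (ger0_norm (expR_ge0 _)) -[leRHS]mulrA ler_pM ?expR_ge0//.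
  by rewrite expE// (le_trans rs sT).
rewrite (le_trans (ler_normD _ _))// normrM mulrDl mulrDr mulr1 -addrA lerD//.
rewrite -[leLHS]add0r lerD ?mulr_ge0// mulrDr mulr1 -[leLHS]add0r lerD//.
by rewrite ler_wpM2l.
Qed.

(** [xget] names a constant from [Mproc_bound], so that the range of the driving process is one
    fixed random variable. *)
Definition Mbound (w : Om) : R := 2 * (xget 0 [set K : R | 0 <= K /\
  forall s w, `|Mproc s w| <= K * (1 + path_sup T Wc w)]) * (1 + path_sup T Wc w).

Lemma Mproc_dist_le s t w : `|Mproc s w - Mproc t w| <= Mbound w.
Proof.
rewrite /Mbound; case: xgetP => [K _ [K0 HK]|nex]; last first.
  by have [K K0 HK] := Mproc_bound; case: (nex K).
rewrite (le_trans (ler_normB _ _))// -mulrA mulr_natl mulr2n lerD//.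
Qed.

Lemma affine_path_sup_integrable (K : R) :
  measurable_fun setT (fun w => K * (1 + path_sup T Wc w)) /\ exists2 e : R, 0 < e &
  P.-integrable setT (fun w => (expR (e * (K * (1 + path_sup T Wc w)) ^+ 2))%:E).
Proof.
have mS := measurable_path_sup T0 Wc_continuous Wc_measurable.
have mM : measurable_fun setT (fun w => K * (1 + path_sup T Wc w)).
  by apply: measurable_funM => //; exact: measurable_funD.
split => //.
have [||e e0 ie] := @path_sup_exp_integrable R _ Om P T Wc T0 Wc_continuous Wc_measurable.
- move=> w; case: bW => _ W0 _ _ _; rewrite /Wc clamp_id//.
  by rewrite lexx ltW.
- move=> s t s0 st tT B mB; case: bW => _ _ _ incr _.
  rewrite /Wc !clamp_id ?s0 ?(le_trans s0 (ltW st))// ?(le_trans (ltW st) tT)//.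
  exact: incr.
have K2 : 0 < 2 * K ^+ 2 + 1 by rewrite ltr_wpDl// mulr_ge0// sqr_ge0.
(* From [(K (1 + S))^2 <= 2 K^2 (1 + S^2)], this exponent leaves at most [e (1 + S^2)]. *)
exists (e / (2 * K ^+ 2 + 1)); first by rewrite divr_gt0.
apply: (dominated_integrable_real measurableT (g := fun w =>
  expR e * expR (e * path_sup T Wc w ^+ 2))).
- apply: measurableT_comp => //; apply: measurable_funM => //.
  exact: measurable_funX.
- move=> w _; rewrite ger0_norm ?expR_ge0// -expRD ler_expR -mulrA.
  rewrite -[X in _ <= X + _]mulr1 -mulrDr ler_wpM2l ?(ltW e0)// mulrC ler_pdivrMr//.
  set S := path_sup T Wc w; have := sqr_ge0 (S - 1); have := sqr_ge0 K.
  have := sqr_ge0 (K * (S - 1)); have := sqr_ge0 S; nra.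
- by apply: integrable_scale.
Qed.

Lemma Mbound_integrable : measurable_fun setT Mbound /\ exists2 e : R, 0 < e &
  P.-integrable setT (fun w => (expR (e * Mbound w ^+ 2))%:E).
Proof. exact: affine_path_sup_integrable. Qed.

(** Splits an increment of [Mproc] into the Gaussian part [xi] and a drift part of order [t - s]. A
    single [S] controls every quantity and every pair of times, so it can serve in dominating
    functions for difference quotients. *)
Lemma Mproc_gaussian_increment : exists S : Om -> R,
  [/\ measurable_fun setT S,
      exists2 e : R, 0 < e & P.-integrable setT (fun w => (expR (e * S w ^+ 2))%:E) &
      forall s t w, 0 <= s -> s <= t -> t <= T ->
        let xi := c * expR (- b * t) * (W t w - W s w) in
        [/\ `|Mproc t w - Mproc s w| <= S w,
            `|xi| + `|Mproc t w - Mproc s w - xi| <= S w,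
            `|Mproc t w - Mproc s w - xi| <= S w * (t - s) &
            forall r, s <= r <= t ->
              `|expR (- b * r) * (a + b * c * (Wc r w - W s w))| <= S w]].
Proof.
have [K0 K00 HK] := Mproc_bound.
pose E : R := expR (`|b| * T).
have E0 : 0 <= E by exact: expR_ge0.
have expE s : 0 <= s -> s <= T -> expR (- b * s) <= E.
  move=> s0 sT; rewrite ler_expR (le_trans (ler_norm _))// normrM normrN (ger0_norm s0).
  by rewrite ler_wpM2l.
pose K := 2 * K0 + 4 * (`|c| * E) + E * (`|a| + 2 * `|b * c|).
have [mS iS] := affine_path_sup_integrable K.
exists (fun w => K * (1 + path_sup T Wc w)); split => // s t w s0 st tT xi.
have ps0 : 0 <= path_sup T Wc w by apply: le_trans (Wpath_bound 0 w).
have cE0 : 0 <= `|c| * E by rewrite mulr_ge0.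
have bE0 : 0 <= E * (`|a| + 2 * `|b * c|) by rewrite mulr_ge0// addr_ge0// mulr_ge0.
have ps1 : 0 <= 1 + path_sup T Wc w by rewrite addr_ge0.
have t0 := le_trans s0 st.
have Wcs : Wc s w = W s w by rewrite /Wc clamp_id// s0 (le_trans st).
have Wct : Wc t w = W t w by rewrite /Wc clamp_id// t0.
have dM : `|Mproc t w - Mproc s w| <= 2 * K0 * (1 + path_sup T Wc w).
  by rewrite (le_trans (ler_normB _ _))// -mulrA mulr_natl mulr2n lerD.
have dW x : `|Wc x w - W s w| <= 2 * (1 + path_sup T Wc w).
  rewrite -Wcs (le_trans (ler_normB _ _))// mulr_natl mulr2n lerD//.
    by rewrite (le_trans (Wpath_bound _ _))// lerDr.
  by rewrite (le_trans (Wpath_bound _ _))// lerDr.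
have dxi : `|xi| <= 2 * (`|c| * E) * (1 + path_sup T Wc w).
  rewrite /xi -Wct !normrM (ger0_norm (expR_ge0 _)) (mulrC 2) -[leRHS]mulrA.
  by rewrite ler_pM ?mulr_ge0 ?expR_ge0// ler_wpM2l// expE.
have drift_le r : s <= r <= t ->
    `|expR (- b * r) * (a + b * c * (Wc r w - W s w))| <= K * (1 + path_sup T Wc w).
  move=> /andP[sr rt]; have r0 := le_trans s0 sr; have rT := le_trans rt tT.
  rewrite normrM (ger0_norm (expR_ge0 _)).
  apply: (@le_trans _ _ (E * ((`|a| + 2 * `|b * c|) * (1 + path_sup T Wc w)))).
    rewrite ler_pM ?expR_ge0 ?expE//.
    rewrite (le_trans (ler_normD _ _))// normrM mulrDl lerD//.
      by rewrite mulrDr mulr1 lerDl mulr_ge0.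
    by rewrite (mulrC 2) -[leRHS]mulrA ler_wpM2l.
  by rewrite mulrA ler_wpM2r// /K lerDr addr_ge0// ?mulr_ge0.
split.
- by rewrite (le_trans dM)// ler_wpM2r// /K -addrA lerDl addr_ge0// mulr_ge0.
- have := ler_normB (Mproc t w - Mproc s w) xi; rewrite /K.
  move: (path_sup T Wc w) ps1 dM dxi bE0 => p ps1 dM dxi bE0 h.
  have := mulr_ge0 bE0 ps1; nra.
- rewrite /xi Mproc_increment// [X in `|X|](_ : _ =
    \int[mu]_(x in `[s, t]) (expR (- b * x) * (a + b * c * (Wc x w - W s w)))); last by ring.
  have ck : continuous (fun x => expR (- b * x) * (a + b * c * (Wc x w - W s w))).
    apply: continuous_mulr; first exact: continuous_expM.
    apply: continuous_addr; first exact: cst_continuous.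
    apply: continuous_mulr; first exact: cst_continuous.
    by apply: continuous_subr; [exact: Wc_continuous|exact: cst_continuous].
  have s1 : -1 < s by rewrite (lt_le_trans _ s0)// ltrN10.
  have [r /andP[sr rt] ->] := Rintegral_mean ck s1 st.
  rewrite normrM (ger0_norm (_ : 0 <= t - s)) ?subr_ge0// ler_wpM2r ?subr_ge0//.
  by apply: drift_le; rewrite sr.
- exact: drift_le.
Qed.

End driving_process.

Section OU_representation.
Context {R : realType} d (Om : measurableType d) (P : probability Om R).
Variables (W : R -> Om -> R) (a b c T : R).
Hypothesis bW : is_brownian_motion P W.
Hypothesis T0 : 0 < T.
Local Notation mu := (@lebesgue_measure R).
Local Notation M := (Mproc W a b c T).
Variable X : R -> R -> R -> Om -> R.
Hypothesis flowX : is_OU_flow W a b c T X.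

Lemma is_derive_expM (k x : R) : is_derive x 1 (fun x : R => expR (k * x)) (k * expR (k * x)).
Proof.
have h : is_derive x 1 (fun x : R => k * x) k.
  by apply: (is_derive_eq (is_deriveZ k (is_derive_id x 1))); rewrite /GRing.scale/= mulr1.
have := @is_derive1_comp R expR (fun x => k * x) x _ _ (is_derive_expR _) h.
by rewrite mulrC.
Qed.

Lemma OU_flowE (t x s : R) w : 0 <= t -> t <= s -> s <= T ->
  X t x s w = expR (b * s) * (expR (- b * t) * x + (M s w - M t w)).
Proof.
move=> t0 ts sT; have tT : t <= T := le_trans ts sT.
have tI : 0 <= t <= T by rewrite t0.
have [cX eqX] := flowX x tI w.
pose xc r := X t x (Num.max t (Num.min r T)) w.
have cxc : continuous xc.
  apply: (within_continuous_compose cX).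
    apply: continuous_maxr; first exact: cst_continuous.
    by apply: continuous_minr; [move=> ?; exact: cvg_id|exact: cst_continuous].
  by move=> r; rewrite /= in_itv/= le_max lexx/= ge_max tT/= ge_min lexx orbT.
have xcE r : t <= r <= T -> xc r = X t x r w.
  by move=> /andP[tr rT]; rewrite /xc min_l// max_r.
have ck1 : continuous (fun r => a + b * xc r).
  apply: continuous_addr; first exact: cst_continuous.
  by apply: continuous_mulr; [exact: cst_continuous|exact: cxc].
have ck2 : continuous (fun r => expR (- b * r) * (a + b * c * (Wc W T r w - W t w))).
  apply: continuous_mulr; first exact: continuous_expM.
  apply: continuous_addr; first exact: cst_continuous.
  apply: continuous_mulr; first exact: cst_continuous.
  by apply: continuous_subr; [exact: (Wc_continuous bW T0)|exact: cst_continuous].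
have [K [dK KE]] := continuous_antiderivative ck1.
have [K2 [dK2 K2E]] := continuous_antiderivative ck2.
have t1 : -1 < t by rewrite (lt_le_trans _ t0)// ltrN10.
have Xrep r : t <= r <= T -> X t x r w = x + (K r - K t) + c * (W r w - W t w).
  move=> /andP[tr rT]; rewrite eqX ?tr// -KE//; congr (_ + _ + _).
  apply: eq_Rintegral => z; rewrite inE/= in_itv/= => /andP[tz zr].
  by rewrite xcE// tz (le_trans zr).
(* The solution is not differentiable in time, but minus its noise it is; variation of constants
   applied to that difference makes [G] constant. *)
pose G r := expR (- b * r) * (x + (K r - K t)) - (K2 r - K2 t).
have dG (r : R) : t <= r <= s -> is_derive r 1 G 0.
  move=> /andP[tr rs]; have r1 : -1 < r := lt_le_trans t1 tr.
  have rT : r <= T := le_trans rs sT.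
  have h1 : is_derive r 1 (fun r : R => x + (K r - K t)) (a + b * xc r).
    by apply: (is_derive_eq (is_deriveD (is_derive_cst x r 1)
      (is_deriveB (dK r r1) (is_derive_cst (K t) r 1)))); rewrite subr0 add0r.
  have h2 := is_deriveM (is_derive_expM (- b) r) h1.
  have h3 := is_deriveB (dK2 r r1) (is_derive_cst (K2 t) r 1).
  apply: (is_derive_eq (is_deriveB h2 h3)); rewrite /GRing.scale/=.
  rewrite xcE ?tr// Xrep ?tr// /Wc clamp_id; last by rewrite (le_trans t0 tr).
  ring.
have [z _ Gz] := mean_value ts dG.
have : G s = expR (- b * t) * x.
  move/eqP: Gz; rewrite mul0r subr_eq0 => /eqP ->.
  by rewrite /G !subrr addr0 subr0.
rewrite /G => /eqP; rewrite subr_eq => /eqP GE.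
have -> : M s w - M t w = c * expR (- b * s) * (W s w - W t w) + (K2 s - K2 t).
  by rewrite (Mproc_increment a b c bW T0)// K2E.
rewrite Xrep ?ts// [X in _ = _ * X]addrCA -GE.
have E0 : expR (b * s) * expR (- b * s) = 1 by rewrite -expRD mulNr subrr expR0.
set A := x + _; set e := expR (b * s) in E0 *; set e' := expR _ in E0 *; set D := W s w - _.
rewrite (_ : e * _ = (e * e') * (A + c * D)); first by rewrite E0 mul1r.
ring.
Qed.

End OU_representation.

Lemma expR_cosD {R : realType} (h k x y : R) :
  expR (h + k) * cos (x + y) =
  (expR h * cos x) * (expR k * cos y) - (expR h * sin x) * (expR k * sin y).
Proof. by rewrite expRD cosD; ring. Qed.

Lemma expR_sinD {R : realType} (h k x y : R) :
  expR (h + k) * sin (x + y) =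
  (expR h * sin x) * (expR k * cos y) + (expR h * cos x) * (expR k * sin y).
Proof. by rewrite expRD sinD; ring. Qed.

Section feynman_kac.
Context {R : realType} d (Om : measurableType d) (P : probability Om R).
Variables (W : R -> Om -> R) (a b c T : R).
Hypothesis bW : is_brownian_motion P W.
Hypothesis T0 : 0 < T.
Local Notation mu := (@lebesgue_measure R).
Local Notation cl := (clamp T).
Local Notation M := (Mproc W a b c T).
Local Notation S := (Mbound W a b c T).
Variables (g1 g2 : R -> R -> R) (q : R -> R).
Hypothesis sg1 : forall n, dadm n g1.
Hypothesis sg2 : forall n, dadm n g2.
Hypothesis sq : forall n, dadm n (fun _ => q).
Hypothesis g1_le0 : forall s y, g1 s y <= 0.

(* In the coordinate [y = e^(- b t) x], the exponent of the Feynman-Kac functional is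
   [potential_re + i potential_im], its exponential is [weight_re + i weight_im] and [f (t, x) = fk_re t y + i fk_im t y]. *)
Definition potential_re (t y : R) (w : Om) : R := time_integral T M g1 t y w.
Definition potential_im (t y : R) (w : Om) : R :=
  time_integral T M g2 t y w + q (y + (M T w - M (cl t) w)).
Definition weight_re t y w := expR (potential_re t y w) * cos (potential_im t y w).
Definition weight_im t y w := expR (potential_re t y w) * sin (potential_im t y w).
Definition fk_re (t y : R) : R := \int[P]_w weight_re t y w.
Definition fk_im (t y : R) : R := \int[P]_w weight_im t y w.

Let cM w : continuous (M ^~ w).
Proof. exact: (Mproc_continuous bW T0). Qed.
Let mM := Mproc_measurable a b c bW T0.
Let MS := Mproc_dist_le a b c bW T0.

Lemma potential_re_le0 t y w : potential_re t y w <= 0.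
Proof.
rewrite /potential_re /time_integral -oppr_ge0.
have /andP[t0 tT] := clamp_itv T0 t.
have cg := dadm_seqcont (sg1 0).
have ck : continuous (fun s => g1 s (y + (M s w - M (cl t) w))).
  apply: seqcont_path => //; first by move=> ?; exact: cvg_id.
  apply: continuous_addr; first exact: cst_continuous.
  by apply: continuous_subr; [exact: cM|exact: cst_continuous].
have t1 : -1 < cl t by rewrite (lt_le_trans _ t0)// ltrN10.
have [r _ ->] := Rintegral_mean ck t1 tT.
by rewrite oppr_ge0 mulr_le0_ge0// subr_ge0.
Qed.

Lemma sadm_potential_re n : sadm S n potential_re.
Proof. exact: sadm_time_integral. Qed.

Lemma sadm_potential_im n : sadm S n potential_im.
Proof.
apply: sadmD; first exact: sadm_time_integral.
apply: (@sadm_comp R _ Om n (fun _ => q) S (fun t _ => 0) (fun t w => M T w - M (cl t) w)) => //.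
- by move=> w; exact: cst_continuous.
- move=> w; apply: continuous_subr; first exact: cst_continuous.
  exact: (continuous_compR (@clamp_continuous _ _) (@cM w)).
- by move=> t; apply: measurable_funB; exact: mM.
Qed.

Lemma sadm_weight_re n : sadm S n weight_re.
Proof. by case: (sadm_exp potential_re_le0 sadm_potential_re sadm_potential_im n). Qed.

Lemma sadm_weight_im n : sadm S n weight_im.
Proof. by case: (sadm_exp potential_re_le0 sadm_potential_re sadm_potential_im n). Qed.

Lemma weight_re_bound t y w : `|weight_re t y w| <= 1.
Proof.
rewrite normrM -[leRHS]mulr1 ler_pM// ?cos_max// ger0_norm ?expR_ge0//.
by rewrite -expR0 ler_expR potential_re_le0.
Qed.

Lemma weight_im_bound t y w : `|weight_im t y w| <= 1.
Proof.
rewrite normrM -[leRHS]mulr1 ler_pM// ?sin_max// ger0_norm ?expR_ge0//.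
by rewrite -expR0 ler_expR potential_re_le0.
Qed.

Lemma weight_re_measurable t y : measurable_fun setT (weight_re t y).
Proof. by case: (sadm_adm (sadm_weight_re 0)). Qed.

Lemma weight_im_measurable t y : measurable_fun setT (weight_im t y).
Proof. by case: (sadm_adm (sadm_weight_im 0)). Qed.

Lemma dadm_expectation n F : sadm S n F -> dadm n (fun t y => \int[P]_w F t y w).
Proof.
move=> sF; have [mS [e e0 ie]] := Mbound_integrable a b c bW T0.
(* The path is integrated out of [unit * Om], which leaves the one-point path space of [dadm]. *)
apply: (@sadm_integral R _ _ unit Om P setT measurableT (fun=> 0) S (fun z => S z.2) e
  _ e0 _ ie n (fun t y z => F t y z.2)).
- by move=> z1 z2 /=; rewrite expr0n/= add0r.
- exact: mS.
- exact: sadm_snd.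
Qed.

Lemma dadm_fk_re n : dadm n fk_re.
Proof. exact: dadm_expectation (sadm_weight_re n). Qed.

Lemma dadm_fk_im n : dadm n fk_im.
Proof. exact: dadm_expectation (sadm_weight_im n). Qed.

Definition rate_integral (g : R -> R -> R) (s t y : R) (w : Om) : R :=
  \int[mu]_(r in `[s, t]) g r (y + (M r w - M s w)).

Lemma continuous_along_path g y s w : seqcont g ->
  continuous (fun r => g r (y + (M r w - M s w))).
Proof.
move=> cg; apply: seqcont_path => //; first by move=> ?; exact: cvg_id.
apply: continuous_addr; first exact: cst_continuous.
by apply: continuous_subr; [exact: cM|exact: cst_continuous].
Qed.

(** The flow property: in the coordinate [y] the flow is a translation, so restarting at time [t]
    only shifts the argument by [M t - M s]. *)
Lemma time_integral_flow g s t y w : seqcont g -> 0 <= s -> s <= t -> t <= T ->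
  time_integral T M g s y w = rate_integral g s t y w + time_integral T M g t (y + (M t w - M s w)) w.
Proof.
move=> cg s0 st tT; rewrite /time_integral /rate_integral.
rewrite !clamp_id ?s0 ?(le_trans s0 st)// ?(le_trans st tT)//.
have [K [_ KE]] := continuous_antiderivative (@continuous_along_path g y s w cg).
have s1 : -1 < s by rewrite (lt_le_trans _ s0)// ltrN10.
rewrite (_ : \int[mu]_(r in `[t, T]) _ = \int[mu]_(r in `[t, T]) g r (y + (M r w - M s w))).
  by rewrite !KE// ?(lt_le_trans s1 st)// ?(le_trans st tT)//; ring.
apply: eq_Rintegral => r _; congr (g _ _).
by rewrite -[LHS]addrA; congr (_ + _); rewrite [LHS]addrC subrKA.
Qed.

Lemma measurable_past_rate_integral g (s t r y : R) : seqcont g -> 0 <= s -> s < t -> s <= r <= t -> r <= T ->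
  @measurable_fun _ _ (g_sigma_algebraType (past W s t)) R setT (rate_integral g s r y).
Proof.
move=> cg s0 st /andP[sr rt] rT.
pose pr x := Num.max s (Num.min x r).
have prI x : s <= pr x <= r by rewrite /pr le_max lexx/= ge_max sr/= ge_min lexx orbT.
have cpr : continuous pr.
  apply: continuous_maxr; first exact: cst_continuous.
  by apply: continuous_minr; [move=> ?; exact: cvg_id|exact: cst_continuous].
rewrite (_ : rate_integral g s r y = (fun w => \int[mu]_(x in `[s, r])
  (fun wx : Om * R => g wx.2 (y + (M (pr wx.2) wx.1 - M s wx.1))) (w, x))); last first.
  apply/funext => w; apply: eq_Rintegral => x; rewrite inE/= in_itv/= => /andP[sx xr].
  by rewrite /pr min_l// max_r.
apply: (@measurable_Rintegral R _ _ (g_sigma_algebraType (past W s t)) _ mu _ (measurable_itv _)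
  (fun wx => g wx.2 (y + (M (pr wx.2) wx.1 - M s wx.1)))).
apply: (@caratheodory_measurable R _ (g_sigma_algebraType (past W s t))
  (fun x w => g x (y + (M (pr x) w - M s w)))).
  move=> w; apply: seqcont_path => //; first by move=> ?; exact: cvg_id.
  apply: continuous_addr; first exact: cst_continuous.
  apply: continuous_subr; last exact: cst_continuous.
  exact: (continuous_compR cpr (@cM w)).
move=> x; apply: seqcont_measurable => //; apply: measurable_funD => //.
have /andP[px pr'] := prI x.
apply: (measurable_past_Mproc a b c bW T0) => //; first by rewrite px (le_trans pr').
exact: le_trans pr' rT.
Qed.

Lemma potential_re_flow s t y w : 0 <= s -> s <= t -> t <= T ->
  potential_re s y w = rate_integral g1 s t y w + potential_re t (y + (M t w - M s w)) w.
Proof. by move=> s0 st tT; apply: time_integral_flow => //; exact: dadm_seqcont (sg1 0). Qed.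

Lemma potential_im_flow s t y w : 0 <= s -> s <= t -> t <= T ->
  potential_im s y w = rate_integral g2 s t y w + potential_im t (y + (M t w - M s w)) w.
Proof.
move=> s0 st tT; rewrite /potential_im (time_integral_flow y w (dadm_seqcont (sg2 0)) s0 st tT).
rewrite !clamp_id ?s0 ?(le_trans s0 st)// ?(le_trans st tT)// -addrA; congr (_ + (_ + q _)).
by rewrite -[RHS]addrA; congr (_ + _); rewrite [RHS]addrC subrKA.
Qed.

Definition discount_re s t y w := expR (rate_integral g1 s t y w) * cos (rate_integral g2 s t y w).
Definition discount_im s t y w := expR (rate_integral g1 s t y w) * sin (rate_integral g2 s t y w).

Lemma Ig1_le0 s t y w : 0 <= s -> s <= t -> rate_integral g1 s t y w <= 0.
Proof.
move=> s0 st; have s1 : -1 < s by rewrite (lt_le_trans _ s0)// ltrN10.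
have [r _] := Rintegral_mean (@continuous_along_path g1 y s w (dadm_seqcont (sg1 0))) s1 st.
by rewrite /rate_integral => ->; rewrite mulr_le0_ge0// subr_ge0.
Qed.

Lemma discount_re_bound s t y w : 0 <= s -> s <= t -> `|discount_re s t y w| <= 1.
Proof.
move=> s0 st; rewrite normrM -[leRHS]mulr1 ler_pM// ?cos_max// ger0_norm ?expR_ge0//.
by rewrite -expR0 ler_expR Ig1_le0.
Qed.

Lemma discount_im_bound s t y w : 0 <= s -> s <= t -> `|discount_im s t y w| <= 1.
Proof.
move=> s0 st; rewrite normrM -[leRHS]mulr1 ler_pM// ?sin_max// ger0_norm ?expR_ge0//.
by rewrite -expR0 ler_expR Ig1_le0.
Qed.

Lemma measurable_past_J s t r y : 0 <= s -> s < t -> s <= r <= t -> r <= T ->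
  @measurable_fun _ _ (g_sigma_algebraType (past W s t)) R setT (discount_re s r y) /\
  @measurable_fun _ _ (g_sigma_algebraType (past W s t)) R setT (discount_im s r y).
Proof.
move=> s0 st rI rT.
have m1 := measurable_past_rate_integral y (dadm_seqcont (sg1 0)) s0 st rI rT.
have m2 := measurable_past_rate_integral y (dadm_seqcont (sg2 0)) s0 st rI rT.
split; apply: measurable_funM; first exact: measurableT_comp.
- by apply: (measurableT_comp (f := cos)) => //;
    apply: continuous_measurable_fun; exact: continuous_cos.
- exact: measurableT_comp.
- by apply: (measurableT_comp (f := sin)) => //;
    apply: continuous_measurable_fun; exact: continuous_sin.
Qed.

(** The horizon [T + 1] instead of [T] keeps the interval of the future nondegenerate at [t = T]. *)
Lemma measurable_future_E t y : 0 <= t -> t <= T ->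
  @measurable_fun _ _ (g_sigma_algebraType (past W t (T + 1))) R setT (weight_re t y) /\
  @measurable_fun _ _ (g_sigma_algebraType (past W t (T + 1))) R setT (weight_im t y).
Proof.
move=> t0 tT; have tT1 : t < T + 1 by rewrite (le_lt_trans tT)// ltrDl.
have TI : t <= T <= T + 1 by rewrite tT/= lerDl.
have mq : measurable_fun setT q.
  apply: continuous_measurable_fun; exact: seqcont1 0 (dadm_seqcont (sq 0)).
have m1 : @measurable_fun _ _ (g_sigma_algebraType (past W t (T + 1))) R setT (potential_re t y).
  rewrite (_ : potential_re t y = rate_integral g1 t T y); first exact: measurable_past_rate_integral (dadm_seqcont (sg1 0)) _ _ _ _.
  by apply/funext => w; rewrite /potential_re /time_integral clamp_id// t0.
have m2 : @measurable_fun _ _ (g_sigma_algebraType (past W t (T + 1))) R setT (potential_im t y).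
  rewrite (_ : potential_im t y = (fun w => rate_integral g2 t T y w + q (y + (M T w - M t w)))).
    apply: measurable_funD; first exact: measurable_past_rate_integral (dadm_seqcont (sg2 0)) _ _ _ _.
    apply: (measurableT_comp mq); apply: measurable_funD => //.
    exact: (measurable_past_Mproc a b c bW T0).
  by apply/funext => w; rewrite /potential_im /time_integral clamp_id// t0.
split; apply: measurable_funM; first exact: measurableT_comp.
- by apply: (measurableT_comp (f := cos)) => //;
    apply: continuous_measurable_fun; exact: continuous_cos.
- exact: measurableT_comp.
- by apply: (measurableT_comp (f := sin)) => //;
    apply: continuous_measurable_fun; exact: continuous_sin.
Qed.

Lemma weight_re_flow s t y w : 0 <= s -> s <= t -> t <= T ->
  weight_re s y w = discount_re s t y w * weight_re t (y + (M t w - M s w)) w - discount_im s t y w * weight_im t (y + (M t w - M s w)) w.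
Proof.
by move=> s0 st tT; rewrite {1}/weight_re (potential_re_flow y w s0 st tT) (potential_im_flow y w s0 st tT) expR_cosD.
Qed.

Lemma weight_im_flow s t y w : 0 <= s -> s <= t -> t <= T ->
  weight_im s y w = discount_im s t y w * weight_re t (y + (M t w - M s w)) w + discount_re s t y w * weight_im t (y + (M t w - M s w)) w.
Proof.
by move=> s0 st tT; rewrite {1}/weight_im (potential_re_flow y w s0 st tT) (potential_im_flow y w s0 st tT) expR_sinD.
Qed.

Lemma past_measurable_fun s t (k : Om -> R) : 0 <= s -> s < t ->
  @measurable_fun _ _ (g_sigma_algebraType (past W s t)) R setT k -> measurable_fun setT k.
Proof.
move=> s0 st mk _ B mB; rewrite setTI.
have := mk measurableT B mB; rewrite setTI; apply: smallest_sub.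
  exact: sigma_algebra_measurable.
by apply: past_measurable => // r r0; exact: (brownian_measurable bW r0).
Qed.

(** Both [J] and the shift depend on the path between [s] and [t] only, while [F t] at a fixed point
    depends on the later path; the latter can thus be averaged with the former frozen. *)
Lemma markov_product (s t y : R) (J : Om -> R) (F : R -> R -> Om -> R) :
  0 <= s -> s < t -> t <= T ->
  @measurable_fun _ _ (g_sigma_algebraType (past W s t)) R setT J ->
  (forall w, `|J w| <= 1) ->
  (forall y, @measurable_fun _ _ (g_sigma_algebraType (past W t (T + 1))) R setT (F t y)) ->
  (forall w, seqcont (fun t y => F t y w)) -> (forall t y w, `|F t y w| <= 1) ->
  \int[P]_w (J w * F t (y + (M t w - M s w)) w) =
  \int[P]_w (J w * \int[P]_w' F t (y + (M t w - M s w)) w').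
Proof.
move=> s0 st tT mJ J1' mF cF F1'.
have t0 : 0 <= t := le_trans s0 (ltW st).
have tT1 : t < T + 1 by rewrite (le_lt_trans tT)// ltrDl.
have cFt w : continuous (fun y => F t y w) := @seqcont1 R _ t (cF w).
pose K w1 w2 := J w1 * F t (y + (M t w1 - M s w1)) w2.
have -> := @markov_Rintegral R _ Om P W (@brownian_measurable _ _ _ _ _ bW)
  (let: And5 _ _ _ _ h := bW in h) s t (T + 1) K 1 s0 st tT1.
- apply: eq_Rintegral => w _; rewrite /K RintegralZl//.
  apply: (bounded_integrable P (C := 1)) => //.
  exact: past_measurable_fun t0 tT1 (mF _).
- apply: measurable_funM; first exact: (measurableT_comp mJ measurable_fst).
  have mFj : @measurable_fun _ _ (g_sigma_algebraType (past W t (T + 1)) * R)%type R setT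
    (fun zs => F t zs.2 zs.1).
    by apply: (@caratheodory_measurable R _ (g_sigma_algebraType (past W t (T + 1))) (F t)) => [w|y1];
      [exact: (cFt w)|exact: mF].
  have mp : @measurable_fun _ _ (g_sigma_algebraType (past W s t) * g_sigma_algebraType (past W t (T + 1)))%type
     (g_sigma_algebraType (past W t (T + 1)) * R)%type setT
     (fun z => (z.2, y + (M t z.1 - M s z.1))).
    apply: measurable_fun_pair; first exact: measurable_snd.
    apply: measurable_funD => //.
    apply: (measurableT_comp (f := fun w : g_sigma_algebraType (past W s t) => M t w - M s w)); last exact: measurable_fst.
    by apply: (measurable_past_Mproc a b c bW T0) => //; rewrite (ltW st) lexx.
  exact: (measurableT_comp mFj mp).
- by move=> w1 w2; rewrite /K normrM -[leRHS]mulr1 ler_pM.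
Qed.

Lemma f_markov s t y : 0 <= s -> s < t -> t <= T ->
  fk_re s y = \int[P]_w (discount_re s t y w * fk_re t (y + (M t w - M s w)) - discount_im s t y w * fk_im t (y + (M t w - M s w))) /\
  fk_im s y = \int[P]_w (discount_im s t y w * fk_re t (y + (M t w - M s w)) + discount_re s t y w * fk_im t (y + (M t w - M s w))).
Proof.
move=> s0 st tT; have stw := ltW st; have t0 : 0 <= t := le_trans s0 stw.
have tI : s <= t <= t by rewrite stw lexx.
have [mJ1 mJ2] := measurable_past_J y s0 st tI tT.
have mE1 y' := proj1 (measurable_future_E y' t0 tT).
have mE2 y' := proj2 (measurable_future_E y' t0 tT).
have cE1 w : seqcont (fun t y => weight_re t y w) by case: (sadm_adm (sadm_weight_re 0)) => _ + _; exact.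
have cE2 w : seqcont (fun t y => weight_im t y w) by case: (sadm_adm (sadm_weight_im 0)) => _ + _; exact.
have bJ1 w := discount_re_bound y w s0 stw; have bJ2 w := discount_im_bound y w s0 stw.
have mJ1' := past_measurable_fun s0 st mJ1; have mJ2' := past_measurable_fun s0 st mJ2.
have mY : measurable_fun setT (fun w => y + (M t w - M s w)).
  by apply: measurable_funD => //; apply: measurable_funB; exact: mM.
have mul1 (u v : R) : `|u| <= 1 -> `|v| <= 1 -> `|u * v| <= 1.
  by move=> ? ?; rewrite normrM -[leRHS]mulr1 ler_pM.
have mcomp F : (forall w, seqcont (fun t y => F t y w)) -> (forall y, measurable_fun setT (F t y)) ->
    measurable_fun setT (fun w : Om => F t (y + (M t w - M s w)) w).
  move=> cF mF.
  have mFj : measurable_fun setT (fun zs : Om * R => F t zs.2 zs.1).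
    by apply: (caratheodory_measurable (h := F t)) => [w|y1]; [exact: (@seqcont1 R _ t (cF w))|exact: mF].
  by apply: (measurableT_comp mFj (g := fun w => (w, y + (M t w - M s w)))); exact: measurable_fun_pair.
have mE1c := mcomp _ cE1 (weight_re_measurable t); have mE2c := mcomp _ cE2 (weight_im_measurable t).
have bI (J F : Om -> R) : measurable_fun setT J -> measurable_fun setT F ->
    (forall w, `|J w| <= 1) -> (forall w, `|F w| <= 1) ->
    P.-integrable setT (EFin \o (fun w => J w * F w)).
  move=> ? ? ? ?; apply: (bounded_integrable P (C := 1)); first exact: measurable_funM.
  by move=> w; exact: mul1.
have mf (f : R -> R -> R) n : dadm n f -> measurable_fun setT (fun w => f t (y + (M t w - M s w))).
  by move=> /dadm_seqcont cf; apply: seqcont_measurable.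
have f1b t' y' : `|fk_re t' y'| <= 1.
  by apply: bounded_expectation; [exact: weight_re_measurable|exact: weight_re_bound].
have f2b t' y' : `|fk_im t' y'| <= 1.
  by apply: bounded_expectation; [exact: weight_im_measurable|exact: weight_im_bound].
have mf1 := mf _ _ (dadm_fk_re 0); have mf2 := mf _ _ (dadm_fk_im 0).
pose Y w := y + (M t w - M s w).
have p11 := markov_product y s0 st tT mJ1 bJ1 mE1 cE1 weight_re_bound.
have p12 := markov_product y s0 st tT mJ1 bJ1 mE2 cE2 weight_im_bound.
have p21 := markov_product y s0 st tT mJ2 bJ2 mE1 cE1 weight_re_bound.
have p22 := markov_product y s0 st tT mJ2 bJ2 mE2 cE2 weight_im_bound.
split.
- transitivity (\int[P]_w (discount_re s t y w * weight_re t (Y w) w - discount_im s t y w * weight_im t (Y w) w)).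
    by apply: eq_Rintegral => w _; exact: weight_re_flow.
  rewrite RintegralB//; [|by apply: bI => // w; exact: weight_re_bound|by apply: bI => // w; exact: weight_im_bound].
  by rewrite p11 p22 -RintegralB//; [apply: bI => // w; exact: f1b|apply: bI => // w; exact: f2b].
- transitivity (\int[P]_w (discount_im s t y w * weight_re t (Y w) w + discount_re s t y w * weight_im t (Y w) w)).
    by apply: eq_Rintegral => w _; exact: weight_im_flow.
  rewrite RintegralD//; [|by apply: bI => // w; exact: weight_re_bound|by apply: bI => // w; exact: weight_im_bound].
  by rewrite p21 p12 -RintegralD//; [apply: bI => // w; exact: f1b|apply: bI => // w; exact: f2b].
Qed.

End feynman_kac.

(** * The backward equation *)

Section taylor.
Context {R : realType}.

(** Three nested mean values, each within the distance of the previous one; the constant 1 instead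
    of [1/6] is sufficient for the limit. *)
Lemma taylor2_remainder (F F1 F2 F3 : R -> R) (y h : R) :
  (forall x : R, is_derive x 1 F (F1 x)) -> (forall x : R, is_derive x 1 F1 (F2 x)) ->
  (forall x : R, is_derive x 1 F2 (F3 x)) ->
  exists2 z, `|z - y| <= `|h| &
    `|F (y + h) - F y - F1 y * h - F2 y / 2 * h ^+ 2| <= `|F3 z| * `|h| ^+ 3.
Proof.
move=> d0 d1 d2.
have dl (k x : R) : is_derive x 1 (fun x : R => k * (x - y)) k.
  apply: (is_derive_eq (is_deriveZ k (is_deriveB (is_derive_id x 1) (is_derive_cst y x 1)))).
  by rewrite /GRing.scale/= subr0 mulr1.
have dq (k x : R) : is_derive x 1 (fun x : R => k / 2 * (x - y) ^+ 2) (k * (x - y)).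
  have h1 := is_deriveM (dl (k / 2) x) (dl 1 x).
  have -> : (fun x : R => k / 2 * (x - y) ^+ 2) = (fun x : R => k / 2 * (x - y)) * (fun x : R => 1 * (x - y)).
    by apply/funext => u; rewrite -[RHS]/(k / 2 * (u - y) * (1 * (u - y))) mul1r expr2 mulrA.
  by apply: (is_derive_eq h1); rewrite /GRing.scale/=; field.
pose G (x : R) := F x - F1 y * (x - y) - F2 y / 2 * (x - y) ^+ 2.
pose G1 (x : R) := F1 x - F2 y * (x - y).
have dG (x : R) : is_derive x 1 G (F1 x - F1 y - F2 y * (x - y)).
  exact: is_deriveB (is_deriveB (d0 x) (dl _ x)) (dq _ x).
have dG1 (x : R) : is_derive x 1 G1 (F2 x - F2 y) := is_deriveB (d1 x) (dl _ x).
have [z1 z1h e1] := @mean_value_dist R G _ y (y + h) dG.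
have [z2 z2h e2] := @mean_value_dist R G1 _ y z1 dG1.
have [z3 z3h e3] := @mean_value_dist R F2 _ y z2 d2.
have yh : y + h - y = h by rewrite addrAC subrr add0r.
rewrite yh in z1h e1.
have z2h' := le_trans z2h z1h; exists z3; first exact: le_trans z3h z2h'.
have -> : F (y + h) - F y - F1 y * h - F2 y / 2 * h ^+ 2 = G (y + h) - G y.
  by rewrite /G yh subrr expr0n/= !mulr0 !subr0; ring.
have -> : G (y + h) - G y = F3 z3 * (z2 - y) * (z1 - y) * h.
  by rewrite e1 -e3 -e2 /G1 subrr mulr0 subr0; congr (_ * _); ring.
rewrite !normrM exprS expr2 -!mulrA ler_wpM2l// ler_pM ?mulr_ge0// ler_pM//.
Qed.

Lemma sqr_le_expR (k : R) : 0 < k -> exists2 C : R, 0 <= C &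
  forall s : R, 1 + s ^+ 2 <= C * expR (k * s ^+ 2).
Proof.
move=> k0; have ki : 0 < k^-1 by rewrite invr_gt0.
exists (1 + k^-1) => [|s]; first by rewrite addr_ge0// ltW.
apply: (@le_trans _ _ ((1 + k^-1) * (1 + k * s ^+ 2))).
  have : k^-1 * k = 1 by rewrite mulVf// gt_eqF.
  have := sqr_ge0 s; nra.
by rewrite ler_wpM2l ?expR_ge1Dx// addr_ge0// ltW.
Qed.

(** Young's inequality, its weight [k] left free so that it can be taken small in
    [diffusion_quotient]. *)
Lemma mul_le_weighted_sqr (u v k : R) : 0 <= u -> 0 <= v -> 0 < k ->
  u * v <= k * u ^+ 2 + k^-1 * v ^+ 2.
Proof.
move=> u0 v0 k0; have ki : 0 < k^-1 by rewrite invr_gt0.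
have kk : k^-1 * k = 1 by rewrite mulVf// gt_eqF.
have h : 0 <= k^-1 * (k * u - v) ^+ 2 by rewrite mulr_ge0 ?(ltW ki)// sqr_ge0.
have uv := mulr_ge0 u0 v0.
have : k^-1 * (k * u - v) ^+ 2 = k * u ^+ 2 - 2 * (u * v) + k^-1 * v ^+ 2.
  move: (k^-1) kk => p kk.
  rewrite (_ : _ * _ = (p * k) * (k * u ^+ 2) - 2 * (p * k) * (u * v) + p * v ^+ 2); last by ring.
  by rewrite kk mul1r mulr1.
lra.
Qed.

Lemma cvg_dist_le (u v : nat -> R) (l : R) : (forall n, `|u n - l| <= v n) ->
  v n @[n --> \oo] --> 0 -> u n @[n --> \oo] --> l.
Proof.
move=> uv v0; apply/cvgrPdist_le => e e0.
have /cvgrPdist_le/(_ e e0) := v0; apply: filterS => n; rewrite sub0r normrN => vn.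
by rewrite distrC (le_trans (uv n))// (le_trans (ler_norm _)).
Qed.

End taylor.

Section quotient_limit.
Context {R : realType} d (Z : measurableType d).
Variable mu : {measure set Z -> \bar R}.

Lemma integrable_addr (f g : Z -> R) : mu.-integrable setT (EFin \o f) ->
  mu.-integrable setT (EFin \o g) -> mu.-integrable setT (EFin \o (fun z => f z + g z)).
Proof.
move=> intf intg; rewrite (_ : _ \o _ = (EFin \o f) \+ (EFin \o g))%E; first exact: integrableD.
by apply/funext => z /=; rewrite EFinD.
Qed.

Lemma Rintegral_quotient_cvg (F : nat -> Z -> R) (de : nat -> R) (l G : Z -> R) :
  (forall n, 0 < de n) -> (forall n, measurable_fun setT (F n)) ->
  (forall n w, `|F n w| <= G w * de n) -> mu.-integrable setT (EFin \o G) ->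
  (forall w, F n w / de n @[n --> \oo] --> l w) ->
  (\int[mu]_w F n w) / de n @[n --> \oo] --> \int[mu]_w l w.
Proof.
move=> de0 mF FG iG cF.
have mh n : measurable_fun setT (fun w => F n w / de n) by exact: measurable_funM.
have hG n w : `|F n w / de n| <= G w.
  by rewrite normrM (ger0_norm (_ : 0 <= (de n)^-1)) ?invr_ge0 ?(ltW (de0 n))// ler_pdivrMr.
have -> : (fun n => (\int[mu]_w F n w) / de n) = (fun n => \int[mu]_w (F n w / de n)).
  apply/funext => n; rewrite -[LHS]mulrC -[RHS]mul1r -(mulVf (lt0r_neq0 (de0 n))) -[RHS]mulrA.
  congr (_ * _); rewrite -RintegralZl//; last exact: (dominated_integrable_real measurableT (g := G)).
  by apply: eq_Rintegral => w _; rewrite mulrCA mulfV ?mulr1// gt_eqF.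
exact: (Rintegral_dominated_cvg measurableT).
Qed.

End quotient_limit.

Section smooth_class.
Context {R : realType}.
Implicit Types g : R -> R -> R.

Definition smooth g := forall n, dadm n g.

Definition dy g (t y : R) : R := derive1 (g t) y.

Lemma smooth_derive g : smooth g -> forall t y : R, is_derive y 1 (g t) (dy g t y).
Proof.
move=> sg t y; have [_ [g' [dg _]]] := sg 1%N.
by have h := dg t y tt; rewrite /dy derive1E; exact: DeriveDef (@ex_derive _ _ _ _ _ _ _ h) erefl.
Qed.

Lemma smooth_dy g : smooth g -> smooth (dy g).
Proof.
move=> sg n; have [_ [g' [dg sg']]] := sg n.+1.
rewrite /dadm (_ : (fun t y (_ : unit) => dy g t y) = g')//.
apply/funext => t; apply/funext => y; apply/funext => -[].
by rewrite /dy derive1E (@derive_val _ _ _ _ _ _ _ (dg t y tt)).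
Qed.

Lemma smooth_seqcont g : smooth g -> seqcont g.
Proof. by move=> sg; exact: dadm_seqcont (sg 0). Qed.

(** The growth bound recentred at [y] and uniform in time, via [y'^2 <= 2 y^2 + 2 (y' - y)^2]; for
    [s] a random bound on the displacement is inserted. *)
Lemma smooth_growth g (e y : R) : smooth g -> 0 < e -> exists2 C : R, 0 <= C &
  forall t y' s, `|y' - y| <= s -> `|g t y'| <= C * expR (e * s ^+ 2).
Proof.
move=> sg e0; have e2 : 0 < e / 2 by rewrite divr_gt0.
have [C HC] := dadm_subgaussian (sg 0) e2.
have C0 : 0 <= C.
  by have := le_trans (normr_ge0 _) (HC 0 0); rewrite pmulr_lge0// expR_gt0.
exists (C * expR (e * y ^+ 2)) => [|t y' s ys]; first by rewrite mulr_ge0// expR_ge0.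
rewrite (le_trans (HC t y'))// -[leRHS]mulrA ler_wpM2l// -expRD ler_expR.
have : (y' - y) ^+ 2 <= s ^+ 2.
  by rewrite -[(y' - y) ^+ 2]real_normK ?num_real// lerXn2r ?nnegrE// (le_trans _ ys).
by have := sqr_ge0 (y' - 2 * y); nra.
Qed.

End smooth_class.

Section increments.
Context {R : realType} d (Om : measurableType d) (P : probability Om R).
Variables (W : R -> Om -> R) (a b c T : R).
Hypothesis bW : is_brownian_motion P W.
Hypothesis T0 : 0 < T.
Local Notation mu := (@lebesgue_measure R).
Local Notation cl := (clamp T).
Local Notation M := (Mproc W a b c T).
Variables (sn tn : nat -> R) (tau y : R).
Hypothesis sn0 : forall n, 0 <= sn n.
Hypothesis stn : forall n, sn n < tn n.
Hypothesis tnT : forall n, tn n <= T.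
Hypothesis csn : sn n @[n --> \oo] --> tau.
Hypothesis ctn : tn n @[n --> \oo] --> tau.

Local Notation de n := (tn n - sn n).
Local Notation Y n w := (y + (M (tn n) w - M (sn n) w)).
Local Notation xi n w := (c * expR (- b * tn n) * (W (tn n) w - W (sn n) w)).

Let de_gt0 n : 0 < de n. Proof. by rewrite subr_gt0. Qed.

Let tn0 n : 0 <= tn n. Proof. exact: le_trans (sn0 n) (ltW (stn n)). Qed.

Let snT n : sn n <= T. Proof. exact: le_trans (ltW (stn n)) (tnT n). Qed.

Let cde : de n @[n --> \oo] --> 0.
Proof. by rewrite -(subrr tau); exact: cvgB. Qed.

Let cM w : continuous (M ^~ w).
Proof. exact: (Mproc_continuous bW T0). Qed.

Let mM s : measurable_fun setT (M s).
Proof. exact: (Mproc_measurable a b c bW T0). Qed.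

Let cMn (r : nat -> R) w : r n @[n --> \oo] --> tau -> M (r n) w @[n --> \oo] --> M tau w.
Proof. by move=> cr; exact: (cvg_comp _ _ cr (@cM w tau)). Qed.

Let between (r : nat -> R) : (forall n, sn n <= r n <= tn n) -> r n @[n --> \oo] --> tau.
Proof.
move=> h; apply: (@squeeze_cvgr _ _ _ _ sn tn) => //.
exact: nearW.
Qed.

Let cYr (r : nat -> R) w : (forall n, sn n <= r n <= tn n) ->
  y + (M (r n) w - M (sn n) w) @[n --> \oo] --> y.
Proof.
move=> /between cr; rewrite -[X in _ --> X](addr0 y) -(subrr (M tau w)).
by apply: cvgD; [exact: cvg_cst|apply: cvgB; exact: cMn].
Qed.

Let mY n : measurable_fun setT (fun w => Y n w).
Proof. by apply: measurable_funD => //; apply: measurable_funB; exact: mM. Qed.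

Let mW n : measurable_fun setT (fun w => W (tn n) w - W (sn n) w).
Proof. by apply: measurable_funB; exact: (brownian_measurable bW). Qed.

Let cW w : W (tn n) w - W (sn n) w @[n --> \oo] --> 0.
Proof.
have h : Wc W T (tn n) w - Wc W T (sn n) w @[n --> \oo] --> 0.
  rewrite -(subrr (Wc W T tau w)); apply: cvgB.
    exact: (cvg_comp _ _ ctn (@Wc_continuous _ _ _ _ _ _ bW T0 w tau)).
  exact: (cvg_comp _ _ csn (@Wc_continuous _ _ _ _ _ _ bW T0 w tau)).
rewrite (_ : (fun n => _) = (fun n => Wc W T (tn n) w - Wc W T (sn n) w))//.
by apply/funext => n; rewrite /Wc !clamp_id ?tn0 ?tnT ?sn0 ?snT.
Qed.

Let cexp : expR (- b * tn n) @[n --> \oo] --> expR (- b * tau).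
Proof. exact: (cvg_comp _ _ ctn (@continuous_expM R (- b) tau)). Qed.

Let cxi w : xi n w @[n --> \oo] --> 0.
Proof.
rewrite -(mulr0 (c * expR (- b * tau))); apply: cvgM; last exact: cW.
by apply: cvgM; [exact: cvg_cst|exact: cexp].
Qed.

Let mxi n : measurable_fun setT (fun w => xi n w).
Proof. by apply: measurable_funM => //; exact: mW. Qed.

(* The drift part of the increment contributes the first-order term. *)
Lemma drift_quotient f : smooth f ->
  (\int[P]_w (f (tn n) (Y n w) - f (tn n) (y + xi n w))) / de n @[n --> \oo] -->
  a * expR (- b * tau) * dy f tau y.
Proof.
move=> sf; have [S [mS [e e0 ie] SP]] := Mproc_gaussian_increment a b c bW T0.
have cf := smooth_seqcont sf; have cf' := smooth_seqcont (smooth_dy sf).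
have e2 : 0 < e / 2 by rewrite divr_gt0.
have [C C0 HC] := smooth_growth y (smooth_dy sf) e2.
have [C1 C10 HC1] := sqr_le_expR e2.
(* The mean value theorem in space gives a point [rz.2], the one for the drift integral a time
   [rz.1]; they tend to [y] and [tau]. *)
have key n w : exists rz : R * R, [/\ sn n <= rz.1 <= tn n, `|rz.2 - y| <= S w,
    `|rz.2 - y| <= `|xi n w| + S w * de n,
    `|expR (- b * rz.1) * (a + b * c * (Wc W T rz.1 w - W (sn n) w))| <= S w &
    f (tn n) (Y n w) - f (tn n) (y + xi n w) =
    dy f (tn n) rz.2 * (expR (- b * rz.1) * (a + b * c * (Wc W T rz.1 w - W (sn n) w))) * de n].
  have [S1 S2 S3 S4] := SP (sn n) (tn n) w (sn0 n) (ltW (stn n)) (tnT n).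
  have [z zy ez] := @mean_value_dist R (f (tn n)) _ (y + xi n w) (Y n w) (smooth_derive sf (tn n)).
  have ck : continuous (fun x => expR (- b * x) * (a + b * c * (Wc W T x w - W (sn n) w))).
    apply: continuous_mulr; first exact: continuous_expM.
    apply: continuous_addr; first exact: cst_continuous.
    apply: continuous_mulr; first exact: cst_continuous.
    by apply: continuous_subr; [exact: (Wc_continuous bW T0)|exact: cst_continuous].
  have s1 : -1 < sn n by rewrite (lt_le_trans _ (sn0 n))// ltrN10.
  have [r rI er] := Rintegral_mean ck s1 (ltW (stn n)).
  have DE : Y n w - (y + xi n w) = M (tn n) w - M (sn n) w - xi n w by ring.
  have zy' : `|z - y| <= `|xi n w| + `|Y n w - (y + xi n w)|.
    rewrite -[z - y](_ : xi n w + (z - (y + xi n w)) = _); last by ring.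
    by rewrite (le_trans (ler_normD _ _))// lerD2l.
  exists (r, z); split => //=.
  - by rewrite (le_trans zy')// DE.
  - by rewrite (le_trans zy')// lerD2l DE.
  - exact: S4.
  - rewrite ez -[RHS]mulrA -er; congr (_ * _); rewrite DE.
    by rewrite (Mproc_increment a b c bW T0)// ?(ltW (stn n))//; ring.
have -> : a * expR (- b * tau) * dy f tau y = \int[P]_w (dy f tau y * (expR (- b * tau) * a)).
  by rewrite Rintegral_prob_cst; ring.
have mf (x : Om -> R) n : measurable_fun setT x -> measurable_fun setT (fun w => f (tn n) (x w)).
  by move=> mx; apply: seqcont_measurable.
apply: (Rintegral_quotient_cvg (G := fun w => C * C1 * expR (e * S w ^+ 2))) => //.
- by move=> n; apply: measurable_funB; apply: mf => //; exact: measurable_funD.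
- move=> n w; have [[r z] /= [_ zS _ kS ->]] := key n w.
  rewrite normrM (ger0_norm (ltW (de_gt0 n))) ler_wpM2r ?(ltW (de_gt0 n))//.
  have -> : C * C1 * expR (e * S w ^+ 2) = (C * expR (e / 2 * S w ^+ 2)) *
      (C1 * expR (e / 2 * S w ^+ 2)).
    by rewrite (_ : e * S w ^+ 2 = e / 2 * S w ^+ 2 + e / 2 * S w ^+ 2) ?expRD; field.
  rewrite normrM ler_pM//; first exact: HC.
  by rewrite (le_trans kS)// (le_trans _ (HC1 _))//; have := sqr_ge0 (S w - 1); nra.
- exact: integrable_scale.
- move=> w; have /choice[rz rzP] := fun n => key n w.
  have cr : (rz n).1 @[n --> \oo] --> tau.
    by apply: (between (r := fun n => (rz n).1)) => n; have [] := rzP n.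
  have cz : (rz n).2 @[n --> \oo] --> y.
    apply: (cvg_dist_le (v := fun n => `|xi n w| + S w * de n)).
      by move=> n; have [] := rzP n.
    rewrite -[X in _ --> X](addr0 0) -[X in _ --> X + _](normr0 R) -[X in _ --> _ + X](mulr0 (S w)).
    apply: cvgD; first by apply: cvg_norm; exact: cxi.
    by apply: cvgM => //; exact: cvg_cst.
  rewrite (_ : (fun n => _) = (fun n => dy f (tn n) (rz n).2 * (expR (- b * (rz n).1) *
      (a + b * c * (Wc W T (rz n).1 w - Wc W T (sn n) w))))); last first.
    apply/funext => n; have [_ _ _ _ ->] := rzP n.
    by rewrite mulfK ?gt_eqF// /Wc (clamp_id (_ : 0 <= sn n <= T)) ?sn0 ?snT.
  apply: cvgM; first exact: cf'.
  apply: cvgM; first exact: (cvg_comp _ _ cr (@continuous_expM R (- b) tau)).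
  rewrite -[X in _ --> X]addr0 -[X in _ --> _ + X](mulr0 (b * c)) -(subrr (Wc W T tau w)).
  apply: cvgD; first exact: cvg_cst.
  apply: cvgM; first exact: cvg_cst.
  by apply: cvgB;
    [exact: (cvg_comp _ _ cr (@Wc_continuous _ _ _ _ _ _ bW T0 w tau))
    |exact: (cvg_comp _ _ csn (@Wc_continuous _ _ _ _ _ _ bW T0 w tau))].
Qed.

Let law n (B : set R) : measurable B -> P [set w | W (tn n) w - W (sn n) w \in B] =
  normal_prob 0 (Num.sqrt (de n)) B.
Proof. by case: bW => _ _ _ + _; apply. Qed.

Let sqrt_gt0 n : 0 < Num.sqrt (de n). Proof. by rewrite sqrtr_gt0. Qed.

Let sqr_sqrt n : Num.sqrt (de n) ^+ 2 = de n.
Proof. by rewrite sqr_sqrtr// ltW. Qed.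

(** A pathwise stand-in for a fourth moment of order [de^2]: the exponential on the right has
    expectation [sqrt 2] for every [n]. *)
Let xi4_bound : exists2 B : R, 0 <= B & forall n w,
  xi n w ^+ 4 <= B * de n ^+ 2 * expR ((W (tn n) w - W (sn n) w) ^+ 2 / (4 * de n)).
Proof.
pose E := expR (`|b| * T).
have expE n : expR (- b * tn n) <= E.
  rewrite ler_expR (le_trans (ler_norm _))// normrM normrN (ger0_norm (tn0 n)).
  by rewrite ler_wpM2l.
exists ((c * E) ^+ 4 * 2 ^+ 8) => [|n w]; first by rewrite mulr_ge0 ?exprn_even_ge0//.
have := @normal_pow4_bound R d Om (fun w => W (tn n) w - W (sn n) w) _ (sqrt_gt0 n) w.
have -> : Num.sqrt (de n) ^+ 4 = de n ^+ 2 by rewrite -[in RHS]sqr_sqrt -exprM.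
rewrite sqr_sqrt => h; rewrite exprMn.
have e4 : (c * expR (- b * tn n)) ^+ 4 <= (c * E) ^+ 4.
  by rewrite !exprMn ler_wpM2l ?exprn_even_ge0// lerXn2r ?nnegrE ?expR_ge0.
apply: (le_trans (ler_pM _ _ e4 h)); rewrite ?exprn_even_ge0//.
rewrite -[leRHS]mulrA -[leRHS]mulrA ler_wpM2l ?exprn_even_ge0// mulrA.
rewrite ler_wpM2l ?mulr_ge0 ?exprn_ge0 ?(ltW (de_gt0 n))// ler_expR ler_wpM2l ?sqr_ge0//.
by rewrite lef_pV2 ?posrE ?mulr_gt0// ler_pM2r// ler_nat.
Qed.

(** After Taylor expansion the first-order term has mean 0 and the second-order term has explicit
    variance. The difficulty is the remainder, of order [|xi|^3] times a random growth factor, for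
    which no fixed integrable multiple of [de] is at hand. *)
Lemma diffusion_quotient f : smooth f ->
  (\int[P]_w (f (tn n) (y + xi n w) - f (tn n) y)) / de n @[n --> \oo] -->
  c ^+ 2 / 2 * expR (- b * tau) ^+ 2 * dy (dy f) tau y.
Proof.
move=> sf; have [S [mS [e e0 ie] SP]] := Mproc_gaussian_increment a b c bW T0.
have sf1 := smooth_dy sf; have sf2 := smooth_dy sf1; have sf3 := smooth_dy sf2.
have cf := smooth_seqcont sf.
have e4 : 0 < e / 4 by rewrite divr_gt0.
have e2 : 0 < e / 2 by rewrite divr_gt0.
have [C C0 HC] := smooth_growth y sf3 e4.
have [C1 C10 HC1] := sqr_le_expR e2.
have [B B0 HB] := xi4_bound.
have xiS n w : `|xi n w| <= S w.
  have [_ h _ _] := SP (sn n) (tn n) w (sn0 n) (ltW (stn n)) (tnT n).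
  by rewrite (le_trans _ h)// lerDl.
have [C2 C20 HC2] := smooth_growth y sf e0.
have iX n := normal_first_integrable (@mW n) (sqrt_gt0 n) (@law n).
have iX2 n := normal_second_integrable (@mW n) (sqrt_gt0 n) (@law n).
have iZ n := normal_exp_integrable (@mW n) (sqrt_gt0 n) (@law n).
have EZ n := normal_exp_Rintegral (@mW n) (sqrt_gt0 n) (@law n).
pose Rem n w := f (tn n) (y + xi n w) - f (tn n) y - dy f (tn n) y * xi n w
  - dy (dy f) (tn n) y / 2 * xi n w ^+ 2.
pose V n w := (C * expR (e / 4 * S w ^+ 2)) ^+ 2 * xi n w ^+ 2.
pose Z n w := expR ((W (tn n) w - W (sn n) w) ^+ 2 / (4 * de n)).
(* Young's inequality splits the remainder over [de] into [k] times a term of bounded mean and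
   [k^-1] times [V], whose mean tends to 0 by dominated convergence. Then [k] is made small. *)
have RemV k n w : 0 < k -> `|Rem n w| <= de n * (k * (B * Z n w) + k^-1 * V n w).
  move=> k0.
  have [z zy] := @taylor2_remainder R (f (tn n)) (dy f (tn n)) (dy (dy f) (tn n))
    (dy (dy (dy f)) (tn n)) y (xi n w) (smooth_derive sf _) (smooth_derive sf1 _) (smooth_derive sf2 _).
  move=> /le_trans; apply.
  have dz : `|dy (dy (dy f)) (tn n) z| <= C * expR (e / 4 * S w ^+ 2).
    by apply: HC; rewrite (le_trans zy).
  have kd : 0 < k / de n by rewrite divr_gt0.
  have := @mul_le_weighted_sqr R (`|xi n w| ^+ 2) (C * expR (e / 4 * S w ^+ 2) * `|xi n w|) (k / de n)
    (sqr_ge0 _) (mulr_ge0 (mulr_ge0 C0 (expR_ge0 _)) (normr_ge0 _)) kd.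
  move=> h; apply: (@le_trans _ _ (C * expR (e / 4 * S w ^+ 2) * `|xi n w| ^+ 3)).
    by rewrite ler_wpM2r ?exprn_ge0.
  rewrite (_ : _ * _ ^+ 3 = `|xi n w| ^+ 2 * (C * expR (e / 4 * S w ^+ 2) * `|xi n w|)); last by ring.
  rewrite (le_trans h)// [leRHS]mulrDr lerD//.
    rewrite real_normK ?num_real// -exprM.
    apply: (@le_trans _ _ (k / de n * (B * de n ^+ 2 * Z n w))); first by rewrite ler_wpM2l ?(ltW kd)// HB.
    by rewrite le_eqVlt; apply/orP; left; apply/eqP; move: (de_gt0 n) => /lt0r_neq0 ?; field.
  by rewrite exprMn real_normK ?num_real// invf_div /V -!mulrA.
have mRem n : measurable_fun setT (Rem n).
  have m1 : measurable_fun setT (fun w => f (tn n) (y + xi n w)).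
    by apply: seqcont_measurable => //; exact: measurable_funD.
  apply: measurable_funB; last by apply: measurable_funM => //; exact: measurable_funX.
  by apply: measurable_funB; [exact: measurable_funB|exact: measurable_funM].
have mV n : measurable_fun setT (V n).
  apply: measurable_funM; last exact: measurable_funX.
  apply: measurable_funX; apply: measurable_funM => //; apply: measurableT_comp => //.
  by apply: measurable_funM => //; exact: measurable_funX.
have VG n w : `|V n w| <= C ^+ 2 * C1 * expR (e * S w ^+ 2).
  rewrite /V ger0_norm; last by rewrite mulr_ge0 ?sqr_ge0.
  rewrite -[X in X * _]/((C * expR (e / 4 * S w ^+ 2)) ^+ 2) [X in X * _ <= _]exprMn -expRM_natl.
  have -> : C ^+ 2 * C1 * expR (e * S w ^+ 2) =
      C ^+ 2 * expR (2%:R * (e / 4 * S w ^+ 2)) * (C1 * expR (e / 2 * S w ^+ 2)).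
    rewrite (_ : e * S w ^+ 2 = 2%:R * (e / 4 * S w ^+ 2) + e / 2 * S w ^+ 2); last by field.
    by rewrite expRD; ring.
  rewrite ler_wpM2l ?mulr_ge0 ?sqr_ge0 ?expR_ge0//.
  apply: (le_trans _ (HC1 _)); rewrite -[leLHS]real_normK ?num_real//.
  have := xiS n w; have := normr_ge0 (xi n w); nra.
have iG : P.-integrable setT (EFin \o (fun w => C ^+ 2 * C1 * expR (e * S w ^+ 2))).
  exact: integrable_scale.
have iV n : P.-integrable setT (EFin \o V n).
  exact: (dominated_integrable_real measurableT (mV n) (fun w _ => VG n w) iG).
have iZ' n : P.-integrable setT (EFin \o Z n).
  by have := iZ n; rewrite sqr_sqrt.
have EZ' n : \int[P]_w Z n w = Num.sqrt 2.
  by rewrite -(EZ n); apply: eq_Rintegral => w _; rewrite sqr_sqrt.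
have cV : \int[P]_w V n w @[n --> \oo] --> 0.
  rewrite (_ : 0 = \int[P]_w (fun=> 0 : R) w); last by rewrite Rintegral_prob_cst.
  apply: (Rintegral_dominated_cvg measurableT (g := fun w => C ^+ 2 * C1 * expR (e * S w ^+ 2))) => // w _.
  rewrite -[X in _ --> X](mulr0 ((C * expR (e / 4 * S w ^+ 2)) ^+ 2)) -[X in _ * X](expr0n _ 2).
  apply: cvgM; first exact: cvg_cst.
  by rewrite expr2; apply: cvgM; exact: cxi.
have iBd k n : P.-integrable setT (EFin \o (fun w => de n * (k * (B * Z n w) + k^-1 * V n w))).
  apply: integrable_scale => //; apply: integrable_addr => //; last exact: integrable_scale.
  by apply: integrable_scale => //; exact: integrable_scale.
have iRem n : P.-integrable setT (EFin \o Rem n).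
  exact: (dominated_integrable_real measurableT (mRem n) (fun w _ => RemV 1 n w ltr01) (iBd 1 n)).
have RemI k n : 0 < k -> `|(\int[P]_w Rem n w) / de n| <= k * (B * Num.sqrt 2) + k^-1 * \int[P]_w V n w.
  move=> k0; rewrite normrM (ger0_norm (_ : 0 <= (de n)^-1)) ?invr_ge0 ?(ltW (de_gt0 n))//.
  rewrite ler_pdivrMr// mulrC (le_trans (le_normr_Rintegral _ (iRem n)))//.
  apply: (@le_trans _ _ (\int[P]_w (de n * (k * (B * Z n w) + k^-1 * V n w)))).
    by apply: le_Rintegral => //; [exact: integrable_norm|move=> w _; exact: RemV].
  rewrite RintegralZl//; last first.
    apply: integrable_addr => //; last exact: integrable_scale.
    by apply: integrable_scale => //; exact: integrable_scale.
  rewrite ler_wpM2l ?(ltW (de_gt0 n))// RintegralD//; last 2 first.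
  - by apply: integrable_scale => //; exact: integrable_scale.
  - exact: integrable_scale.
  rewrite !RintegralZl ?EZ'//; last exact: integrable_scale.
have cRem : (\int[P]_w Rem n w) / de n @[n --> \oo] --> 0.
  have B2 : 0 < B * Num.sqrt 2 + 1 by rewrite ltr_wpDl// mulr_ge0// sqrtr_ge0.
  apply/cvgrPdist_le => ep ep0; pose k := ep / 2 / (B * Num.sqrt 2 + 1).
  have k0 : 0 < k by rewrite !divr_gt0.
  have kv : k^-1 * \int[P]_w V n w @[n --> \oo] --> 0.
    by rewrite -[X in _ --> X](mulr0 k^-1); apply: cvgM => //; exact: cvg_cst.
  have ep2 : 0 < ep / 2 by rewrite divr_gt0.
  have /cvgrPdist_le/(_ _ ep2) := kv; apply: filterS => n; rewrite !sub0r !normrN => vn.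
  rewrite (le_trans (RemI k n k0))// (splitr ep) lerD//; last by rewrite (le_trans (ler_norm _)).
  by rewrite /k mulrAC ler_pdivrMr// ler_wpM2l ?(ltW ep2)// lerDl.
have ixi n : P.-integrable setT (EFin \o (fun w => xi n w)).
  by apply: integrable_scale => //; exact: iX.
have ixi2 n : P.-integrable setT (EFin \o (fun w => xi n w ^+ 2)).
  rewrite (_ : _ \o _ = EFin \o (fun w => (c * expR (- b * tn n)) ^+ 2 * (W (tn n) w - W (sn n) w) ^+ 2)).
    by apply: integrable_scale => //; exact: iX2.
  by apply/funext => w /=; rewrite exprMn.
have Exi n : \int[P]_w xi n w = 0.
  by rewrite RintegralZl//; [rewrite (normal_mean0 (@mW n) (sqrt_gt0 n) (@law n)) mulr0|exact: iX].
have Exi2 n : \int[P]_w xi n w ^+ 2 = (c * expR (- b * tn n)) ^+ 2 * de n.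
  transitivity (\int[P]_w ((c * expR (- b * tn n)) ^+ 2 * (W (tn n) w - W (sn n) w) ^+ 2)).
    by apply: eq_Rintegral => w _; rewrite exprMn.
  rewrite RintegralZl//; last exact: iX2.
  by rewrite (normal_variance (@mW n) (sqrt_gt0 n) (@law n)) sqr_sqrt.
have -> : (fun n => (\int[P]_w (f (tn n) (y + xi n w) - f (tn n) y)) / de n) =
    (fun n => (\int[P]_w Rem n w) / de n + dy (dy f) (tn n) y / 2 * (c * expR (- b * tn n)) ^+ 2).
  apply/funext => n.
  have -> : \int[P]_w (f (tn n) (y + xi n w) - f (tn n) y) =
      \int[P]_w (Rem n w + (dy f (tn n) y * xi n w + dy (dy f) (tn n) y / 2 * xi n w ^+ 2)).
    by apply: eq_Rintegral => w _; rewrite /Rem; ring.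
  rewrite RintegralD//; last by apply: integrable_addr => //; exact: integrable_scale.
  rewrite [X in _ + X]RintegralD//; [|by apply: integrable_scale..].
  have -> : \int[P]_w (dy f (tn n) y * xi n w) = 0 by rewrite RintegralZl// Exi mulr0.
  have -> : \int[P]_w (dy (dy f) (tn n) y / 2 * xi n w ^+ 2) =
      dy (dy f) (tn n) y / 2 * ((c * expR (- b * tn n)) ^+ 2 * de n).
    by rewrite RintegralZl// Exi2.
  rewrite add0r mulrDl; congr (_ + _).
  by rewrite -[LHS]mulrA mulfK ?gt_eqF.
rewrite -[X in _ --> X]add0r; apply: cvgD => //.
rewrite (_ : c ^+ 2 / 2 * expR (- b * tau) ^+ 2 * dy (dy f) tau y =
  dy (dy f) tau y / 2 * ((c * expR (- b * tau)) * (c * expR (- b * tau)))); last by ring.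
apply: cvgM.
  apply: cvgM; last exact: cvg_cst.
  by apply: (smooth_seqcont sf2) => //; exact: cvg_cst.
rewrite (_ : (fun n => _) = fun n => c * expR (- b * tn n) * (c * expR (- b * tn n)))//.
by apply: cvgM; (apply: cvgM; [exact: cvg_cst|exact: cexp]).
Qed.

End increments.

Section backward_equation.
Context {R : realType} d (Om : measurableType d) (P : probability Om R).
Variables (W : R -> Om -> R) (a b c T : R).
Hypothesis bW : is_brownian_motion P W.
Hypothesis T0 : 0 < T.
Local Notation mu := (@lebesgue_measure R).
Local Notation M := (Mproc W a b c T).
Local Notation S := (Mbound W a b c T).
Variables (g1 g2 : R -> R -> R) (q : R -> R).
Hypothesis sg1 : smooth g1.
Hypothesis sg2 : smooth g2.
Hypothesis sq : smooth (fun _ => q).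
Hypothesis g1_le0 : forall s y, g1 s y <= 0.
Local Notation Ig := (rate_integral W a b c T).
Local Notation J1 := (discount_re W a b c T g1 g2).
Local Notation J2 := (discount_im W a b c T g1 g2).
Local Notation f1 := (fk_re P W a b c T g1 g2 q).
Local Notation f2 := (fk_im P W a b c T g1 g2 q).

Let path_cont g y s w : smooth g -> continuous (fun r => g r (y + (M r w - M s w))).
Proof. by move=> sg; apply: (continuous_along_path bW T0); exact: smooth_seqcont. Qed.

(** The mean value theorem is real, so the two components of the complex exponential have separate
    intermediate times. *)
Lemma J_mean_value s t y w : 0 <= s -> s <= t ->
  (exists2 r, s <= r <= t & J1 s t y w - 1 =
    (J1 s r y w * g1 r (y + (M r w - M s w)) - J2 s r y w * g2 r (y + (M r w - M s w))) * (t - s)) /\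
  (exists2 r, s <= r <= t & J2 s t y w =
    (J2 s r y w * g1 r (y + (M r w - M s w)) + J1 s r y w * g2 r (y + (M r w - M s w))) * (t - s)).
Proof.
move=> s0 st; have s1 : -1 < s by rewrite (lt_le_trans _ s0)// ltrN10.
have [K1 [dK1 K1E]] := continuous_antiderivative (@path_cont g1 y s w sg1).
have [K2 [dK2 K2E]] := continuous_antiderivative (@path_cont g2 y s w sg2).
have de1 (r : R) : s <= r <= t -> is_derive r 1 (fun x : R => expR (K1 x - K1 s))
    (expR (K1 r - K1 s) * g1 r (y + (M r w - M s w))).
  move=> /andP[sr _]; have r1 : -1 < r := lt_le_trans s1 sr.
  have h1 : is_derive r 1 (fun x : R => K1 x - K1 s) (g1 r (y + (M r w - M s w))).
    by apply: (is_derive_eq (is_deriveB (dK1 r r1) (is_derive_cst (K1 s) r 1))); rewrite subr0.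
  by have := @is_derive1_comp R expR (fun x => K1 x - K1 s) r _ _ (is_derive_expR _) h1; rewrite mulrC.
have de2 (r : R) : s <= r <= t -> is_derive r 1 (fun x : R => K2 x - K2 s) (g2 r (y + (M r w - M s w))).
  move=> /andP[sr _]; have r1 : -1 < r := lt_le_trans s1 sr.
  by apply: (is_derive_eq (is_deriveB (dK2 r r1) (is_derive_cst (K2 s) r 1))); rewrite subr0.
have dc (r : R) : s <= r <= t -> is_derive r 1 (fun x : R => cos (K2 x - K2 s))
    (- sin (K2 r - K2 s) * g2 r (y + (M r w - M s w))).
  by move=> rI; have := @is_derive1_comp R cos (fun x => K2 x - K2 s) r _ _ (is_derive_cos _) (de2 r rI);
    rewrite mulrC.
have ds (r : R) : s <= r <= t -> is_derive r 1 (fun x : R => sin (K2 x - K2 s))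
    (cos (K2 r - K2 s) * g2 r (y + (M r w - M s w))).
  by move=> rI; have := @is_derive1_comp R sin (fun x => K2 x - K2 s) r _ _ (is_derive_sin _) (de2 r rI);
    rewrite mulrC.
have JE r : s <= r -> J1 s r y w = expR (K1 r - K1 s) * cos (K2 r - K2 s) /\
    J2 s r y w = expR (K1 r - K1 s) * sin (K2 r - K2 s).
  by move=> sr; rewrite /discount_re /discount_im /rate_integral !K1E// !K2E.
split.
- have [|r rI] := mean_value (K := fun x : R => expR (K1 x - K1 s) * cos (K2 x - K2 s))
      (k := fun r => expR (K1 r - K1 s) * (- sin (K2 r - K2 s) * g2 r (y + (M r w - M s w))) +
        cos (K2 r - K2 s) * (expR (K1 r - K1 s) * g1 r (y + (M r w - M s w)))) st.
    by move=> r rI; exact: (is_deriveM (de1 r rI) (dc r rI)).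
  rewrite !subrr expR0 cos0 mulr1 => E; exists r => //.
  have /andP[sr _] := rI; have [-> ->] := JE r sr; have [-> _] := JE t st.
  by rewrite E; ring.
- have [|r rI] := mean_value (K := fun x : R => expR (K1 x - K1 s) * sin (K2 x - K2 s))
      (k := fun r => expR (K1 r - K1 s) * (cos (K2 r - K2 s) * g2 r (y + (M r w - M s w))) +
        sin (K2 r - K2 s) * (expR (K1 r - K1 s) * g1 r (y + (M r w - M s w)))) st.
    by move=> r rI; exact: (is_deriveM (de1 r rI) (ds r rI)).
  rewrite !subrr expR0 sin0 mulr0 subr0 => E; exists r => //.
  have /andP[sr _] := rI; have [-> ->] := JE r sr; have [_ ->] := JE t st.
  by rewrite E; ring.
Qed.

Variables (sn tn : nat -> R) (tau y : R).
Hypothesis sn0 : forall n, 0 <= sn n.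
Hypothesis stn : forall n, sn n < tn n.
Hypothesis tnT : forall n, tn n <= T.
Hypothesis csn : sn n @[n --> \oo] --> tau.
Hypothesis ctn : tn n @[n --> \oo] --> tau.

Local Notation de n := (tn n - sn n).
Local Notation Y n w := (y + (M (tn n) w - M (sn n) w)).
Local Notation xi n w := (c * expR (- b * tn n) * (W (tn n) w - W (sn n) w)).

Let de_gt0 n : 0 < de n. Proof. by rewrite subr_gt0. Qed.

Let tn0 n : 0 <= tn n. Proof. exact: le_trans (sn0 n) (ltW (stn n)). Qed.

Let cde : de n @[n --> \oo] --> 0.
Proof. by rewrite -(subrr tau); exact: cvgB. Qed.

Let between (r : nat -> R) : (forall n, sn n <= r n <= tn n) -> r n @[n --> \oo] --> tau.
Proof.
by move=> h; apply: (@squeeze_cvgr _ _ _ _ sn tn) => //; exact: nearW.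
Qed.

Let cYr (r : nat -> R) w : (forall n, sn n <= r n <= tn n) ->
  y + (M (r n) w - M (sn n) w) @[n --> \oo] --> y.
Proof.
move=> /between cr; rewrite -[X in _ --> X](addr0 y) -(subrr (M tau w)).
apply: cvgD; first exact: cvg_cst.
have cM := @Mproc_continuous _ _ _ _ _ a b c _ bW T0 w tau.
by apply: cvgB; [exact: (cvg_comp _ _ cr cM)|exact: (cvg_comp _ _ csn cM)].
Qed.

Let mY n : measurable_fun setT (fun w => Y n w).
Proof. by apply: measurable_funD => //; apply: measurable_funB; exact: (Mproc_measurable _ _ _ bW). Qed.

Let cIg g (r : nat -> R) w : smooth g -> (forall n, sn n <= r n <= tn n) ->
  Ig g (sn n) (r n) y w @[n --> \oo] --> 0.
Proof.
move=> sg rI.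
have [C C0 HC] := smooth_growth y sg ltr01.
apply: (cvg_dist_le (v := fun n => C * expR (1 * S w ^+ 2) * de n)) => [n|]; last first.
  by rewrite -[X in _ --> X](mulr0 (C * expR (1 * S w ^+ 2))); apply: cvgM => //; exact: cvg_cst.
have /andP[sr rt] := rI n.
have s1 : -1 < sn n by rewrite (lt_le_trans _ (sn0 n))// ltrN10.
have [z _] := Rintegral_mean (@path_cont g y (sn n) w sg) s1 sr.
rewrite /rate_integral => ->; rewrite subr0 normrM ler_pM//; last by rewrite ger0_norm ?subr_ge0// lerB.
by apply: HC; rewrite addrAC subrr add0r; exact: (Mproc_dist_le a b c bW T0).
Qed.

Let cJ (r : nat -> R) w : (forall n, sn n <= r n <= tn n) ->
  (J1 (sn n) (r n) y w @[n --> \oo] --> (1 : R)) /\ (J2 (sn n) (r n) y w @[n --> \oo] --> (0 : R)).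
Proof.
move=> rI; have c1 := cIg w sg1 rI; have c2 := cIg w sg2 rI.
have h1 := cvg_comp _ _ c1 (@continuous_expR R 0).
have h2 := cvg_comp _ _ c2 (@continuous_cos R 0).
have h3 := cvg_comp _ _ c2 (@continuous_sin R 0).
split.
- by have := cvgM h1 h2; rewrite expR0 cos0 mulr1; exact.
- by have := cvgM h1 h3; rewrite sin0 mulr0; exact.
Qed.

Let mJ n : measurable_fun setT (J1 (sn n) (tn n) y) /\ measurable_fun setT (J2 (sn n) (tn n) y).
Proof.
have tI : sn n <= tn n <= tn n by rewrite (ltW (stn n)) lexx.
have [m1 m2] := measurable_past_J a b c bW T0 sg1 sg2 y (sn0 n) (stn n) tI (tnT n).
by split; exact: (past_measurable_fun bW (sn0 n) (stn n)).
Qed.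

Lemma interest_quotient f : seqcont f -> (forall t y, `|f t y| <= 1) ->
  ((\int[P]_w ((J1 (sn n) (tn n) y w - 1) * f (tn n) (Y n w))) / de n @[n --> \oo] --> g1 tau y * f tau y) /\
  ((\int[P]_w (J2 (sn n) (tn n) y w * f (tn n) (Y n w))) / de n @[n --> \oo] --> g2 tau y * f tau y).
Proof.
move=> cf fb; have [mS [e e0 ie]] := Mbound_integrable a b c bW T0.
have [C1 C10 HC1] := smooth_growth y sg1 e0.
have [C2 C20 HC2] := smooth_growth y sg2 e0.
have mf n : measurable_fun setT (fun w => f (tn n) (Y n w)) by apply: seqcont_measurable.
have iG : P.-integrable setT (EFin \o (fun w => (C1 + C2) * expR (e * S w ^+ 2))).
  exact: integrable_scale.
have gb r n w : `|g1 r (y + (M r w - M (sn n) w))| <= C1 * expR (e * S w ^+ 2) /\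
    `|g2 r (y + (M r w - M (sn n) w))| <= C2 * expR (e * S w ^+ 2).
  have h : `|y + (M r w - M (sn n) w) - y| <= S w.
    by rewrite addrAC subrr add0r; exact: (Mproc_dist_le a b c bW T0).
  by split; [exact: HC1|exact: HC2].
have bd (u1 u2 v1 v2 G1 G2 : R) : `|u1| <= 1 -> `|u2| <= 1 -> `|v1| <= G1 -> `|v2| <= G2 ->
    `|u1 * v1 + u2 * v2| <= G1 + G2.
  move=> h1 h2 h3 h4; rewrite (le_trans (ler_normD _ _))// lerD// normrM -[leRHS]mul1r ler_pM//.
have bJ1 n r w : sn n <= r -> `|J1 (sn n) r y w| <= 1 by exact: (discount_re_bound a b c bW T0).
have bJ2 n r w : sn n <= r -> `|J2 (sn n) r y w| <= 1 by exact: (discount_im_bound a b c bW T0).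
have El (x : R) : x = \int[P]_w x by rewrite Rintegral_prob_cst.
split.
- rewrite [X in _ --> X]El; apply: (Rintegral_quotient_cvg (G := fun w => (C1 + C2) * expR (e * S w ^+ 2))) => //.
  + move=> n; apply: measurable_funM => //; apply: measurable_funB => //.
    by have [] := mJ n.
  + move=> n w; have [[r /andP[sr _] ->] _] := J_mean_value y w (sn0 n) (ltW (stn n)).
    have [b1 b2] := gb r n w.
    rewrite normrM -[leRHS]mulr1 ler_pM// normrM (ger0_norm (ltW (de_gt0 n))).
    rewrite ler_wpM2r ?(ltW (de_gt0 n))// mulrDl -mulNr.
    by apply: bd => //; rewrite ?normrN; [exact: bJ1|exact: bJ2].
  + move=> w.
    have /choice[r rP] : forall n, exists r, sn n <= r <= tn n /\ J1 (sn n) (tn n) y w - 1 =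
      (J1 (sn n) r y w * g1 r (y + (M r w - M (sn n) w)) - J2 (sn n) r y w * g2 r (y + (M r w - M (sn n) w))) * de n.
      by move=> n; have [[r rI rE] _] := J_mean_value y w (sn0 n) (ltW (stn n)); exists r.
    have rI n : sn n <= r n <= tn n by case: (rP n).
    have cYY := cYr w rI; have cr := between rI; have [cJ1 cJ2] := cJ w rI.
    rewrite (_ : (fun n => _) = fun n => (J1 (sn n) (r n) y w * g1 (r n) (y + (M (r n) w - M (sn n) w)) -
      J2 (sn n) (r n) y w * g2 (r n) (y + (M (r n) w - M (sn n) w))) * f (tn n) (Y n w)); last first.
      by apply/funext => n; have [_ ->] := rP n; rewrite mulrAC mulfK// gt_eqF.
    apply: cvgM; last first.
      by apply: cf => //; apply: (cYr (r := tn)) => n; rewrite lexx ltW.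
    rewrite -[X in _ --> X]subr0 -[X in _ --> X - _]mul1r -[X in _ --> _ - X](mul0r (g2 tau y)).
    by apply: cvgB; apply: cvgM => //; apply: smooth_seqcont.
- rewrite [X in _ --> X]El; apply: (Rintegral_quotient_cvg (G := fun w => (C1 + C2) * expR (e * S w ^+ 2))) => //.
  + by move=> n; apply: measurable_funM => //; have [] := mJ n.
  + move=> n w; have [_ [r /andP[sr _] ->]] := J_mean_value y w (sn0 n) (ltW (stn n)).
    have [b1 b2] := gb r n w.
    rewrite normrM -[leRHS]mulr1 ler_pM// normrM (ger0_norm (ltW (de_gt0 n))).
    rewrite ler_wpM2r ?(ltW (de_gt0 n))// mulrDl.
    by apply: bd => //; [exact: bJ2|exact: bJ1].
  + move=> w.
    have /choice[r rP] : forall n, exists r, sn n <= r <= tn n /\ J2 (sn n) (tn n) y w =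
      (J2 (sn n) r y w * g1 r (y + (M r w - M (sn n) w)) + J1 (sn n) r y w * g2 r (y + (M r w - M (sn n) w))) * de n.
      by move=> n; have [_ [r rI rE]] := J_mean_value y w (sn0 n) (ltW (stn n)); exists r.
    have rI n : sn n <= r n <= tn n by case: (rP n).
    have cYY := cYr w rI; have cr := between rI; have [cJ1 cJ2] := cJ w rI.
    rewrite (_ : (fun n => _) = fun n => (J2 (sn n) (r n) y w * g1 (r n) (y + (M (r n) w - M (sn n) w)) +
      J1 (sn n) (r n) y w * g2 (r n) (y + (M (r n) w - M (sn n) w))) * f (tn n) (Y n w)); last first.
      by apply/funext => n; have [_ ->] := rP n; rewrite mulrAC mulfK// gt_eqF.
    apply: cvgM; last first.
      by apply: cf => //; apply: (cYr (r := tn)) => n; rewrite lexx ltW.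
    rewrite -[X in _ --> X]add0r -[X in _ --> _ + X]mul1r -[X in _ --> X + _](mul0r (g1 tau y)).
    by apply: cvgD; apply: cvgM => //; apply: smooth_seqcont.
Qed.

Lemma generator_quotient f : smooth f -> (forall t y, `|f t y| <= 1) ->
  (\int[P]_w (f (tn n) (Y n w) - f (tn n) y)) / de n @[n --> \oo] -->
  a * expR (- b * tau) * dy f tau y + c ^+ 2 / 2 * expR (- b * tau) ^+ 2 * dy (dy f) tau y.
Proof.
move=> sf fb; have cf := smooth_seqcont sf.
have h1 := @drift_quotient _ _ _ _ _ a b c _ bW T0 _ _ _ y sn0 stn tnT csn ctn _ sf.
have h2 := @diffusion_quotient _ _ _ _ _ a b c _ bW T0 _ _ _ y sn0 stn tnT csn ctn _ sf.
have mX n : measurable_fun setT (fun w => y + xi n w).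
  apply: measurable_funD => //; apply: measurable_funM => //.
  by apply: measurable_funB; apply: (brownian_measurable bW) => //; exact: ltW.
have bi (u v : Om -> R) n : measurable_fun setT u -> measurable_fun setT v ->
    P.-integrable setT (EFin \o (fun w => f (tn n) (u w) - f (tn n) (v w))).
  move=> mu' mv; apply: (bounded_integrable P (C := 1 + 1)).
    by apply: measurable_funB; apply: seqcont_measurable.
  by move=> w; rewrite (le_trans (ler_normB _ _))// lerD.
rewrite (_ : (fun n => _) = fun n =>
  (\int[P]_w (f (tn n) (Y n w) - f (tn n) (y + xi n w))) / de n +
  (\int[P]_w (f (tn n) (y + xi n w) - f (tn n) y)) / de n); first exact: cvgD.
apply/funext => n; rewrite -mulrDl -RintegralD//.
- by congr (_ / _); apply: eq_Rintegral => w _; rewrite [RHS]addrA subrK.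
- exact: bi.
- exact: bi.
Qed.

(** By [f_markov] the difference splits into the effect of the displacement and that of the
    discount. Both ends of the intervals [[sn, tn]] may move, so left and right derivatives at [tau]
    are covered together. *)
Lemma feynman_kac_quotient :
  ((f1 (sn n) y - f1 (tn n) y) / de n @[n --> \oo] -->
    a * expR (- b * tau) * dy f1 tau y + c ^+ 2 / 2 * expR (- b * tau) ^+ 2 * dy (dy f1) tau y
    + (g1 tau y * f1 tau y - g2 tau y * f2 tau y)) /\
  ((f2 (sn n) y - f2 (tn n) y) / de n @[n --> \oo] -->
    a * expR (- b * tau) * dy f2 tau y + c ^+ 2 / 2 * expR (- b * tau) ^+ 2 * dy (dy f2) tau y
    + (g1 tau y * f2 tau y + g2 tau y * f1 tau y)).
Proof.
have sf1 : smooth f1 := dadm_fk_re a b c bW T0 sg1 sg2 sq g1_le0.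
have sf2 : smooth f2 := dadm_fk_im a b c bW T0 sg1 sg2 sq g1_le0.
have b1 t' y' : `|f1 t' y'| <= 1.
  by apply: bounded_expectation; [exact: (weight_re_measurable a b c bW T0)|exact: (weight_re_bound a b c bW T0)].
have b2 t' y' : `|f2 t' y'| <= 1.
  by apply: bounded_expectation; [exact: (weight_im_measurable a b c bW T0)|exact: (weight_im_bound a b c bW T0)].
have c1 := smooth_seqcont sf1; have c2 := smooth_seqcont sf2.
have bJ1 n w : `|J1 (sn n) (tn n) y w| <= 1 by apply: (discount_re_bound a b c bW T0) => //; exact: ltW.
have bJ2 n w : `|J2 (sn n) (tn n) y w| <= 1 by apply: (discount_im_bound a b c bW T0) => //; exact: ltW.
have iJ1 f n : seqcont f -> (forall t y, `|f t y| <= 1) ->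
    P.-integrable setT (EFin \o (fun w => (J1 (sn n) (tn n) y w - 1) * f (tn n) (Y n w))).
  move=> cf fb; apply: (bounded_integrable P (C := (1 + 1) * 1)).
    apply: measurable_funM; last exact: seqcont_measurable.
    by apply: measurable_funB => //; have [] := mJ n.
  by move=> w; rewrite normrM ler_pM// (le_trans (ler_normB _ _))// normr1 lerD.
have iJ2 f n : seqcont f -> (forall t y, `|f t y| <= 1) ->
    P.-integrable setT (EFin \o (fun w => J2 (sn n) (tn n) y w * f (tn n) (Y n w))).
  move=> cf fb; apply: (bounded_integrable P (C := 1)).
    by apply: measurable_funM; [have [] := mJ n|exact: seqcont_measurable].
  by move=> w; rewrite normrM -[leRHS]mulr1 ler_pM.
have iD f n : seqcont f -> (forall t y, `|f t y| <= 1) ->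
    P.-integrable setT (EFin \o (fun w => f (tn n) (Y n w) - f (tn n) y)).
  move=> cf fb; apply: (bounded_integrable P (C := 1 + 1)).
    by apply: measurable_funB => //; exact: seqcont_measurable.
  by move=> w; rewrite (le_trans (ler_normB _ _))// lerD.
have [i11 i12] := interest_quotient c1 b1; have [i21 i22] := interest_quotient c2 b2.
have d1 := generator_quotient sf1 b1; have d2 := generator_quotient sf2 b2.
have split_f (f : R -> R -> R) (F : Om -> R) n : seqcont f -> (forall t y, `|f t y| <= 1) ->
    P.-integrable setT (EFin \o F) ->
    \int[P]_w (J1 (sn n) (tn n) y w * f (tn n) (Y n w) + F w) - f (tn n) y =
    \int[P]_w (f (tn n) (Y n w) - f (tn n) y) +
    (\int[P]_w ((J1 (sn n) (tn n) y w - 1) * f (tn n) (Y n w)) + \int[P]_w F w).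
  move=> cf fb iF; rewrite -[X in _ - X = _](Rintegral_prob_cst P).
  have i1 := iJ1 f n cf fb; have i2 := iD f n cf fb.
  have i3 : P.-integrable setT (EFin \o (fun w => J1 (sn n) (tn n) y w * f (tn n) (Y n w) + F w)).
    apply: (integrable_addr _ iF); apply: (bounded_integrable P (C := 1)).
      by apply: measurable_funM; [have [] := mJ n|exact: seqcont_measurable].
    by move=> w; rewrite normrM -[leRHS]mulr1 ler_pM.
  rewrite -RintegralB//; last exact: (bounded_integrable P (C := `|f (tn n) y|)).
  rewrite -RintegralD// -RintegralD//; last exact: integrable_addr.
  by apply: eq_Rintegral => w _; ring.
have ic n := f_markov a b c bW T0 sg1 sg2 sq g1_le0 y (sn0 n) (stn n) (tnT n).
have distr_sub (x1 x2 x3 z : R) : (x1 + (x2 - x3)) / z = x1 / z + (x2 / z - x3 / z).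
  by rewrite mulrDl mulrBl.
have distr_add (x1 x2 x3 z : R) : (x1 + (x2 + x3)) / z = x1 / z + (x2 / z + x3 / z).
  by rewrite !mulrDl.
have key1 n : f1 (sn n) y - f1 (tn n) y = \int[P]_w (f1 (tn n) (Y n w) - f1 (tn n) y) +
    (\int[P]_w ((J1 (sn n) (tn n) y w - 1) * f1 (tn n) (Y n w)) -
     \int[P]_w (J2 (sn n) (tn n) y w * f2 (tn n) (Y n w))).
  transitivity (\int[P]_w (J1 (sn n) (tn n) y w * f1 (tn n) (Y n w) +
      -1 * (J2 (sn n) (tn n) y w * f2 (tn n) (Y n w))) - f1 (tn n) y).
    congr (_ - _); have [h _] := ic n; rewrite [LHS]h.
    by apply: eq_Rintegral => w _; rewrite mulN1r.
  have i2 := iJ2 f2 n c2 b2.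
  rewrite split_f//; last by apply: integrable_scale.
  by congr (_ + (_ + _)); rewrite RintegralZl ?mulN1r.
have key2 n : f2 (sn n) y - f2 (tn n) y = \int[P]_w (f2 (tn n) (Y n w) - f2 (tn n) y) +
    (\int[P]_w ((J1 (sn n) (tn n) y w - 1) * f2 (tn n) (Y n w)) +
     \int[P]_w (J2 (sn n) (tn n) y w * f1 (tn n) (Y n w))).
  transitivity (\int[P]_w (J1 (sn n) (tn n) y w * f2 (tn n) (Y n w) +
      J2 (sn n) (tn n) y w * f1 (tn n) (Y n w)) - f2 (tn n) y).
    congr (_ - _); have [_ h] := ic n; rewrite [LHS]h.
    by apply: eq_Rintegral => w _; rewrite [LHS]addrC.
  by rewrite split_f//; exact: iJ2.
split.
- rewrite (_ : (fun n => _) = fun n => (\int[P]_w (f1 (tn n) (Y n w) - f1 (tn n) y)) / de n +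
    ((\int[P]_w ((J1 (sn n) (tn n) y w - 1) * f1 (tn n) (Y n w))) / de n -
     (\int[P]_w (J2 (sn n) (tn n) y w * f2 (tn n) (Y n w))) / de n)).
    exact: cvgD d1 (cvgB i11 i22).
  apply/funext => n; apply: (etrans (congr1 (fun x => x / de n) (key1 n))).
  exact: distr_sub.
- rewrite (_ : (fun n => _) = fun n => (\int[P]_w (f2 (tn n) (Y n w) - f2 (tn n) y)) / de n +
    ((\int[P]_w ((J1 (sn n) (tn n) y w - 1) * f2 (tn n) (Y n w))) / de n +
     (\int[P]_w (J2 (sn n) (tn n) y w * f1 (tn n) (Y n w))) / de n)).
    exact: cvgD d2 (cvgD i21 i12).
  apply/funext => n; apply: (etrans (congr1 (fun x => x / de n) (key2 n))).
  exact: distr_add.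
Qed.

End backward_equation.

(** * Time derivatives along sequences *)

Section sequential_derivative.
Context {R : realType}.

Lemma is_derive_seq (h : R -> R) (x l : R) : is_derive x 1 h l <->
  (forall u : nat -> R, (forall n, u n != x) -> u n @[n --> \oo] --> x ->
    (h (u n) - h x) / (u n - x) @[n --> \oo] --> l).
Proof.
split=> [hl u ux cu|H].
  have h0 : (fun r : R => r^-1 *: ((h \o shift x) (r *: 1) - h x)) @ 0^' --> l.
    have := @ex_derive _ _ _ _ _ _ _ hl; rewrite /derivable => /cvg_ex[l' cl'].
    by rewrite -(@derive_val _ _ _ _ _ _ _ hl) /derive (cvg_lim _ cl').
  have cux : u n - x @[n --> \oo] --> 0.
    by rewrite -(subrr x); apply: cvgB => //; exact: cvg_cst.
  have nux n : u n - x != 0 by rewrite subr_eq0.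
  have h1 := proj1 (cvgr_dnbhsP _ _ _) h0 _ (conj nux cux).
  suff -> : (fun n => (h (u n) - h x) / (u n - x)) = (fun n => (u n - x)^-1 *:
      ((h \o shift x) ((u n - x) *: 1) - h x)) by exact: h1.
  by apply/funext => n; rewrite /GRing.scale/= mulr1 subrK mulrC.
have h0 : (fun r : R => r^-1 *: ((h \o shift x) (r *: 1) - h x)) @ 0^' --> l.
  apply/cvgr_dnbhsP => u [u0 cu].
  rewrite (_ : (fun n => _) = fun n => (h (u n + x) - h x) / (u n + x - x)).
    apply: (H (fun n => u n + x)) => [n|]; first by rewrite -subr_eq0 addrK.
    by rewrite -[X in _ --> X](add0r x); apply: cvgD => //; exact: cvg_cst.
  by apply/funext => n; rewrite /GRing.scale/= mulr1 addrK mulrC.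
apply: DeriveDef; first by apply/cvg_ex; exists l.
exact: cvg_lim.
Qed.

Variable T : R.
Hypothesis T0 : 0 < T.

(** The derivative relative to [[0, T]], one-sided at the two ends. *)
Definition tderiv (h : R -> R) (t l : R) := forall r : nat -> R,
  (forall n, 0 <= r n <= T) -> (forall n, r n != t) -> r n @[n --> \oo] --> t ->
  (h (r n) - h t) / (r n - t) @[n --> \oo] --> l.

Lemma tderiv_continuous h t l (r : nat -> R) : tderiv h t l ->
  (forall n, 0 <= r n <= T) -> (forall n, r n != t) -> r n @[n --> \oo] --> t ->
  h (r n) @[n --> \oo] --> h t.
Proof.
move=> dh rI rt cr; have q := dh r rI rt cr.
have d0 : r n - t @[n --> \oo] --> 0 by rewrite -(subrr t); apply: cvgB => //; exact: cvg_cst.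
rewrite (_ : (fun n => _) = fun n => (h (r n) - h t) / (r n - t) * (r n - t) + h t).
  rewrite -[X in _ --> X]add0r -[X in _ --> X + _](mulr0 l).
  by apply: cvgD; [exact: cvgM|exact: cvg_cst].
by apply/funext => n; rewrite divfK ?subr_eq0// subrK.
Qed.

Lemma tderiv_eq h k t l : 0 <= t <= T -> (forall s, 0 <= s <= T -> h s = k s) ->
  tderiv h t l -> tderiv k t l.
Proof.
move=> tI hk dh r rI rt cr; have := dh r rI rt cr.
by rewrite hk// (_ : (fun n => _) = fun n => (k (r n) - k t) / (r n - t))//;
  apply/funext => n; rewrite hk.
Qed.

Lemma tderiv_cst (k t : R) : tderiv (fun=> k) t 0.
Proof.
move=> r _ _ _; rewrite (_ : (fun n => _) = fun=> 0); first exact: cvg_cst.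
by apply/funext => n; rewrite subrr mul0r.
Qed.

Lemma tderivD h k t l m : tderiv h t l -> tderiv k t m -> tderiv (fun s => h s + k s) t (l + m).
Proof.
move=> dh dk r rI rt cr.
rewrite (_ : (fun n => _) = fun n => (h (r n) - h t) / (r n - t) + (k (r n) - k t) / (r n - t)).
  by apply: cvgD; [exact: dh|exact: dk].
by apply/funext => n; rewrite -mulrDl; congr (_ / _); ring.
Qed.

Lemma tderivM h k t l m : tderiv h t l -> tderiv k t m ->
  tderiv (fun s => h s * k s) t (l * k t + h t * m).
Proof.
move=> dh dk r rI rt cr; have ck := tderiv_continuous dk rI rt cr.
rewrite (_ : (fun n => _) = fun n => (h (r n) - h t) / (r n - t) * k (r n) +
    h t * ((k (r n) - k t) / (r n - t))).
  by apply: cvgD; apply: cvgM; [exact: dh|exact: ck|exact: cvg_cst|exact: dk].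
by apply/funext => n; rewrite mulrAC mulrA -mulrDl; congr (_ / _); ring.
Qed.

Lemma tderivZ h t l k : tderiv h t l -> tderiv (fun s => k * h s) t (k * l).
Proof.
by move=> dh; have := tderivM (@tderiv_cst k t) dh; rewrite mul0r add0r.
Qed.

Lemma tderivN h t l : tderiv h t l -> tderiv (fun s => - h s) t (- l).
Proof.
move=> dh; have := tderivZ (k := -1) dh; rewrite mulN1r.
by rewrite (_ : (fun s => -1 * h s) = fun s => - h s)//; apply/funext => s; rewrite mulN1r.
Qed.

Lemma tderivB h k t l m : tderiv h t l -> tderiv k t m -> tderiv (fun s => h s - k s) t (l - m).
Proof. by move=> dh dk; exact: tderivD (tderivN dk). Qed.

Lemma tderivV h t l : (forall s, 0 <= s <= T -> h s != 0) -> 0 <= t <= T ->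
  tderiv h t l -> tderiv (fun s => (h s)^-1) t (- l / h t ^+ 2).
Proof.
move=> h0 tI dh r rI rt cr; have ch := tderiv_continuous dh rI rt cr.
rewrite (_ : (fun n => _) = fun n => - ((h (r n) - h t) / (r n - t)) * ((h (r n))^-1 * (h t)^-1)).
  rewrite expr2 invfM; apply: cvgM; first by apply: cvgN; exact: dh.
  by apply: cvgM; [apply: cvgV => //; exact: h0|exact: cvg_cst].
apply/funext => n; have := rt n; rewrite -subr_eq0 => ?.
by field; rewrite !h0// !andbT.
Qed.

Lemma derivable_tderiv (h : R -> R) (t l : R) : is_derive t 1 h l -> tderiv h t l.
Proof. by move=> /is_derive_seq dh r _ rt cr; exact: dh. Qed.

Lemma tderiv_interior (h : R -> R) (t l : R) : 0 < t < T -> tderiv h t l -> is_derive t 1 h l.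
Proof.
move=> /andP[t0 tT] dh; apply/is_derive_seq => u ut cu.
have clt : clamp T t = t by rewrite clamp_id// (ltW t0) ltW.
have cr : clamp T (u n) @[n --> \oo] --> t.
  by have := cvg_comp _ _ cu (@clamp_continuous R T t); rewrite clt.
have rt n : clamp T (u n) != t.
  apply: contra (ut n) => /eqP; rewrite /clamp.
  have [u0|u0] := leP 0 (Num.min (u n) T); last by move=> h0; move: t0; rewrite -h0 ltxx.
  by have [uT ->//|uT h0] := leP (u n) T; move: tT; rewrite -h0 ltxx.
have := dh _ (fun n => clamp_itv T0 (u n)) rt cr; apply: cvg_trans.
apply: near_eq_cvg.
have n1 : \forall n \near \oo, 0 < u n by exact: (cvgr_gt t cu).
have n2 : \forall n \near \oo, u n < T by exact: (cvgr_lt t cu).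
by near=> n; rewrite clamp_id//; apply/andP; split; apply: ltW; near: n.
Unshelve. all: by end_near. Qed.

Lemma tderiv_mean_value h l (t s : R) : continuous h ->
  (forall r, 0 <= r <= T -> tderiv h r (l r)) -> 0 <= t -> t <= s -> s <= T ->
  exists2 r, t <= r <= s & h s - h t = l r * (s - t).
Proof.
move=> ch dh t0; rewrite le_eqVlt => /predU1P[-> sT|ts sT].
  by exists s; rewrite ?lexx// !subrr mulr0.
have [||r rI e] := @MVT R h l t s ts.
- move=> x; rewrite in_itv/= => /andP[tx xs].
  apply: tderiv_interior; first by rewrite (le_lt_trans t0 tx) (lt_le_trans xs).
  by apply: dh; rewrite (le_trans t0 (ltW tx)) (le_trans (ltW xs)).
- exact: continuous_subspaceT.
- by move: rI; rewrite in_itv/= => /andP[/ltW tr /ltW rs]; exists r => //; rewrite tr.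
Qed.

Lemma tderiv_mean_value_dist h l (t s : R) : continuous h ->
  (forall r, 0 <= r <= T -> tderiv h r (l r)) -> 0 <= t <= T -> 0 <= s <= T ->
  exists r, [/\ 0 <= r <= T, `|r - t| <= `|s - t| & h s - h t = l r * (s - t)].
Proof.
move=> ch dh /andP[t0 tT] /andP[s0 sT]; have [ts|/ltW st] := leP t s.
  have [r /andP[tr rs] e] := tderiv_mean_value ch dh t0 ts sT; exists r; split => //.
    by rewrite (le_trans t0 tr) (le_trans rs).
  by rewrite !ger0_norm ?subr_ge0// lerB.
have [r /andP[sr rt] e] := tderiv_mean_value ch dh s0 st tT; exists r; split => //.
- by rewrite (le_trans s0 sr) (le_trans rt).
- by rewrite !ler0_norm ?subr_le0// !opprB lerB.
- by rewrite -[LHS]opprB e -mulrN opprB.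
Qed.

(* Clairaut: the second difference of [F] is a value of [dy G] at a nearby point,
   by the mean value theorem in each variable. *)
Lemma tderiv_dy (F G : R -> R -> R) (t y : R) : smooth F -> smooth G ->
  (forall s x, 0 <= s <= T -> tderiv (F ^~ x) s (G s x)) -> 0 <= t <= T ->
  tderiv (dy F ^~ y) t (dy G t y).
Proof.
move=> sF sG dF tI r rI rt cr.
have ir (n : nat) : (0 : R) < n.+1%:R^-1 by rewrite invr_gt0.
have key n : exists sx : R * R, [/\ `|sx.1 - t| <= `|r n - t|, `|sx.2 - y| <= n.+1%:R^-1 &
    `|(dy F (r n) y - dy F t y) / (r n - t) - dy G sx.1 sx.2| <= n.+1%:R^-1].
  pose D x := F (r n) x - F t x.
  have rt0 : 0 < `|r n - t| by rewrite normr_gt0 subr_eq0.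
  have dD : is_derive y 1 D (dy F (r n) y - dy F t y).
    exact: is_deriveB (smooth_derive sF (r n) y) (smooth_derive sF t y).
  pose u (m : nat) : R := y + m.+1%:R^-1.
  have uy m : u m - y = m.+1%:R^-1 by rewrite /u addrAC subrr add0r.
  have uy0 m : u m != y by rewrite -subr_eq0 uy.
  have cu : u m @[m --> \oo] --> y.
    rewrite -[X in _ --> X]addr0; apply: cvgD; first exact: cvg_cst.
    exact: cvg_harmonic.
  have cD := proj1 (is_derive_seq D y _) dD u uy0 cu.
  (* The space increment is chosen after the time increment, with an error that remains below
     [1 / (n + 1)] when divided by [|r n - t|]. *)
  have e0 : 0 < n.+1%:R^-1 * `|r n - t| by rewrite mulr_gt0.
  have /cvgrPdist_le/(_ _ e0) cD' := cD.
  have [m [nm Dm]] : exists m, (n <= m)%N /\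
      `|dy F (r n) y - dy F t y - (D (u m) - D y) / (u m - y)| <= n.+1%:R^-1 * `|r n - t|.
    have [m _ Hm] := cD'; exists (maxn m n); split; first exact: leq_maxr.
    by apply: Hm; exact: leq_maxl.
  have cF := smooth_seqcont sF.
  have cH : continuous (fun s => F s (u m) - F s y).
    by apply: continuous_subr; exact: seqcont2.
  have [s [sI st es]] := @tderiv_mean_value_dist (fun s => F s (u m) - F s y)
    (fun s => G s (u m) - G s y) t (r n) cH
    (fun s sI => tderivB (dF s (u m) sI) (dF s y sI)) tI (rI n).
  have [x xy ex] := @mean_value_dist R (G s) _ y (u m) (smooth_derive sG s).
  exists (s, x); split => //=.
    by rewrite (le_trans xy)// uy ger0_norm ?(ltW (ir m))// lef_pV2 ?posrE// ler_nat ltnS.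
  have DE : (D (u m) - D y) / (u m - y) = dy G s x * (r n - t).
    have -> : D (u m) - D y = F (r n) (u m) - F (r n) y - (F t (u m) - F t y) by rewrite /D; ring.
    by rewrite es ex mulrAC mulfK// subr_eq0.
  rewrite -(ler_pM2r rt0) -normrM mulrBl divfK ?subr_eq0//.
  by rewrite -DE.
have [sx sxP] := choice key.
have c0 : `|r n - t| @[n --> \oo] --> 0.
  rewrite -(normr0 R) -(subrr t); apply: cvg_norm; apply: cvgB => //; exact: cvg_cst.
have cs : (sx n).1 @[n --> \oo] --> t by apply: (cvg_dist_le _ c0) => n; have [] := sxP n.
have cx : (sx n).2 @[n --> \oo] --> y.
  by apply: (cvg_dist_le _ (@cvg_harmonic R)) => n; have [] := sxP n.
have cG := smooth_seqcont (smooth_dy sG) cs cx.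
rewrite (_ : (fun n => _) = fun n => ((dy F (r n) y - dy F t y) / (r n - t) - dy G (sx n).1 (sx n).2)
   + dy G (sx n).1 (sx n).2); last by apply/funext => n; rewrite subrK.
rewrite -[X in _ --> X]add0r; apply: cvgD => //.
apply: (cvg_dist_le _ (@cvg_harmonic R)) => n; rewrite subr0.
by have [] := sxP n.
Qed.

End sequential_derivative.

(** * Taylor coefficients and the Riccati system *)

Section formal_series.
Context {K : fieldType}.
Implicit Types A B : nat -> K.

Definition cp A B (k : nat) : K := \sum_(l < k.+1) A l * B (k - l)%N.

(** The coefficients of the formal derivative. *)
Definition fD A (k : nat) : K := k.+1%:R * A k.+1.

(** Truncation to polynomials transfers commutativity and associativity of the product to formal
    series, coefficient by coefficient. *)
Let trunc N A : {poly K} := \poly_(i < N) A i.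

Let cp_trunc N A B k : (k < N)%N -> cp A B k = (trunc N A * trunc N B)`_k.
Proof.
move=> kN; rewrite coefM; apply: eq_bigr => l _; rewrite !coef_poly.
by rewrite (leq_ltn_trans (leq_ord l) kN) (leq_ltn_trans (leq_subr _ _) kN).
Qed.

Lemma cpC A B k : cp A B k = cp B A k.
Proof. by rewrite !(@cp_trunc k.+1)// mulrC. Qed.

Lemma cp_ext A A' B B' k : (forall l, (l <= k)%N -> A l = A' l) ->
  (forall l, (l <= k)%N -> B l = B' l) -> cp A B k = cp A' B' k.
Proof.
by move=> hA hB; apply: eq_bigr => l _; rewrite hA ?leq_ord// hB// leq_subr.
Qed.

Let trunc_cp N A B k : (k < N)%N -> (trunc N (cp A B))`_k = (trunc N A * trunc N B)`_k.
Proof. by move=> kN; rewrite coef_poly kN (cp_trunc _ _ kN). Qed.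

Lemma cpA A B C k : cp A (cp B C) k = cp (cp A B) C k.
Proof.
rewrite !(@cp_trunc k.+1)//.
transitivity ((trunc k.+1 A * (trunc k.+1 B * trunc k.+1 C))`_k).
  by rewrite !coefM; apply: eq_bigr => l _; rewrite trunc_cp// ltnS leq_subr.
by rewrite mulrA !coefM; apply: eq_bigr => l _; rewrite trunc_cp// ltnS leq_ord.
Qed.

Lemma cpDr A B C k : cp A (fun l => B l + C l) k = cp A B k + cp A C k.
Proof. by rewrite -big_split; apply: eq_bigr => l _; rewrite mulrDr. Qed.

Lemma cpZr (x : K) A B k : cp A (fun l => x * B l) k = x * cp A B k.
Proof. by rewrite mulr_sumr; apply: eq_bigr => l _; rewrite mulrCA. Qed.

Lemma fD_cp A B k : fD (cp A B) k = cp (fD A) B k + cp A (fD B) k.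
Proof.
rewrite /fD /cp mulr_sumr.
have -> : \sum_(l < k.+2) k.+1%:R * (A l * B (k.+1 - l)%N) =
   \sum_(l < k.+2) (l%:R * A l * B (k.+1 - l)%N + A l * ((k.+1 - l)%:R * B (k.+1 - l)%N)).
  apply: eq_bigr => l _; rewrite -{1}(subnKC (leq_ord l)) natrD; ring.
rewrite big_split/=; congr (_ + _).
  rewrite big_ord_recl !mul0r add0r; apply: eq_bigr => l _.
  by rewrite lift0 subSS.
rewrite big_ord_recr/= subnn mul0r mulr0 addr0; apply: eq_bigr => l _.
by rewrite subSn// leq_ord.
Qed.

Variables (F Phi dF U : nat -> K) (a b g : K).
Hypothesis DF : fD F =1 cp F (fD Phi).
Hypothesis dFE : forall k, dF k = cp U F k + b * (k%:R * F k) + a * fD F k + g * fD (fD F) k.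

Definition riccati_rhs k : K := U k + b * (k%:R * Phi k) + a * fD Phi k + g * fD (fD Phi) k
  + g * cp (fD Phi) (fD Phi) k.

(** The relation [F' = F Phi'] multiplied by [x], which handles the term with [b]. *)
Let euler_F k : k%:R * F k = cp F (fun l => l%:R * Phi l) k.
Proof.
case: k => [|k]; first by rewrite /cp big_ord1 !mul0r mulr0.
rewrite -[LHS]/(fD F k) DF [RHS]big_ord_recr/= subnn mul0r mulr0 addr0.
by apply: eq_bigr => l _; rewrite subSn ?leq_ord.
Qed.

(** The linear system divided by [F]: [F'' = (F Phi')' = F (Phi'' + Phi'^2)] is where the quadratic
    term of the Riccati system arises. *)
Lemma dF_riccati k : dF k = cp F riccati_rhs k.
Proof.
rewrite dFE /riccati_rhs.
rewrite (cpDr F (fun k => U k + b * (k%:R * Phi k) + a * fD Phi k + g * fD (fD Phi) k)).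
rewrite (cpDr F (fun k => U k + b * (k%:R * Phi k) + a * fD Phi k)).
rewrite (cpDr F (fun k => U k + b * (k%:R * Phi k))) (cpDr F U).
rewrite !cpZr -euler_F -DF (cpC U) -!addrA; do 3 congr (_ + _); rewrite -mulrDr; congr (_ * _).
have -> : fD (fD F) k = fD (cp F (fD Phi)) k by rewrite /fD -!DF.
rewrite fD_cp addrC cpA; congr (_ + _).
by apply: cp_ext => // l _; rewrite DF.
Qed.

(** The formal counterpart of differentiating [F' = F Phi'] in time, with [riccati_rhs] in the place
    of the time derivative of [Phi]; it identifies the value of that derivative later. *)
Lemma fD_dF k : fD dF k = cp dF (fD Phi) k + cp F (fD riccati_rhs) k.
Proof.
have -> : fD dF k = fD (cp F riccati_rhs) k by rewrite /fD dF_riccati.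
rewrite fD_cp; congr (_ + _).
transitivity (cp (cp F (fD Phi)) riccati_rhs k); first by apply: cp_ext => // l _; rewrite DF.
transitivity (cp (cp F riccati_rhs) (fD Phi) k); last by apply: cp_ext => // l _; rewrite dF_riccati.
by rewrite -!cpA; apply: cp_ext => // l _; rewrite cpC.
Qed.

End formal_series.

(** * Taylor coefficients of smooth functions *)

Section smooth_functions.
Context {R : realType}.
Implicit Types h k : R -> R.

Fixpoint cn n h : Prop := match n with
  | 0 => True
  | m.+1 => exists2 h', (forall x : R, is_derive x 1 h (h' x)) & cn m h'
  end.

Definition cinf h := forall n, cn n h.

Lemma cnW n h : cn n.+1 h -> cn n h.
Proof. by elim: n h => // n IH h [h' dh /IH]; exists h'. Qed.

Lemma cinf_derive h : cinf h -> forall x : R, is_derive x 1 h (derive1 h x).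
Proof.
move=> ch x; have [h' dh _] := ch 1%N.
by rewrite derive1E; exact: DeriveDef (@ex_derive _ _ _ _ _ _ _ (dh x)) erefl.
Qed.

Lemma derive1_fun h h' : (forall x : R, is_derive x 1 h (h' x)) -> derive1 h = h'.
Proof. by move=> dh; apply/funext => x; rewrite derive1E (@derive_val _ _ _ _ _ _ _ (dh x)). Qed.

Lemma cinf_derive1 h : cinf h -> cinf (derive1 h).
Proof. by move=> ch n; have [h' dh ch'] := ch n.+1; rewrite (derive1_fun dh). Qed.

Lemma cinf_derive1n h n : cinf h -> cinf (derive1n n h).
Proof. by move=> ch; elim: n => // n; exact: cinf_derive1. Qed.

Lemma cn_cst n (c : R) : cn n (fun=> c).
Proof. by elim: n c => // n IH c; exists (fun=> 0) => // x; exact: is_derive_cst. Qed.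

Lemma cnD n h k : cn n h -> cn n k -> cn n (fun x => h x + k x).
Proof.
elim: n h k => // n IH h k [h' dh ch] [k' dk ck].
by exists (fun x => h' x + k' x); [move=> x; exact: is_deriveD (dh x) (dk x)|exact: IH].
Qed.

Lemma cnM n h k : cn n h -> cn n k -> cn n (fun x => h x * k x).
Proof.
elim: n h k => // n IH h k ch ck; have [h' dh ch'] := ch; have [k' dk ck'] := ck.
exists (fun x => h' x * k x + h x * k' x); last by apply: cnD; apply: IH => //; exact: cnW.
move=> x; apply: (is_derive_eq (is_deriveM (dh x) (dk x))).
by rewrite /GRing.scale/= addrC; congr (_ + _); rewrite mulrC.
Qed.

Lemma cnN n h : cn n h -> cn n (fun x => - h x).
Proof.
move=> ch; rewrite (_ : (fun x => _) = fun x => -1 * h x); first by apply: cnM => //; exact: cn_cst.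
by apply/funext => x; rewrite mulN1r.
Qed.

Lemma cnV n h : (forall x, h x != 0) -> cn n h -> cn n (fun x => (h x)^-1).
Proof.
move=> h0; elim: n => // n IH ch; have [h' dh ch'] := ch.
exists (fun x => - h' x * ((h x)^-1 * (h x)^-1)).
  move=> x; apply: (is_derive_eq (is_deriveV (h0 x) (dh x))).
  by rewrite /GRing.scale/= -exprVn expr2 !mulNr mulrC.
by apply: cnM; [exact: cnN|apply: cnM; apply: IH; exact: cnW].
Qed.

Lemma smooth_cinf g t : smooth g -> cinf (g t).
Proof.
move=> sg n; elim: n g sg => // n IH g sg; exists (dy g t); first exact: smooth_derive.
exact: IH (smooth_dy sg).
Qed.

Definition tc n h : R := derive1n n h 0 / n`!%:R.

Lemma tc0 h : tc 0 h = h 0.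
Proof. by rewrite /tc fact0 divr1. Qed.

Lemma tc_derive1 n h : tc n (derive1 h) = fD (tc^~ h) n.
Proof.
rewrite /fD /tc factS natrM -derive1Sn; move: (derive1n _ _ _) => x.
by rewrite invfM [RHS]mulrCA mulVKf ?pnatr_eq0.
Qed.

Lemma tcD n h k : cinf h -> cinf k -> tc n (fun x => h x + k x) = tc n h + tc n k.
Proof.
rewrite /tc -mulrDl => ch ck; congr (_ / _); elim: n h k ch ck => // n IH h k ch ck.
rewrite !derive1Sn -IH; [|exact: cinf_derive1..].
congr (derive1n _ _ _); apply: derive1_fun => x.
exact: is_deriveD (cinf_derive ch x) (cinf_derive ck x).
Qed.

Lemma tcM n h k : cinf h -> cinf k -> tc n (fun x => h x * k x) = cp (tc^~ h) (tc^~ k) n.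
Proof.
elim: n h k => [|n IH] h k ch ck; first by rewrite /cp big_ord1 !tc0.
have n0 : n.+1%:R != 0 :> R by rewrite pnatr_eq0.
apply: (mulfI n0); rewrite -[LHS]/(fD (tc^~ (fun x => h x * k x)) n) -tc_derive1.
rewrite -[RHS]/(fD (cp (tc^~ h) (tc^~ k)) n) fD_cp.
have ch' := cinf_derive1 ch; have ck' := cinf_derive1 ck.
have -> : derive1 (fun x => h x * k x) = (fun x => derive1 h x * k x + h x * derive1 k x).
  apply: derive1_fun => x; apply: (is_derive_eq (is_deriveM (cinf_derive ch x) (cinf_derive ck x))).
  by rewrite /GRing.scale/= addrC; congr (_ + _); rewrite mulrC.
rewrite tcD; [|by move=> m; apply: cnM..].
by rewrite !IH//; congr (_ + _); apply: cp_ext => // l _; rewrite tc_derive1.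
Qed.

Lemma tc_cst n (c : R) : tc n (fun=> c) = if n is 0 then c else 0.
Proof.
case: n => [|n]; first by rewrite tc0.
rewrite /tc derive1Sn.
have -> : derive1 (fun=> c) = (fun=> 0) :> (R -> R) by apply: derive1_fun => x; exact: is_derive_cst.
suff -> : derive1n n (fun _ : R => 0 : R) = fun=> 0 by rewrite mul0r.
elim: n => // n IH; rewrite derive1nS IH.
by apply: derive1_fun => x; exact: is_derive_cst.
Qed.

Lemma tcZ n (c : R) h : cinf h -> tc n (fun x => c * h x) = c * tc n h.
Proof.
move=> ch; rewrite tcM//; last by move=> m; exact: cn_cst.
by rewrite /cp big_ord_recl subn0 tc_cst big1 ?addr0// => l _; rewrite tc_cst mul0r.
Qed.

Lemma cinf_dilation (e : R) h : cinf h -> cinf (fun x => h (e * x)).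
Proof.
move=> ch n; elim: n h ch => // n IH h ch; exists (fun x => e * derive1 h (e * x)).
  move=> x; have h1 : is_derive x 1 (fun x : R => e * x) e.
    by apply: (is_derive_eq (is_deriveZ e (is_derive_id x 1))); rewrite /GRing.scale/= mulr1.
  have := @is_derive1_comp R h (fun x => e * x) x _ _ (cinf_derive ch (e * x)) h1.
  by rewrite mulrC.
by apply: cnM; [exact: cn_cst|exact: IH (cinf_derive1 ch)].
Qed.

Lemma tc_dilation n (e : R) h : cinf h -> tc n (fun x => h (e * x)) = e ^+ n * tc n h.
Proof.
elim: n h => [|n IH] h ch; first by rewrite !tc0 mulr0 mul1r.
have n0 : n.+1%:R != 0 :> R by rewrite pnatr_eq0.
apply: (mulfI n0); rewrite -[LHS]/(fD (tc^~ (fun x => h (e * x))) n) -tc_derive1.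
have -> : derive1 (fun x => h (e * x)) = (fun x => e * derive1 h (e * x)).
  apply: derive1_fun => x; have h1 : is_derive x 1 (fun x : R => e * x) e.
    by apply: (is_derive_eq (is_deriveZ e (is_derive_id x 1))); rewrite /GRing.scale/= mulr1.
  have := @is_derive1_comp R h (fun x => e * x) x _ _ (cinf_derive ch (e * x)) h1.
  by rewrite mulrC.
have ch' := cinf_derive1 ch.
rewrite tcZ; last exact: cinf_dilation.
by rewrite IH// tc_derive1 /fD exprS; ring.
Qed.

Lemma cinf_psum p : dfact_small p -> cinf (psum p).
Proof.
move=> sp n; elim: n p sp => // n IH p sp; exists (psum (pseries_diffs p)).
  by move=> x; exact: is_derive_psum.
exact: IH (dfact_small_diffs sp).
Qed.

Lemma tc_psum n p : dfact_small p -> tc n (psum p) = p n.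
Proof.
by move=> sp; rewrite /tc derive1n_psum// psum0 iter_pseries_diffs0 mulrC mulKf.
Qed.

Lemma derive1n_dy g n t : smooth g -> derive1n n (g t) = iter n (@dy R) g t.
Proof. by move=> sg; elim: n => // n IH; rewrite derive1nS IH. Qed.

Lemma smooth_iter_dy g n : smooth g -> smooth (iter n (@dy R) g).
Proof. by move=> sg; elim: n => // n; exact: smooth_dy. Qed.

End smooth_functions.

(** * Complex-valued functions by components *)

Section complex_components.
Context {R : realType}.
Implicit Types z w : CC R.

Lemma complex_ext z w : Cre z = Cre w -> Cim z = Cim w -> z = w.
Proof. by case: z w => [a b] [c d]; rewrite /Cre /Cim /= => -> ->. Qed.

Lemma CreD z w : Cre (z + w) = Cre z + Cre w. Proof. by case: z w => [a b] [c d]. Qed.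

Lemma CimD z w : Cim (z + w) = Cim z + Cim w. Proof. by case: z w => [a b] [c d]. Qed.

Lemma CreN z : Cre (- z) = - Cre z. Proof. by case: z. Qed.

Lemma CimN z : Cim (- z) = - Cim z. Proof. by case: z. Qed.

Lemma CreM z w : Cre (z * w) = Cre z * Cre w - Cim z * Cim w.
Proof. by case: z w => [a b] [c d]. Qed.

Lemma CimM z w : Cim (z * w) = Cre z * Cim w + Cim z * Cre w.
Proof. by case: z w => [a b] [c d]. Qed.

Lemma CreV z : Cre z^-1 = Cre z / (Cre z ^+ 2 + Cim z ^+ 2). Proof. by case: z. Qed.

Lemma CimV z : Cim z^-1 = - Cim z / (Cre z ^+ 2 + Cim z ^+ 2). Proof. by case: z => a b; rewrite mulNr. Qed.

Lemma RtoCM (x y : R) : RtoC (x * y) = RtoC x * RtoC y.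
Proof. by apply: complex_ext; rewrite ?CreM ?CimM /= ?mulr0 ?mul0r ?subr0 ?addr0. Qed.

Lemma RtoC_nat n : RtoC (n%:R : R) = n%:R.
Proof. exact: (rmorph_nat (@real_complex R) n). Qed.

Lemma RtoCV (x : R) : RtoC x^-1 = (RtoC x)^-1.
Proof. exact: (fmorphV (@real_complex R) x). Qed.

Lemma Cre_RtoC (x : R) : Cre (RtoC x) = x. Proof. by []. Qed.

Lemma Cim_RtoC (x : R) : Cim (RtoC x) = 0. Proof. by []. Qed.

Lemma norm2_neq0 z : z != 0 -> Cre z ^+ 2 + Cim z ^+ 2 != 0.
Proof.
apply: contra; rewrite paddr_eq0 ?sqr_ge0// !sqrf_eq0 => /andP[/eqP a0 /eqP b0].
by apply/eqP; apply: complex_ext.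
Qed.

Lemma cexpD z w : cexp (z + w) = cexp z * cexp w.
Proof.
apply: complex_ext; rewrite ?CreM ?CimM /cexp /Cmk /= /Cre /Cim /=.
  by rewrite -/(Cre _) -/(Cim _) CreD CimD expR_cosD.
by rewrite -/(Cre _) -/(Cim _) CreD CimD expR_sinD addrC.
Qed.

Lemma cexp_neq0 z : cexp z != 0.
Proof.
apply/eqP => /(congr1 (fun u => cexp (- z) * u)); rewrite -cexpD addNr mulr0.
by move=> /(congr1 (@Cre R)); rewrite /cexp /= expR0 cos0 mulr1 => /eqP; rewrite oner_eq0.
Qed.

Lemma cexpB z w : cexp (z - w) = cexp z / cexp w.
Proof. by apply: (canRL (@mulfK R[i] _ (cexp_neq0 w))); rewrite -cexpD subrK. Qed.

End complex_components.

Section complex_tderiv.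
Context {R : realType}.
Variable T : R.
Hypothesis T0 : 0 < T.
Implicit Types h k : R -> CC R.

Definition ctderiv h t (l : CC R) :=
  tderiv T (fun s => Cre (h s)) t (Cre l) /\ tderiv T (fun s => Cim (h s)) t (Cim l).

Lemma ctderiv_eq h k t l : 0 <= t <= T -> (forall s, 0 <= s <= T -> h s = k s) ->
  ctderiv h t l -> ctderiv k t l.
Proof.
move=> tI hk [d1 d2]; split.
  by apply: tderiv_eq d1 => // s sI; rewrite hk.
by apply: tderiv_eq d2 => // s sI; rewrite hk.
Qed.

Lemma ctderiv_cst (c : CC R) t : ctderiv (fun=> c) t 0.
Proof. by split; exact: tderiv_cst. Qed.

Lemma ctderivD h k t l m : ctderiv h t l -> ctderiv k t m -> ctderiv (fun s => h s + k s) t (l + m).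
Proof.
move=> [h1 h2] [k1 k2]; split.
  have := tderivD h1 k1; rewrite -CreD.
  by congr (tderiv _ _ _ _); apply/funext => s; rewrite CreD.
have := tderivD h2 k2; rewrite -CimD.
by congr (tderiv _ _ _ _); apply/funext => s; rewrite CimD.
Qed.

Lemma ctderivM h k t l m : ctderiv h t l -> ctderiv k t m ->
  ctderiv (fun s => h s * k s) t (l * k t + h t * m).
Proof.
move=> [h1 h2] [k1 k2]; split.
  have := tderivB (tderivM h1 k1) (tderivM h2 k2).
  congr (tderiv _ _ _ _); first by apply/funext => s; rewrite CreM.
  by rewrite CreD !CreM; ring.
have := tderivD (tderivM h1 k2) (tderivM h2 k1).
congr (tderiv _ _ _ _); first by apply/funext => s; rewrite CimM.
by rewrite CimD !CimM; ring.
Qed.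

Lemma ctderivZ (c : CC R) h t l : ctderiv h t l -> ctderiv (fun s => c * h s) t (c * l).
Proof. by move=> dh; have := ctderivM (ctderiv_cst c t) dh; rewrite mul0r add0r. Qed.

Lemma ctderivN h t l : ctderiv h t l -> ctderiv (fun s => - h s) t (- l).
Proof.
move=> dh; have := ctderivZ (-1) dh; rewrite mulN1r.
by congr (ctderiv _ _ _); apply/funext => s; rewrite mulN1r.
Qed.

Lemma ctderiv_sum n (h : 'I_n -> R -> CC R) t (l : 'I_n -> CC R) :
  (forall i, ctderiv (h i) t (l i)) ->
  ctderiv (fun s => \sum_(i < n) h i s) t (\sum_(i < n) l i).
Proof.
elim: n h l => [|n IH] h l dh.
  rewrite big_ord0 (_ : (fun s => _) = fun=> 0); first exact: ctderiv_cst.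
  by apply/funext => s; rewrite big_ord0.
rewrite big_ord_recl (_ : (fun s => _) = fun s => h ord0 s + \sum_(i < n) h (lift ord0 i) s).
  by apply: ctderivD => //; apply: IH.
by apply/funext => s; rewrite big_ord_recl.
Qed.

Lemma ctderivV h t l : (forall s, 0 <= s <= T -> h s != 0) -> 0 <= t <= T ->
  ctderiv h t l -> ctderiv (fun s => (h s)^-1) t (- l * ((h t)^-1 * (h t)^-1)).
Proof.
move=> h0 tI [d1 d2].
have n0 s : 0 <= s <= T -> Cre (h s) * Cre (h s) + Cim (h s) * Cim (h s) != 0.
  by move=> sI; have := norm2_neq0 (h0 s sI); rewrite !expr2.
have dn := tderivV n0 tI (tderivD (tderivM d1 d1) (tderivM d2 d2)).
have n1 := n0 t tI; split.
  have := tderivM d1 dn; congr (tderiv _ _ _ _).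
    by apply/funext => s; rewrite CreV !expr2.
  by rewrite !(CreM, CimM, CreN, CimN, CreV, CimV) !expr2; field.
have := tderivM (tderivN d2) dn; congr (tderiv _ _ _ _).
  by apply/funext => s; rewrite CimV !expr2.
by rewrite !(CreM, CimM, CreN, CimN, CreV, CimV) !expr2; field.
Qed.

Lemma ctderiv_div h k t l m : (forall s, 0 <= s <= T -> k s != 0) -> 0 <= t <= T ->
  ctderiv h t l -> ctderiv k t m ->
  ctderiv (fun s => h s / k s) t ((l - h t / k t * m) / k t).
Proof.
move=> k0 tI dh dk; have := ctderivM dh (ctderivV k0 tI dk).
by congr (ctderiv _ _ _); ring.
Qed.

End complex_tderiv.

Section complex_taylor.
Context {R : realType}.
Implicit Types h k : R -> CC R.

Definition ccinf h := cinf (fun x => Cre (h x)) /\ cinf (fun x => Cim (h x)).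

Definition ctc n h : R[i] := Cmk (tc n (fun x => Cre (h x))) (tc n (fun x => Cim (h x))).

Definition cder h (x : R) : CC R :=
  Cmk (derive1 (fun x => Cre (h x)) x) (derive1 (fun x => Cim (h x)) x).

Lemma ctc0 h : ctc 0 h = h 0.
Proof. by apply: complex_ext; rewrite /ctc /Cre /Cim /= tc0. Qed.

Lemma ccinf_cder h : ccinf h -> ccinf (cder h).
Proof. by move=> [h1 h2]; split; exact: cinf_derive1. Qed.

Lemma ctc_cder n h : ctc n (cder h) = fD (ctc^~ h) n.
Proof.
apply: complex_ext; rewrite /fD -RtoC_nat ?CreM ?CimM Cre_RtoC Cim_RtoC mul0r.
  by rewrite subr0 {1}/ctc /Cre /= tc_derive1.
by rewrite addr0 {1}/ctc /Cim /= tc_derive1.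
Qed.

Lemma CreS n (F : 'I_n -> R[i]) : Cre (\sum_(i < n) F i) = \sum_(i < n) Cre (F i).
Proof. by apply: (big_morph (@Cre R)) => // x y; exact: CreD. Qed.

Lemma CimS n (F : 'I_n -> R[i]) : Cim (\sum_(i < n) F i) = \sum_(i < n) Cim (F i).
Proof. by apply: (big_morph (@Cim R)) => // x y; exact: CimD. Qed.

Lemma ccinfM h k : ccinf h -> ccinf k -> ccinf (fun x => h x * k x).
Proof.
move=> [h1 h2] [k1 k2]; split => n.
  rewrite (_ : (fun x => _) = fun x => Cre (h x) * Cre (k x) + - (Cim (h x) * Cim (k x))).
    by apply: cnD; [exact: cnM|apply: cnN; exact: cnM].
  by apply/funext => x; rewrite CreM.
rewrite (_ : (fun x => _) = fun x => Cre (h x) * Cim (k x) + Cim (h x) * Cre (k x)).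
  by apply: cnD; exact: cnM.
by apply/funext => x; rewrite CimM.
Qed.

Lemma ccinfV h : (forall x, h x != 0) -> ccinf h -> ccinf (fun x => (h x)^-1).
Proof.
move=> h0 [h1 h2].
have n0 x : Cre (h x) * Cre (h x) + Cim (h x) * Cim (h x) != 0.
  by have := norm2_neq0 (h0 x); rewrite !expr2.
have cn0 n : cn n (fun x => (Cre (h x) * Cre (h x) + Cim (h x) * Cim (h x))^-1).
  by apply: cnV => //; apply: cnD; exact: cnM.
split => n.
  rewrite (_ : (fun x => _) = fun x => Cre (h x) * (Cre (h x) * Cre (h x) + Cim (h x) * Cim (h x))^-1).
    exact: cnM.
  by apply/funext => x; rewrite CreV !expr2.
rewrite (_ : (fun x => _) = fun x => - Cim (h x) * (Cre (h x) * Cre (h x) + Cim (h x) * Cim (h x))^-1).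
  by apply: cnM => //; exact: cnN.
by apply/funext => x; rewrite CimV !expr2.
Qed.

Lemma tcN n (h : R -> R) : cinf h -> tc n (fun x => - h x) = - tc n h.
Proof.
move=> ch; rewrite -mulN1r -tcZ//; congr tc; apply/funext => x; exact: esym (mulN1r _).
Qed.

Lemma ctcM n h k : ccinf h -> ccinf k -> ctc n (fun x => h x * k x) = cp (ctc^~ h) (ctc^~ k) n.
Proof.
move=> [h1 h2] [k1 k2].
have c1 : cinf (fun x => Cre (h x) * Cre (k x)) by move=> m; exact: cnM.
have c2 : cinf (fun x => Cim (h x) * Cim (k x)) by move=> m; exact: cnM.
have c3 : cinf (fun x => Cre (h x) * Cim (k x)) by move=> m; exact: cnM.
have c4 : cinf (fun x => Cim (h x) * Cre (k x)) by move=> m; exact: cnM.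
apply: complex_ext.
  transitivity (tc n (fun x => Cre (h x) * Cre (k x) + - (Cim (h x) * Cim (k x)))).
    by congr tc; apply/funext => x; rewrite CreM.
  rewrite tcD//; last by move=> m; exact: cnN.
  rewrite tcN// !tcM// /cp CreS -sumrB; apply: eq_bigr => l _.
  by rewrite CreM.
transitivity (tc n (fun x => Cre (h x) * Cim (k x) + Cim (h x) * Cre (k x))).
  by congr tc; apply/funext => x; rewrite CimM.
rewrite tcD// !tcM// /cp CimS -big_split; apply: eq_bigr => l _.
by rewrite CimM.
Qed.

(* Near [0], [exp (p + iq) - 1] determines [p] through [e^(2p) = |exp (p + iq)|^2]
   and [q] through [sin q]. *)
Lemma log_quotient (p q de : nat -> R) (x y : R) :
  (forall n, de n != 0) -> de n @[n --> \oo] --> 0 ->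
  p n @[n --> \oo] --> 0 -> q n @[n --> \oo] --> 0 ->
  (expR (p n) * cos (q n) - 1) / de n @[n --> \oo] --> x ->
  (expR (p n) * sin (q n)) / de n @[n --> \oo] --> y ->
  (p n / de n @[n --> \oo] --> x) /\ (q n / de n @[n --> \oo] --> y).
Proof.
move=> de0 cde cp0 cq0 cx cy.
have cu : expR (p n) * cos (q n) - 1 @[n --> \oo] --> 0.
  rewrite -(mulr0 x) (_ : (fun n => _) = fun n => (expR (p n) * cos (q n) - 1) / de n * de n).
    exact: cvgM.
  by apply/funext => n; rewrite divfK.
have cv : expR (p n) * sin (q n) @[n --> \oo] --> 0.
  rewrite -(mulr0 y) (_ : (fun n => _) = fun n => expR (p n) * sin (q n) / de n * de n).
    exact: cvgM.
  by apply/funext => n; rewrite divfK.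
have d2 (r : R) : is_derive r 1 (fun r : R => expR (2 * r)) (2 * expR (2 * r)).
  exact: is_derive_expM.
have key n : exists z : R * R, [/\ `|z.1 - 0| <= `|p n|, `|z.2 - 0| <= `|q n|,
    expR (2 * p n) - 1 = 2 * expR (2 * z.1) * p n & sin (q n) = cos z.2 * q n].
  have [z1 h1 e1] := @mean_value_dist R (fun r => expR (2 * r)) _ 0 (p n) d2.
  have [z2 h2 e2] := @mean_value_dist R sin _ 0 (q n) (fun r => is_derive_sin r).
  exists (z1, z2); move: h1 h2 e1 e2; rewrite !subr0 mulr0 expR0 sin0 subr0 => *.
  by split.
have [z zP] := choice key.
have c1 : (z n).1 @[n --> \oo] --> 0.
  apply: (cvg_dist_le (v := fun n => `|p n|)); first by move=> n; have [] := zP n.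
  by rewrite -(normr0 R); exact: cvg_norm.
have c2 : (z n).2 @[n --> \oo] --> 0.
  apply: (cvg_dist_le (v := fun n => `|q n|)); first by move=> n; have [] := zP n.
  by rewrite -(normr0 R); exact: cvg_norm.
split.
- have ce : 2 * expR (2 * (z n).1) @[n --> \oo] --> 2 * expR (2 * 0).
    apply: cvgM; first exact: cvg_cst.
    exact: (cvg_comp _ _ c1 (@continuous_expM R 2 0)).
  rewrite mulr0 expR0 mulr1 in ce.
  (* With [exp (p + iq) = 1 + u + iv], the squared modulus gives [e^(2p) - 1 = (2 + u) u + v^2]. *)
  have h : (2 + (expR (p n) * cos (q n) - 1)) * ((expR (p n) * cos (q n) - 1) / de n) +
      (expR (p n) * sin (q n)) * ((expR (p n) * sin (q n)) / de n) @[n --> \oo] --> (2 + 0) * x + 0 * y.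
    by apply: cvgD; apply: cvgM => //; apply: cvgD => //; exact: cvg_cst.
  have e0 n : 2 * expR (2 * (z n).1) != 0 by rewrite mulf_neq0// gt_eqF// expR_gt0.
  have n2 : 2 != 0 :> R by [].
  rewrite -[X in _ --> X](_ : ((2 + 0) * x + 0 * y) / 2 = x); last by field.
  rewrite (_ : (fun n => _) = fun n => ((2 + (expR (p n) * cos (q n) - 1)) * ((expR (p n) * cos (q n) - 1) / de n) +
      (expR (p n) * sin (q n)) * ((expR (p n) * sin (q n)) / de n)) / (2 * expR (2 * (z n).1))).
    by apply: cvgM => //; exact: cvgV.
  apply/funext => n; apply: (mulIf (e0 n)); rewrite mulfVK//.
  have [_ _ E _] := zP n; rewrite mulrAC -[X in X / _ = _]mulrC -E.
  have -> : expR (2 * p n) = expR (p n) ^+ 2 * (cos (q n) ^+ 2 + sin (q n) ^+ 2).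
    by rewrite cos2Dsin2 mulr1 -expRM_natl.
  by have := de0 n => ?; field.
- have cc : cos (z n).2 @[n --> \oo] --> (1 : R).
    by have := cvg_comp _ _ c2 (@continuous_cos R 0); rewrite cos0.
  have ce : expR (p n) @[n --> \oo] --> (1 : R).
    by have := cvg_comp _ _ cp0 (@continuous_expR R 0); rewrite expR0.
  have n1 : 1 != 0 :> R by exact: oner_neq0.
  have h : (expR (p n) * sin (q n) / de n) * ((expR (p n))^-1 * (cos (z n).2)^-1) @[n --> \oo] --> y * (1^-1 * 1^-1).
    by apply: cvgM => //; apply: cvgM; exact: cvgV.
  rewrite invr1 !mulr1 in h; apply: cvg_trans h; apply: near_eq_cvg.
  (* Division by this cosine is legitimate only for large [n], so the two sequences are compared
     eventually. *)
  have c0 : \forall n \near \oo, 0 < cos (z n).2 by exact: (cvgr_gt 1 cc).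
  near=> n; have [_ _ _ ->] := zP n.
  have k1 : cos (z n).2 != 0 by rewrite gt_eqF//; near: n.
  have k2 : expR (p n) != 0 by rewrite gt_eqF ?expR_gt0.
  by field; rewrite ?k1 ?k2 ?de0.
Unshelve. all: by end_near. Qed.

End complex_taylor.

(** * The logarithm of a nonvanishing smooth function *)

Section logarithm.
Context {R : realType}.

(** Dividing by [cexp L0] reduces to a logarithm near 1. The assumed convergence of [Ln] to [L0]
    selects the branch, so that the quotient of the logarithms is governed by that of the
    exponentials. *)
Lemma clog_quotient (Ln : nat -> CC R) (L0 l : CC R) (de : nat -> R) :
  (forall n, de n != 0) -> de n @[n --> \oo] --> 0 ->
  Cre (Ln n) @[n --> \oo] --> Cre L0 -> Cim (Ln n) @[n --> \oo] --> Cim L0 ->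
  (Cre (cexp (Ln n)) - Cre (cexp L0)) / de n @[n --> \oo] --> Cre l ->
  (Cim (cexp (Ln n)) - Cim (cexp L0)) / de n @[n --> \oo] --> Cim l ->
  ((Cre (Ln n) - Cre L0) / de n @[n --> \oo] --> Cre (l / cexp L0)) /\
  ((Cim (Ln n) - Cim L0) / de n @[n --> \oo] --> Cim (l / cexp L0)).
Proof.
move=> de0 cde cr ci qr qi.
have E0 : cexp L0 / cexp L0 = 1 :> R[i] by rewrite -cexpB subrr /cexp /Cre /Cim /= expR0 cos0 sin0 mulr1 mulr0.
have E1 n : Cre (Ln n) - Cre L0 = Cre (Ln n - L0) by rewrite CreD CreN.
have E2 n : Cim (Ln n) - Cim L0 = Cim (Ln n - L0) by rewrite CimD CimN.
have E3 n : cexp (Ln n - L0) - 1 = (cexp (Ln n) - cexp L0) / cexp L0.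
  by rewrite cexpB [RHS]mulrBl E0.
set g := (cexp L0)^-1 in E3 *.
apply: log_quotient => //.
- by rewrite -(subrr (Cre L0)); apply: cvgB => //; exact: cvg_cst.
- by rewrite -(subrr (Cim L0)); apply: cvgB => //; exact: cvg_cst.
- rewrite (_ : (fun n => _) = fun n => (Cre (cexp (Ln n)) - Cre (cexp L0)) / de n * Cre g
      - (Cim (cexp (Ln n)) - Cim (cexp L0)) / de n * Cim g).
    by rewrite CreM; apply: cvgB; apply: cvgM => //; exact: cvg_cst.
  apply/funext => n; rewrite E1 E2 mulrAC [X in _ = _ - X]mulrAC -mulrBl; congr (_ / _).
  transitivity (Cre (cexp (Ln n - L0) - 1)); first by rewrite [RHS]CreD CreN.
  by rewrite E3 CreM CreD CreN CimD CimN.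
- rewrite (_ : (fun n => _) = fun n => (Cre (cexp (Ln n)) - Cre (cexp L0)) / de n * Cim g
      + (Cim (cexp (Ln n)) - Cim (cexp L0)) / de n * Cre g).
    by rewrite CimM; apply: cvgD; apply: cvgM => //; exact: cvg_cst.
  apply/funext => n; rewrite E1 E2 [X in _ = X + _]mulrAC [X in _ = _ + X]mulrAC -mulrDl; congr (_ / _).
  transitivity (Cim (cexp (Ln n - L0) - 1)); first by rewrite [RHS]CimD CimN oppr0 addr0.
  by rewrite E3 CimM CreD CreN CimD CimN.
Qed.

Variable T : R.
Hypothesis T0 : 0 < T.
Variables f L : R -> R -> CC R.
Hypothesis cL : forall (sn xn : nat -> R) (s x : R), (forall n, 0 <= sn n <= T) -> 0 <= s <= T ->
  sn n @[n --> \oo] --> s -> xn n @[n --> \oo] --> x ->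
  (Cre (L (sn n) (xn n)) @[n --> \oo] --> Cre (L s x)) /\
  (Cim (L (sn n) (xn n)) @[n --> \oo] --> Cim (L s x)).
Hypothesis expL : forall t x, 0 <= t <= T -> cexp (L t x) = f t x.
Hypothesis sf : forall t, 0 <= t <= T -> ccinf (f t).

Let f0 t x : 0 <= t <= T -> f t x != 0.
Proof. by move=> tI; rewrite -expL// cexp_neq0. Qed.

Lemma is_derive_log t (x : R) : 0 <= t <= T ->
  is_derive x 1 (fun x : R => Cre (L t x)) (Cre (cder (f t) x / f t x)) /\
  is_derive x 1 (fun x : R => Cim (L t x)) (Cim (cder (f t) x / f t x)).
Proof.
move=> tI; have [s1 s2] := sf tI.
suff key u : (forall n, u n != x) -> u n @[n --> \oo] --> x ->
    ((Cre (L t (u n)) - Cre (L t x)) / (u n - x) @[n --> \oo] --> Cre (cder (f t) x / f t x)) /\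
    ((Cim (L t (u n)) - Cim (L t x)) / (u n - x) @[n --> \oo] --> Cim (cder (f t) x / f t x)).
  by split; apply/is_derive_seq => u ux cu; have [] := key u ux cu.
move=> ux cu; have [c1 c2] := cL (fun _ : nat => tI) tI (cvg_cst t) cu.
rewrite -[in X in _ / X]expL//; apply: clog_quotient => //.
- by move=> n; rewrite subr_eq0.
- by rewrite -(subrr x); apply: cvgB => //; exact: cvg_cst.
- rewrite expL// (_ : (fun n => _) = fun n => (Cre (f t (u n)) - Cre (f t x)) / (u n - x)).
    exact: (proj1 (is_derive_seq _ _ _) (cinf_derive s1 x)).
  by apply/funext => n; rewrite expL.
- rewrite expL// (_ : (fun n => _) = fun n => (Cim (f t (u n)) - Cim (f t x)) / (u n - x)).
    exact: (proj1 (is_derive_seq _ _ _) (cinf_derive s2 x)).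
  by apply/funext => n; rewrite expL.
Qed.

Lemma ccinf_log t : 0 <= t <= T -> ccinf (L t).
Proof.
move=> tI; have [c1 c2] : ccinf (fun x => cder (f t) x / f t x).
  apply: ccinfM; first exact: ccinf_cder (sf tI).
  by apply: ccinfV (sf tI) => x; exact: f0.
split=> -[|n] //=.
  by exists (fun x => Cre (cder (f t) x / f t x)) => // x; have [] := is_derive_log x tI.
by exists (fun x => Cim (cder (f t) x / f t x)) => // x; have [] := is_derive_log x tI.
Qed.

Lemma fD_log t n : 0 <= t <= T -> fD (ctc^~ (f t)) n = cp (ctc^~ (f t)) (fD (ctc^~ (L t))) n.
Proof.
move=> tI; rewrite -ctc_cder.
have -> : cder (f t) = fun x => f t x * cder (L t) x.
  apply/funext => x; have [d1 d2] := is_derive_log x tI.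
  have -> : cder (L t) x = cder (f t) x / f t x.
    by apply: complex_ext; rewrite /cder {1}/Cre {1}/Cim /= derive1E (@derive_val _ _ _ _ _ _ _ d1, @derive_val _ _ _ _ _ _ _ d2).
  by rewrite mulrC; apply: esym; apply: (@mulfVK R[i]); exact: f0.
rewrite ctcM; [|exact: sf|exact: ccinf_cder (ccinf_log tI)].
by apply: cp_ext => // l _; rewrite ctc_cder.
Qed.

Variables (a b g : CC R) (U dF : R -> nat -> CC R).
Hypothesis tF : forall t n, 0 <= t <= T -> ctderiv T (fun s => ctc n (f s)) t (- dF t n).
Hypothesis dFE : forall t n, 0 <= t <= T -> dF t n = cp (U t) (ctc^~ (f t)) n
  + b * (n%:R * ctc n (f t)) + a * fD (ctc^~ (f t)) n + g * fD (fD (ctc^~ (f t))) n.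

(** The order-0 coefficient is a logarithm of [F_0]. Beyond it, [F' = F Phi'] solved for its top
    coefficient expresses [Phi_(k+1)] through the [F_l] and the earlier [Phi_l], so
    differentiability is inherited; [fD_dF] then shows that the quotient rule gives the Riccati
    right-hand side. The minus signs reflect that time runs towards [T]. *)
Theorem riccati_log t n : 0 <= t <= T -> ctderiv T (fun s => ctc n (L s)) t
  (- riccati_rhs (ctc^~ (L t)) (U t) a b g n).
Proof.
move=> tI; pose Phi := ctc^~ (L t); pose Psi := riccati_rhs Phi (U t) a b g.
pose F := ctc^~ (f t).
have F0 s : 0 <= s <= T -> ctc 0 (f s) != 0 by move=> sI; rewrite ctc0; exact: f0.
have hF k : dF t k = cp (U t) F k + b * (k%:R * F k) + a * fD F k + g * fD (fD F) k := dFE k tI.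
have DF : fD F =1 cp F (fD Phi) by move=> k; exact: fD_log.
suff key k : forall m, (m <= k)%N -> ctderiv T (fun s => ctc m (L s)) t (- Psi m) by exact: key (leqnn n).
elim: k => [|k IH] m.
  rewrite leqn0 => /eqP ->.
  have c0 (r : nat -> R) : (forall j, 0 <= r j <= T) -> r j @[j --> \oo] --> t ->
    (Cre (L (r j) 0) @[j --> \oo] --> Cre (L t 0)) /\ (Cim (L (r j) 0) @[j --> \oo] --> Cim (L t 0)).
    by move=> rI cr; apply: cL => //; exact: cvg_cst.
  have Psi0 : - Psi 0%N = - dF t 0%N / cexp (L t 0).
    rewrite (dF_riccati DF hF) /cp big_ord1 subn0 expL// /F ctc0 -mulNr.
    apply: (canRL (@mulfK R[i] _ (f0 0 tI))).
    by rewrite !mulNr [X in - X = _]mulrC.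
  have [d1 d2] := tF 0 tI.
  have e1 : tderiv T (fun s => Cre (cexp (L s 0))) t (Cre (- dF t 0%N)).
    by apply: (tderiv_eq tI _ d1) => s sI; rewrite ctc0 expL.
  have e2 : tderiv T (fun s => Cim (cexp (L s 0))) t (Cim (- dF t 0%N)).
    by apply: (tderiv_eq tI _ d2) => s sI; rewrite ctc0 expL.
  have key (r : nat -> R) : (forall j, 0 <= r j <= T) -> (forall j, r j != t) -> r j @[j --> \oo] --> t ->
    ((Cre (L (r j) 0) - Cre (L t 0)) / (r j - t) @[j --> \oo] --> Cre (- Psi 0%N)) /\
    ((Cim (L (r j) 0) - Cim (L t 0)) / (r j - t) @[j --> \oo] --> Cim (- Psi 0%N)).
    move=> rI rt cr; have [c1 c2] := c0 r rI cr; rewrite Psi0; apply: clog_quotient => //.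
    - by move=> j; rewrite subr_eq0.
    - by rewrite -(subrr t); apply: cvgB => //; exact: cvg_cst.
    - exact: e1.
    - exact: e2.
  split.
    apply: (tderiv_eq tI (h := fun s => Cre (L s 0))) => [s _|r rI rt cr]; first by rewrite ctc0.
    by have [] := key r rI rt cr.
  apply: (tderiv_eq tI (h := fun s => Cim (L s 0))) => [s _|r rI rt cr]; first by rewrite ctc0.
  by have [] := key r rI rt cr.
rewrite leq_eqVlt => /predU1P[->|]; last by rewrite ltnS; exact: IH.
have dPhi j : (j < k)%N -> ctderiv T (fun s => fD (ctc^~ (L s)) j) t (- fD Psi j).
  by move=> jk; rewrite /fD -mulrN; apply: ctderivZ; exact: IH.
(* The relation of order [k] with all terms except [F_0 (k + 1) Phi_(k+1)] moved to one side; only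
   [Phi_1, ..., Phi_k] occur. *)
pose N s := fD (ctc^~ (f s)) k - \sum_(l < k) ctc l.+1 (f s) * fD (ctc^~ (L s)) (k - l.+1)%N.
have NE s : 0 <= s <= T -> fD (ctc^~ (L s)) k = N s / ctc 0 (f s).
  move=> sI; rewrite /N (fD_log k sI) /cp big_ord_recl subn0 addrK mulrC.
  by apply: esym; apply: (@mulKf R[i]); exact: F0.
have dN : ctderiv T N t (- fD (dF t) k - \sum_(l < k) (- dF t l.+1 * fD Phi (k - l.+1)%N
    + F l.+1 * - fD Psi (k - l.+1)%N)).
  apply: ctderivD.
    by rewrite /fD -mulrN; apply: ctderivZ; exact: tF.
  apply: ctderivN; apply: ctderiv_sum => l; apply: ctderivM; first exact: tF.
  by apply: dPhi; rewrite ltn_subrL/=; exact: leq_ltn_trans (leq0n _) (ltn_ord l).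
have dfD : ctderiv T (fun s => fD (ctc^~ (L s)) k) t (- fD Psi k).
  apply: (ctderiv_eq tI (fun s sI => esym (NE s sI))).
  have := ctderiv_div F0 tI dN (tF 0 tI); congr (ctderiv _ _ _ _).
  rewrite -NE// -/Phi (fD_dF DF hF) -/Psi /cp !big_ord_recl !subn0.
  set A := \sum_(i < k) _; set B := \sum_(i < k) _; set D := \sum_(l < k) _.
  have DE : D = - (A + B).
    rewrite /D /A /B -big_split/= -sumrN; apply: eq_bigr => l _.
    by rewrite mulNr mulrN -opprD.
  have alg (x y z w A' B' : R[i]) : - (x * y + A' + (z * w + B')) - - (A' + B') - y * - x = - w * z.
    by ring.
  rewrite DE; apply: (canLR (@mulfK R[i] _ (F0 t tI))); exact: alg.
have k0 : k.+1%:R != 0 :> R[i] by rewrite pnatr_eq0.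
rewrite (_ : Psi k.+1 = k.+1%:R^-1 * fD Psi k); last by rewrite /fD mulKf.
rewrite -mulrN; have := ctderivZ k.+1%:R^-1 dfD; congr (ctderiv _ _ _ _).
by apply/funext => s; rewrite /fD mulKf.
Qed.

End logarithm.

(** * The given coefficients and logarithm *)

Section complex_topology.
Context {R : realType}.

Lemma norm_complexE (z : CC R) : `|z| = RtoC (Num.sqrt (Cre z ^+ 2 + Cim z ^+ 2)) :> R[i].
Proof. by case: z. Qed.

Lemma ltRtoC (x y : R) : (RtoC x < RtoC y :> R[i]) = (x < y).
Proof. exact: ltcR. Qed.

Lemma Cre_le_norm (z : CC R) : RtoC `|Cre z| <= `|z| :> R[i].
Proof.
rewrite norm_complexE lecR -sqrtr_sqr ler_sqrt ?addr_ge0 ?sqr_ge0//.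
by rewrite lerDl sqr_ge0.
Qed.

Lemma Cim_le_norm (z : CC R) : RtoC `|Cim z| <= `|z| :> R[i].
Proof.
rewrite norm_complexE lecR -sqrtr_sqr ler_sqrt ?addr_ge0 ?sqr_ge0//.
by rewrite lerDr sqr_ge0.
Qed.

Lemma norm_le_components (z : CC R) : `|z| <= RtoC (`|Cre z| + `|Cim z|) :> R[i].
Proof.
rewrite norm_complexE lecR -[leRHS]ger0_norm ?addr_ge0// -sqrtr_sqr.
rewrite ler_sqrt ?sqr_ge0// sqrrD !real_normK ?num_real// -addrA lerD2l lerDr.
by rewrite mulrn_wge0// mulr_ge0.
Qed.

Lemma cvg_components (I : Type) (F : set_system I) (FF : Filter F) (h : I -> CC R) (l : CC R) :
  h @ F --> l -> ((fun x => Cre (h x)) @ F --> Cre l) /\ ((fun x => Cim (h x)) @ F --> Cim l).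
Proof.
move=> /cvgrPdist_lt hl; split; apply/cvgrPdist_lt => e e0.
  have e1 : 0 < RtoC e :> R[i] by rewrite -[0]/(RtoC 0) ltRtoC.
  apply: filterS (hl _ e1) => x; rewrite -ltRtoC; apply: le_lt_trans.
  by rewrite -CreN -CreD; exact: Cre_le_norm.
have e1 : 0 < RtoC e :> R[i] by rewrite -[0]/(RtoC 0) ltRtoC.
apply: filterS (hl _ e1) => x; rewrite -ltRtoC; apply: le_lt_trans.
by rewrite -CimN -CimD; exact: Cim_le_norm.
Qed.

Lemma components_cvg (I : Type) (F : set_system I) (FF : Filter F) (h : I -> CC R) (l : CC R) :
  (fun x => Cre (h x)) @ F --> Cre l -> (fun x => Cim (h x)) @ F --> Cim l -> h @ F --> l.
Proof.
move=> /cvgrPdist_lt hr /cvgrPdist_lt hi; apply/cvgrPdist_lt => e e0.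
(* In the order of [R[i]] a positive element is real. *)
have [r r0 eE] : exists2 r : R, 0 < r & e = RtoC r.
  by move: e0; case: e => [r i]; rewrite ltcE /= => /andP[/eqP -> r0]; exists r.
have r2 : 0 < r / 2 by rewrite divr_gt0.
apply: filterS2 (hr _ r2) (hi _ r2) => x xr xi.
rewrite eE; apply: le_lt_trans (norm_le_components _) _.
by rewrite ltRtoC CreD CreN CimD CimN (splitr r) ltrD.
Qed.

Lemma within_seq_cvg (A : set R) (h : R -> R) (l : R) :
  (forall u : nat -> R, (forall n, A (u n)) -> u n @[n --> \oo] --> 0 -> h (u n) @[n --> \oo] --> l) ->
  h @ within A (nbhs 0) --> l.
Proof.
move=> H; apply/cvgrPdist_le => e e0; apply: contrapT => nh.
have key (n : nat) : exists x, [/\ `|x| <= n.+1%:R^-1, A x & ~ `|l - h x| <= e].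
  apply: contrapT => nx; apply: nh.
  exists n.+1%:R^-1 => /=; first by rewrite invr_gt0.
  move=> x /=; rewrite sub0r normrN => xn Ax; apply: contrapT => lx.
  by apply: nx; exists x; split => //; exact: ltW.
have [u uP] := choice key.
have cu : u n @[n --> \oo] --> 0.
  apply: (cvg_dist_le _ (@cvg_harmonic R)) => n; rewrite subr0.
  by have [] := uP n.
have Au n : A (u n) by have [] := uP n.
have /cvgrPdist_le/(_ e e0)[N _ HN] := H u Au cu.
by have [_ _] := uP N; apply; exact: HN (leqnn N).
Qed.

Lemma within_continuous_seq (V : topologicalType) (A : set V) (h : V -> CC R) (u : nat -> V) (x : V) :
  {within A, continuous h} -> (forall n, A (u n)) -> A x -> u n @[n --> \oo] --> x ->
  (Cre (h (u n)) @[n --> \oo] --> Cre (h x)) /\ (Cim (h (u n)) @[n --> \oo] --> Cim (h x)).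
Proof.
move=> /subspace_continuousP ch Au Ax cu; apply: cvg_components.
have cw : u n @[n --> \oo] --> within A (nbhs x).
  move=> B hB; have : nbhs \oo (u @^-1` [set y | A y -> B y]) by exact: (cu _ hB).
  by apply: filterS => n; apply; exact: Au.
exact: (cvg_comp _ _ cw (ch x Ax)).
Qed.

Lemma ctderiv_reversed (T : R) (h : R -> CC R) (t : R) (l : CC R) : 0 <= t <= T ->
  ctderiv T h (T - t) (- l) -> has_deriv_within T (fun s => h (T - s)) t l.
Proof.
move=> tI [d1 d2].
have key (u : nat -> R) : (forall n, u n != 0 /\ 0 <= t + u n <= T) -> u n @[n --> \oo] --> 0 ->
   (Cre ((RtoC (u n))^-1 * (h (T - (t + u n)) - h (T - t))) @[n --> \oo] --> Cre l) /\
   (Cim ((RtoC (u n))^-1 * (h (T - (t + u n)) - h (T - t))) @[n --> \oo] --> Cim l).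
  move=> uA cu; have u0 n : u n != 0 by have [] := uA n.
  have rI n : 0 <= T - (t + u n) <= T.
    by have [_ /andP[h1 h2]] := uA n; rewrite subr_ge0 h2 gerBl h1.
  have dE n : T - (t + u n) - (T - t) = - u n by ring.
  have rt n : T - (t + u n) != T - t.
    by rewrite -subr_eq0 dE oppr_eq0.
  have cr : T - (t + u n) @[n --> \oo] --> T - t.
    rewrite -[X in _ --> _ - X]addr0; apply: cvgB; first exact: cvg_cst.
    by apply: cvgD => //; exact: cvg_cst.
  have E n (z : CC R) : Cre ((RtoC (u n))^-1 * z) = Cre z / u n /\ Cim ((RtoC (u n))^-1 * z) = Cim z / u n.
    by rewrite -RtoCV CreM CimM Cre_RtoC Cim_RtoC !mul0r subr0 addr0 ![(u n)^-1 * _]mulrC.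
  split.
    rewrite -[Cre l]opprK -CreN (_ : (fun n => _) = fun n => - ((Cre (h (T - (t + u n))) - Cre (h (T - t))) /
      (T - (t + u n) - (T - t)))); first by apply: cvgN; exact: d1.
    by apply/funext => n; rewrite (proj1 (E n _)) CreD CreN dE invrN mulrN opprK.
  rewrite -[Cim l]opprK -CimN (_ : (fun n => _) = fun n => - ((Cim (h (T - (t + u n))) - Cim (h (T - t))) /
    (T - (t + u n) - (T - t)))); first by apply: cvgN; exact: d2.
  by apply/funext => n; rewrite (proj2 (E n _)) CimD CimN dE invrN mulrN opprK.
apply: components_cvg; apply: within_seq_cvg => u uA cu; have [] := key u uA cu.
  by [].
by [].
Qed.

End complex_topology.

Section smooth_closure.
Context {R : realType}.
Implicit Types f g : R -> R -> R.

Lemma smoothD f g : smooth f -> smooth g -> smooth (fun t y => f t y + g t y).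
Proof. by move=> sf sg n; exact: sadmD (sf n) (sg n). Qed.

Lemma smoothM f g : smooth f -> smooth g -> smooth (fun t y => f t y * g t y).
Proof. by move=> sf sg n; exact: sadmM (sf n) (sg n). Qed.

Lemma smoothN f : smooth f -> smooth (fun t y => - f t y).
Proof. by move=> sf n; exact: sadmN (sf n). Qed.

Lemma smooth_time (h : R -> R) (B : R) : continuous h -> (forall t, `|h t| <= B) ->
  smooth (fun t _ => h t).
Proof. by move=> ch hB n; exact: (sadm_time _ _ ch hB). Qed.

Lemma smooth_cst (k : R) : smooth (fun _ _ => k).
Proof. by apply: (@smooth_time _ `|k|) => //; exact: cst_continuous. Qed.

End smooth_closure.

Section taylor_tderiv.
Context {R : realType}.
Variable T : R.
Hypothesis T0 : 0 < T.

(** The minimum and the maximum of [r n] and [t] turn an approach from either side into an ordered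
    pair of times. *)
Lemma tderiv_of_quotient (h : R -> R) (t l : R) : 0 <= t <= T ->
  (forall sn tn : nat -> R, (forall n, 0 <= sn n) -> (forall n, sn n < tn n) ->
    (forall n, tn n <= T) -> sn n @[n --> \oo] --> t -> tn n @[n --> \oo] --> t ->
    (h (sn n) - h (tn n)) / (tn n - sn n) @[n --> \oo] --> - l) ->
  tderiv T h t l.
Proof.
move=> /andP[t0 tT] H r rI rt cr.
have cmax : continuous (fun x => Num.max x t).
  by apply: continuous_maxr; [move=> ?; exact: cvg_id|exact: cst_continuous].
have cmin : continuous (fun x => Num.min x t).
  by apply: continuous_minr; [move=> ?; exact: cvg_id|exact: cst_continuous].
have c1 : Num.min (r n) t @[n --> \oo] --> t.
  by have := cvg_comp _ _ cr (cmin t); rewrite minxx.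
have c2 : Num.max (r n) t @[n --> \oo] --> t.
  by have := cvg_comp _ _ cr (cmax t); rewrite maxxx.
rewrite (_ : (fun n => _) = fun n => - ((h (Num.min (r n) t) - h (Num.max (r n) t)) /
   (Num.max (r n) t - Num.min (r n) t))).
  rewrite -[l]opprK; apply: cvgN; apply: H => // n.
  - by have /andP[r0 _] := rI n; rewrite le_min r0.
  - by have := rt n; case: (ltgtP (r n) t).
  - by have /andP[_ rT] := rI n; rewrite ge_max rT.
apply/funext => n; have := rt n; case: (ltgtP (r n) t) => // rt' _.
  by rewrite -mulNr opprB -[r n - t]opprB -[h (r n) - h t]opprB invrN mulrNN.
by rewrite -mulNr opprB.
Qed.

Lemma tderiv_tc (F G : R -> R -> R) k t : smooth F -> smooth G ->
  (forall s x, 0 <= s <= T -> tderiv T (F ^~ x) s (G s x)) -> 0 <= t <= T ->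
  tderiv T (fun s => tc k (F s)) t (tc k (G t)).
Proof.
move=> sF sG dF tI.
have key m : forall s x, 0 <= s <= T -> tderiv T (iter m (@dy R) F ^~ x) s (iter m (@dy R) G s x).
  elim: m => // m IH s x sI.
  exact (@tderiv_dy R T T0 _ _ s x (smooth_iter_dy m sF) (smooth_iter_dy m sG) IH sI).
have := tderivZ (k := k`!%:R^-1) (key k t 0 tI); rewrite /tc derive1n_dy// mulrC.
by congr (tderiv _ _ _ _); apply/funext => s; rewrite derive1n_dy// mulrC.
Qed.

End taylor_tderiv.

Section complex_taylor_linear.
Context {R : realType}.
Implicit Types h k : R -> CC R.

Lemma ctcD n h k : ccinf h -> ccinf k -> ctc n (fun x => h x + k x) = ctc n h + ctc n k.
Proof.
move=> [h1 h2] [k1 k2]; apply: complex_ext; rewrite ?CreD ?CimD /ctc /Cre /Cim /=.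
  by rewrite -tcD//; congr tc; apply/funext => x; exact: CreD.
by rewrite -tcD//; congr tc; apply/funext => x; exact: CimD.
Qed.

Lemma ctcN n h : ccinf h -> ctc n (fun x => - h x) = - ctc n h.
Proof.
move=> [h1 h2]; apply: complex_ext; rewrite ?CreN ?CimN /ctc /Cre /Cim /=.
  by rewrite -tcN//; congr tc; apply/funext => x; exact: CreN.
by rewrite -tcN//; congr tc; apply/funext => x; exact: CimN.
Qed.

Lemma ctcZ n (c : R) h : ccinf h -> ctc n (fun x => RtoC c * h x) = RtoC c * ctc n h.
Proof.
move=> [h1 h2]; apply: complex_ext; rewrite ?CreM ?CimM Cre_RtoC Cim_RtoC mul0r ?subr0 ?addr0.
  rewrite /ctc /= {1}/Cre /= -tcZ//; congr tc; apply/funext => x.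
  by rewrite -[LHS]/(Cre (RtoC c * h x)) CreM Cre_RtoC Cim_RtoC mul0r subr0.
rewrite /ctc /= {1}/Cim /= -tcZ//; congr tc; apply/funext => x.
by rewrite -[LHS]/(Cim (RtoC c * h x)) CimM Cre_RtoC Cim_RtoC mul0r addr0.
Qed.

Lemma ctc_dilation n (e : R) h : ccinf h -> ctc n (fun x => h (e * x)) = RtoC (e ^+ n) * ctc n h.
Proof.
move=> [h1 h2]; apply: complex_ext; rewrite ?CreM ?CimM Cre_RtoC Cim_RtoC mul0r ?subr0 ?addr0.
  by rewrite /ctc {1}/Cre /= (tc_dilation n e h1).
by rewrite /ctc {1}/Cim /= (tc_dilation n e h2).
Qed.

Lemma ccinfD h k : ccinf h -> ccinf k -> ccinf (fun x => h x + k x).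
Proof.
move=> [h1 h2] [k1 k2]; split => n.
  by rewrite (_ : (fun x => _) = fun x => Cre (h x) + Cre (k x));
    [exact: cnD|apply/funext => x; rewrite CreD].
by rewrite (_ : (fun x => _) = fun x => Cim (h x) + Cim (k x));
  [exact: cnD|apply/funext => x; rewrite CimD].
Qed.

Lemma ccinfZ (c : R) h : ccinf h -> ccinf (fun x => RtoC c * h x).
Proof. by move=> ch; apply: ccinfM => //; split => n; exact: cn_cst. Qed.

Lemma ccinf_dilation (e : R) h : ccinf h -> ccinf (fun x => h (e * x)).
Proof. by move=> [h1 h2]; split; [exact: (cinf_dilation e h1)|exact: (cinf_dilation e h2)]. Qed.

Lemma ctderiv_RtoC (T : R) (h : R -> R) (t l : R) :
  tderiv T h t l -> ctderiv T (fun s => RtoC (h s)) t (RtoC l).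
Proof. by move=> dh; split => //; exact: tderiv_cst. Qed.

End complex_taylor_linear.

Section generator.
Context {R : realType} d (Om : measurableType d) (P : probability Om R).
Variables (W : R -> Om -> R) (a b c T : R).
Hypothesis bW : is_brownian_motion P W.
Hypothesis T0 : 0 < T.
Local Notation cl := (clamp T).
Variables (g1 g2 : R -> R -> R) (q : R -> R).
Hypothesis sg1 : smooth g1.
Hypothesis sg2 : smooth g2.
Hypothesis sq : smooth (fun _ => q).
Hypothesis g1_le0 : forall s y, g1 s y <= 0.
Local Notation f1 := (fk_re P W a b c T g1 g2 q).
Local Notation f2 := (fk_im P W a b c T g1 g2 q).

Let sf1 : smooth f1. Proof. exact: (dadm_fk_re a b c bW T0 sg1 sg2 sq g1_le0). Qed.
Let sf2 : smooth f2. Proof. exact: (dadm_fk_im a b c bW T0 sg1 sg2 sq g1_le0). Qed.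

(** Clamped in order to be bounded on the whole line, as the class of smooth functions demands. *)
Let ep s : R := expR (- b * cl s).

Let smooth_ep : smooth (fun s _ => ep s).
Proof.
apply: (@smooth_time _ _ (expR (`|b| * T))).
  exact: (continuous_compR (@clamp_continuous _ T) (@continuous_expM R (- b))).
move=> s; have /andP[s0 sT] := clamp_itv T0 s.
rewrite ger0_norm ?expR_ge0// ler_expR (le_trans (ler_norm _))// normrM normrN (ger0_norm s0).
by rewrite ler_wpM2l.
Qed.

Let dt1 s y : R := - (a * ep s * dy f1 s y + c ^+ 2 / 2 * (ep s * ep s) * dy (dy f1) s y
  + (g1 s y * f1 s y - g2 s y * f2 s y)).

Let dt2 s y : R := - (a * ep s * dy f2 s y + c ^+ 2 / 2 * (ep s * ep s) * dy (dy f2) s y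
  + (g1 s y * f2 s y + g2 s y * f1 s y)).

Let smooth_generator f : smooth f ->
  smooth (fun s y => a * ep s * dy f s y + c ^+ 2 / 2 * (ep s * ep s) * dy (dy f) s y).
Proof.
move=> sf; have s1 := smooth_dy sf; have s2 := smooth_dy s1.
apply: smoothD; apply: smoothM => //; first by apply: smoothM => //; exact: smooth_cst.
by apply: smoothM; [exact: smooth_cst|exact: smoothM].
Qed.

Let smooth_dt1 : smooth dt1.
Proof.
apply: smoothN; apply: smoothD; first exact: smooth_generator.
by apply: smoothD; [exact: smoothM|apply: smoothN; exact: smoothM].
Qed.

Let smooth_dt2 : smooth dt2.
Proof.
apply: smoothN; apply: smoothD; first exact: smooth_generator.
by apply: smoothD; exact: smoothM.
Qed.

Let tderiv_f t y : 0 <= t <= T -> tderiv T (f1 ^~ y) t (dt1 t y) /\ tderiv T (f2 ^~ y) t (dt2 t y).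
Proof.
move=> tI; split; apply: tderiv_of_quotient => // sn tn sn0 stn tnT csn ctn.
  rewrite /dt1 opprK /ep clamp_id// -expr2.
  by have [] := feynman_kac_quotient a b c bW T0 sg1 sg2 sq g1_le0 y sn0 stn tnT csn ctn.
rewrite /dt2 opprK /ep clamp_id// -expr2.
by have [] := feynman_kac_quotient a b c bW T0 sg1 sg2 sq g1_le0 y sn0 stn tnT csn ctn.
Qed.

Let fC t (y : R) : CC R := Cmk (f1 t y) (f2 t y).
Let gC t (y : R) : CC R := Cmk (g1 t y) (g2 t y).

(** The functional in the original coordinate [x], where the coordinate [y] depends on time. *)
Definition fk_flow t (x : R) : CC R := fC t (expR (- b * t) * x).

Definition fk_rate t n : CC R := RtoC (expR (- b * t) ^+ n) * ctc n (gC t).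

Let ccinf_fC t : ccinf (fC t). Proof. by split; exact: smooth_cinf. Qed.
Let ccinf_gC t : ccinf (gC t). Proof. by split; exact: smooth_cinf. Qed.

Lemma ccinf_fk_flow t : ccinf (fk_flow t).
Proof. exact: ccinf_dilation. Qed.

(** The coefficient in [x] is [e^(- n b t)] times the one in [y]. Differentiating this factor
    produces the term with [b n], and the factors [e^(- b t)] and [e^(- 2 b t)] of the backward
    equation are absorbed by the shifts of the index in [fD F] and [fD (fD F)]. *)
Lemma fk_flow_tderiv t n : 0 <= t <= T -> let F := ctc^~ (fk_flow t) in
  ctderiv T (fun s => ctc n (fk_flow s)) t
  (- (cp (fk_rate t) F n + RtoC b * (n%:R * F n) + RtoC a * fD F n
     + RtoC (c ^+ 2 / 2) * fD (fD F) n)).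
Proof.
move=> tI F; pose e := expR (- b * t).
pose Z := ctc^~ (fC t).
have FZ m : F m = RtoC (e ^+ m) * Z m by rewrite /F /fk_flow ctc_dilation.
have dZ : ctderiv T (fun s => ctc n (fC s)) t (Cmk (tc n (dt1 t)) (tc n (dt2 t))).
  split; first exact (@tderiv_tc R T T0 _ _ n t sf1 smooth_dt1 (fun s x sI => proj1 (tderiv_f x sI)) tI).
  exact (@tderiv_tc R T T0 _ _ n t sf2 smooth_dt2 (fun s x sI => proj2 (tderiv_f x sI)) tI).
have dtE : Cmk (tc n (dt1 t)) (tc n (dt2 t)) = - (RtoC (a * e) * fD Z n
    + RtoC (c ^+ 2 / 2 * (e * e)) * fD (fD Z) n + cp (ctc^~ (gC t)) Z n) :> R[i].
  have cf' := ccinf_cder (ccinf_fC t); have cf'' := ccinf_cder cf'.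
  transitivity (ctc n (fun y => - (RtoC (a * e) * cder (fC t) y
      + RtoC (c ^+ 2 / 2 * (e * e)) * cder (cder (fC t)) y + gC t y * fC t y))).
    congr (Cmk (tc n _) (tc n _)); apply/funext => y;
      rewrite ?(CreN, CimN, CreD, CimD, CreM, CimM) ?Cre_RtoC ?Cim_RtoC !mul0r ?subr0 ?addr0.
      by rewrite /dt1 /ep clamp_id.
    by rewrite /dt2 /ep clamp_id.
  have c1 : ccinf (fun y => RtoC (a * e) * cder (fC t) y) by exact: ccinfZ.
  have c2 : ccinf (fun y => RtoC (c ^+ 2 / 2 * (e * e)) * cder (cder (fC t)) y) by exact: ccinfZ.
  have c3 : ccinf (fun y => gC t y * fC t y) by exact: ccinfM.
  have c12 := ccinfD c1 c2; have c123 := ccinfD c12 c3.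
  rewrite (ctcN n c123) (ctcD n c12 c3) (ctcD n c1 c2) !ctcZ// ctcM// !ctc_cder.
  by congr (- (_ + _ * _ + _)); rewrite /fD ctc_cder.
have de : ctderiv T (fun s => RtoC (expR ((- b * n%:R) * s))) t
    (RtoC (- b * n%:R * expR (- b * n%:R * t))).
  by apply: ctderiv_RtoC; apply: derivable_tderiv; exact: is_derive_expM.
have eE s : expR (- b * n%:R * s) = expR (- b * s) ^+ n.
  by rewrite -expRM_natl; congr expR; ring.
have := ctderivM de dZ; rewrite dtE eE -/e.
rewrite (_ : (fun s => _) = (fun s => ctc n (fk_flow s))); last first.
  by apply/funext => s; rewrite eE /fk_flow ctc_dilation.
congr (ctderiv _ _ _ _).
have cpE : cp (fk_rate t) F n = RtoC (e ^+ n) * cp (ctc^~ (gC t)) Z n.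
  rewrite /cp mulr_sumr; apply: eq_bigr => l _; rewrite FZ /fk_rate -/e.
  have -> : e ^+ n = e ^+ l * e ^+ (n - l) by rewrite -exprD subnKC// leq_ord.
  rewrite RtoCM.
  have alg (x y z w : R[i]) : x * y * (z * w) = x * z * (y * w) by ring.
  exact: alg.
have D1 : fD F n = RtoC (e ^+ n) * (RtoC e * fD Z n).
  have alg (x y z w : R[i]) : x * (y * z * w) = z * (y * (x * w)) by ring.
  by rewrite /fD FZ exprS RtoCM; exact: alg.
have D2 : fD (fD F) n = RtoC (e ^+ n) * (RtoC e * RtoC e * fD (fD Z) n).
  have alg (x x' y z w : R[i]) : x * (x' * (y * (y * z) * w)) = z * (y * y * (x * (x' * w))) by ring.
  by rewrite /fD FZ !exprS !RtoCM; exact: alg.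
have bE : RtoC (- b * n%:R * e ^+ n) = - RtoC b * n%:R * RtoC (e ^+ n) :> R[i].
  by rewrite !RtoCM RtoC_nat; congr (_ * _ * _); apply: complex_ext; rewrite ?CreN ?CimN ?Cim_RtoC ?oppr0.
have aE : RtoC (a * e) = RtoC a * RtoC e :> R[i] by exact: RtoCM.
have gE : RtoC (c ^+ 2 / 2 * (e * e)) = RtoC (c ^+ 2 / 2) * (RtoC e * RtoC e) :> R[i].
  by rewrite RtoCM (RtoCM e).
have alg (X z E A1 d1 G1 d2 k cpF Fn D DD B N A e1 g : R[i]) :
    X = - B * N * E -> A1 = A * e1 -> G1 = g * (e1 * e1) -> cpF = E * k -> Fn = E * z ->
    D = E * (e1 * d1) -> DD = E * (e1 * e1 * d2) ->
    X * z + E * - (A1 * d1 + G1 * d2 + k) = - (cpF + B * (N * Fn) + A * D + g * DD).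
  by move=> -> -> -> -> -> -> ->; ring.
exact: (alg _ _ _ _ _ _ _ _ _ _ _ _ _ _ _ _ _ bE aE gE cpE (FZ n) D1 D2).
Qed.

End generator.

Section clamped_coefficients.
Context {R : realType}.
Variable T : R.
Hypothesis T0 : 0 < T.

Lemma clamped_components (u : R -> CC R) : {within `[0, T], continuous u} ->
  continuous (fun s => Cre (u (clamp T s))) /\ continuous (fun s => Cim (u (clamp T s))).
Proof.
move=> cu; have cuc : continuous (fun s => u (clamp T s)).
  apply: (within_continuous_compose cu); first exact: clamp_continuous.
  by move=> x; rewrite /= in_itv/=; exact: clamp_itv.
by split=> s; have [] := cvg_components _ (cuc s).
Qed.

Lemma clamped_bounded (h : R -> R) : continuous (fun s => h (clamp T s)) ->
  exists B, forall s, `|h (clamp T s)| <= B.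
Proof.
move=> ch; have cn : {within `[0, T], continuous (fun s => `|h (clamp T s)|)}.
  apply: continuous_subspaceT => s; exact: (cvg_norm (ch s)).
have [m mI Hm] := EVT_max (ltW T0) cn.
exists `|h (clamp T m)| => s; have := Hm (clamp T s).
rewrite (clamp_id (clamp_itv T0 s)); apply; rewrite in_itv/=; exact: clamp_itv.
Qed.

Lemma smooth_clamped (h : R -> R) : continuous (fun s => h (clamp T s)) ->
  smooth (fun s _ => h (clamp T s)).
Proof. by move=> ch; have [B HB] := clamped_bounded ch; exact: smooth_time HB. Qed.

Lemma smooth_psum (b : R) (p : nat -> R) : dfact_small p ->
  smooth (fun s y => psum p (expR (b * clamp T s) * y)).
Proof.
move=> sp n; have ce : continuous (fun s => expR (b * clamp T s)).
  exact: (continuous_compR (@clamp_continuous _ T) (@continuous_expM R b)).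
have [B HB] := @clamped_bounded (fun s => expR (b * s)) ce.
exact: (dadm_psum n ce HB sp).
Qed.

End clamped_coefficients.

Section instantiation.
Context {R : realType} d (Omega : measurableType d) (P : probability Omega R).
Variables (W : R -> Omega -> R) (a b c T : R) (u1 u2 u3 v : R -> CC R) (p p2 p3 q : nat -> R).
Variable X : R -> R -> R -> Omega -> R.
Hypothesis bW : is_brownian_motion P W.
Hypothesis T0 : 0 < T.
Hypothesis cu1 : {within `[0, T], continuous u1}.
Hypothesis cu2 : {within `[0, T], continuous u2}.
Hypothesis cu3 : {within `[0, T], continuous u3}.
Hypothesis u1_le0 : forall s, 0 <= s <= T -> Cre (u1 s) <= 0.
Hypothesis u2_im : forall s, 0 <= s <= T -> Cre (u2 s) = 0.
Hypothesis u3_im : forall s, 0 <= s <= T -> Cre (u3 s) = 0.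
Hypothesis v_im : forall s, 0 <= s <= T -> Cre (v s) = 0.
Hypothesis sp : dfact_small p.
Hypothesis sp2 : dfact_small p2.
Hypothesis sp3 : dfact_small p3.
Hypothesis sq : dfact_small q.
Hypothesis flowX : is_OU_flow W a b c T X.
Local Notation cl := (clamp T).

(** The real part of the rate at [x = e^(b s) y]: only [u1] contributes, and writing [p1] as a
    square makes the sign evident. *)
Definition rate_re (s y : R) : R := Cre (u1 (cl s)) *
  (psum p (expR (b * cl s) * y) * psum p (expR (b * cl s) * y)).

Definition rate_im (s y : R) : R := Cim (u1 (cl s)) *
  (psum p (expR (b * cl s) * y) * psum p (expR (b * cl s) * y))
  + Cim (u2 (cl s)) * psum p2 (expR (b * cl s) * y) + Cim (u3 (cl s)) * psum p3 (expR (b * cl s) * y).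

Definition terminal (y : R) : R := Cim (v T) * psum q (expR (b * T) * y).

Lemma smooth_rate_re : smooth rate_re.
Proof.
have [c1 _] := clamped_components T0 cu1.
by apply: smoothM; [exact: (smooth_clamped (h := fun s => Cre (u1 s)) T0 c1)|apply: smoothM; exact: smooth_psum].
Qed.

Lemma smooth_rate_im : smooth rate_im.
Proof.
have [_ c1] := clamped_components T0 cu1; have [_ c2] := clamped_components T0 cu2.
have [_ c3] := clamped_components T0 cu3.
apply: smoothD; first apply: smoothD.
- by apply: smoothM; [exact: (smooth_clamped (h := fun s => Cim (u1 s)) T0 c1)|apply: smoothM; exact: smooth_psum].
- by apply: smoothM; [exact: (smooth_clamped (h := fun s => Cim (u2 s)) T0 c2)|exact: smooth_psum].
- by apply: smoothM; [exact: (smooth_clamped (h := fun s => Cim (u3 s)) T0 c3)|exact: smooth_psum].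
Qed.

Lemma smooth_terminal : smooth (fun _ => terminal).
Proof.
apply: smoothM; first exact: smooth_cst.
move=> n; apply: (@dadm_psum R (fun=> expR (b * T)) (expR (b * T))) => //.
  exact: cst_continuous.
by move=> s; rewrite ger0_norm// expR_ge0.
Qed.

Lemma rate_re_le0 s y : rate_re s y <= 0.
Proof.
by rewrite /rate_re mulr_le0_ge0 ?u1_le0 ?clamp_itv// -expr2 sqr_ge0.
Qed.

Local Notation flow := (fk_flow P W a b c T rate_re rate_im terminal).
Local Notation M := (Mproc W a b c T).

Lemma Cre_mulRtoC (z : CC R) (x : R) : Cre (z * RtoC x) = Cre z * x.
Proof. by rewrite CreM Cre_RtoC Cim_RtoC mulr0 subr0. Qed.

Lemma Cim_mulRtoC (z : CC R) (x : R) : Cim (z * RtoC x) = Cim z * x.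
Proof. by rewrite CimM Cre_RtoC Cim_RtoC mulr0 add0r. Qed.

Lemma fk_fE t x : 0 <= t <= T ->
  fk_f P X T u1 u2 u3 v (cauchy_prod p p) p2 p3 q t x = flow t x.
Proof.
move=> tI; have /andP[t0 tT] := tI.
pose y := expR (- b * t) * x.
have XE s w : t <= s <= T -> X t x s w = expR (b * cl s) * (y + (M s w - M t w)).
  by move=> /andP[ts sT]; rewrite (OU_flowE bW T0 flowX)// clamp_id// (le_trans t0 ts).
have uE (u : R -> CC R) s : t <= s <= T -> u s = u (cl s).
  by move=> /andP[ts sT]; rewrite clamp_id// (le_trans t0 ts).
have cE w : cexp (cintegral lebesgue_measure `[t, T]
      (fun s => u1 s * RtoC (psum (cauchy_prod p p) (X t x s w)) + u2 s * RtoC (psum p2 (X t x s w))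
                    + u3 s * RtoC (psum p3 (X t x s w))) + v T * RtoC (psum q (X t x T w))) =
   Cmk (weight_re W a b c T rate_re rate_im terminal t y w) (weight_im W a b c T rate_re rate_im terminal t y w).
  have T1 : 0 <= T <= T by rewrite lexx (ltW T0).
  rewrite /cexp CreD CimD Cre_mulRtoC Cim_mulRtoC v_im// mul0r addr0.
  have h1 : Cre (cintegral lebesgue_measure `[t, T] (fun s => u1 s * RtoC (psum (cauchy_prod p p) (X t x s w)) + u2 s * RtoC (psum p2 (X t x s w))
                    + u3 s * RtoC (psum p3 (X t x s w)))) = potential_re W a b c T rate_re t y w.
    rewrite /cintegral /potential_re /time_integral (clamp_id tI) {1}/Cre /=; apply: eq_Rintegral => s.
    rewrite inE/= in_itv/= => sI; have /andP[ts sT] := sI.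
    have sI' : 0 <= s <= T by rewrite (le_trans t0 ts).
    rewrite !CreD !Cre_mulRtoC u2_im// u3_im// !mul0r !addr0 psum_cauchy_prod// XE// (uE u1)//.
  have h2 : Cim (cintegral lebesgue_measure `[t, T] (fun s => u1 s * RtoC (psum (cauchy_prod p p) (X t x s w)) + u2 s * RtoC (psum p2 (X t x s w))
                    + u3 s * RtoC (psum p3 (X t x s w)))) = time_integral T M rate_im t y w.
    rewrite /cintegral /time_integral (clamp_id tI) {1}/Cim /=; apply: eq_Rintegral => s.
    rewrite inE/= in_itv/= => sI; have /andP[ts sT] := sI.
    by rewrite !CimD !Cim_mulRtoC psum_cauchy_prod// XE// (uE u1)// (uE u2)// (uE u3).
  have h3 : Cim (v T) * psum q (X t x T w) = terminal (y + (M T w - M (cl t) w)).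
    by rewrite /terminal (clamp_id tI) XE ?tT ?lexx// (clamp_id T1).
  by rewrite h1 h2 h3.
rewrite /fk_f /cintegral /fk_flow -/y.
by congr Cmk; apply: eq_Rintegral => w _; rewrite cE.
Qed.

Lemma fk_rateE t n : 0 <= t <= T -> fk_rate b rate_re rate_im t n =
  u1 t * RtoC (cauchy_prod p p n) + u2 t * RtoC (p2 n) + u3 t * RtoC (p3 n).
Proof.
move=> tI; rewrite /fk_rate.
set e := expR (b * t).
have eV : expR (- b * t) ^+ n * e ^+ n = 1.
  by rewrite -exprMn -expRD mulNr addNr expR0 expr1n.
have dil r : dfact_small r -> cinf (fun y => psum r (e * y)).
  by move=> sr; exact: (cinf_dilation e (cinf_psum sr)).
have tcp r : dfact_small r -> tc n (fun y => psum r (e * y)) = e ^+ n * r n.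
  by move=> sr; rewrite (tc_dilation n e (cinf_psum sr)) tc_psum.
have tcpp : tc n (fun y => psum p (e * y) * psum p (e * y)) = e ^+ n * cauchy_prod p p n.
  rewrite (_ : (fun y => _) = (fun y => (fun z => psum p z * psum p z) (e * y)))//.
  have cpp : cinf (fun z => psum p z * psum p z) by move=> m; apply: cnM; exact: cinf_psum.
  rewrite (tc_dilation n e cpp) tcM; [|exact: cinf_psum..].
  by congr (_ * _); apply: cp_ext => l _; rewrite tc_psum.
have re : tc n (rate_re t) = Cre (u1 t) * (e ^+ n * cauchy_prod p p n).
  rewrite -tcpp -(tcZ n (Cre (u1 t))); last by move=> m; apply: cnM; exact: dil.
  by congr tc; apply/funext => y; rewrite /rate_re (clamp_id tI).
have im : tc n (rate_im t) = Cim (u1 t) * (e ^+ n * cauchy_prod p p n)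
    + Cim (u2 t) * (e ^+ n * p2 n) + Cim (u3 t) * (e ^+ n * p3 n).
  have z1 : cinf (fun y => Cim (u1 t) * (psum p (e * y) * psum p (e * y))).
    by move=> m; apply: cnM; [exact: cn_cst|apply: cnM; exact: dil].
  have z2 : cinf (fun y => Cim (u2 t) * psum p2 (e * y)).
    by move=> m; apply: cnM; [exact: cn_cst|exact: dil].
  have z3 : cinf (fun y => Cim (u3 t) * psum p3 (e * y)).
    by move=> m; apply: cnM; [exact: cn_cst|exact: dil].
  rewrite -tcpp -(tcp _ sp2) -(tcp _ sp3) -!tcZ; [|exact: dil|exact: dil|].
    have z12 := fun m => cnD (z1 m) (z2 m).
    rewrite -(tcD n z1 z2) -(tcD n z12 z3).
    by congr tc; apply/funext => y; rewrite /rate_im (clamp_id tI).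
  by move=> m; apply: cnM; exact: dil.
have scale (x y : R) : expR (- b * t) ^+ n * (x * (e ^+ n * y)) = x * y.
  have alg (h k : R) : h * k = 1 -> h * (x * (k * y)) = x * y.
    by move=> hk; rewrite mulrCA [h * _]mulrA hk mul1r.
  exact: alg.
apply: complex_ext.
  rewrite !CreD !Cre_mulRtoC u2_im// u3_im// !mul0r !addr0 CreM Cre_RtoC Cim_RtoC mul0r subr0.
  by rewrite -[RHS]scale -re.
rewrite !CimD !Cim_mulRtoC CimM Cre_RtoC Cim_RtoC mul0r addr0.
by rewrite -[X in _ = X + _ + _]scale -[X in _ = _ + X + _]scale -[X in _ = _ + _ + X]scale
  -!mulrDr -im.
Qed.

Lemma fk_flow_terminal x : flow T x = Cmk (cos (Cim (v T) * psum q x)) (sin (Cim (v T) * psum q x)).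
Proof.
have T1 : 0 <= T <= T by rewrite lexx (ltW T0).
have H1T y w : potential_re W a b c T rate_re T y w = 0.
  by rewrite /potential_re /time_integral (clamp_id T1) set_itv1 Rintegral_set1.
have H2T y w : potential_im W a b c T rate_im terminal T y w = terminal y.
  rewrite /potential_im /time_integral (clamp_id T1) set_itv1 Rintegral_set1 add0r.
  by rewrite subrr addr0.
have tE : terminal (expR (- b * T) * x) = Cim (v T) * psum q x.
  by rewrite /terminal mulrA -expRD mulNr addrN expR0 mul1r.
rewrite -tE /fk_flow; congr Cmk.
  transitivity (\int[P]_w (cos (terminal (expR (- b * T) * x)))).
    by apply: eq_Rintegral => w _; rewrite /weight_re H1T H2T expR0 mul1r.
  exact: Rintegral_prob_cst.
transitivity (\int[P]_w (sin (terminal (expR (- b * T) * x)))).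
  by apply: eq_Rintegral => w _; rewrite /weight_im H1T H2T expR0 mul1r.
exact: Rintegral_prob_cst.
Qed.

Variable L : R -> R -> CC R.
Hypothesis cL : {within [set z : R * R | 0 <= z.1 <= T], continuous (fun z => L z.1 z.2)}.
Hypothesis expL : forall t x, 0 <= t <= T ->
  cexp (L t x) = fk_f P X T u1 u2 u3 v (cauchy_prod p p) p2 p3 q t x.

Let cLs (sn xn : nat -> R) (s x : R) : (forall n, 0 <= sn n <= T) -> 0 <= s <= T ->
  sn n @[n --> \oo] --> s -> xn n @[n --> \oo] --> x ->
  (Cre (L (sn n) (xn n)) @[n --> \oo] --> Cre (L s x)) /\
  (Cim (L (sn n) (xn n)) @[n --> \oo] --> Cim (L s x)).
Proof.
move=> sI sI' cs cx.
exact: (within_continuous_seq (u := fun n => (sn n, xn n)) (x := (s, x)) cL sI sI' (cvg_pair cs cx)).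
Qed.

Let expLf t x : 0 <= t <= T -> cexp (L t x) = flow t x.
Proof. by move=> tI; rewrite expL// fk_fE. Qed.

Let ccinf_flow t : 0 <= t <= T -> ccinf (flow t).
Proof.
by move=> _; exact: (ccinf_fk_flow a b c bW T0 smooth_rate_re smooth_rate_im smooth_terminal rate_re_le0).
Qed.

Lemma ccinf_logf t : 0 <= t <= T -> ccinf (L t).
Proof. exact: (ccinf_log cLs expLf ccinf_flow). Qed.

Lemma riccati_logf t n : 0 <= t <= T -> ctderiv T (fun s => ctc n (L s)) t
  (- riccati_rhs (ctc^~ (L t)) (fk_rate b rate_re rate_im t) (RtoC a) (RtoC b) (RtoC (c ^+ 2 / 2)) n).
Proof.
move=> tI; pose dF s m : CC R := cp (fk_rate b rate_re rate_im s) (ctc^~ (flow s)) m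
  + RtoC b * (m%:R * ctc m (flow s)) + RtoC a * fD (ctc^~ (flow s)) m
  + RtoC (c ^+ 2 / 2) * fD (fD (ctc^~ (flow s))) m.
have tF s m : 0 <= s <= T -> ctderiv T (fun r => ctc m (flow r)) s (- dF s m).
  by move=> sI; exact: (fk_flow_tderiv a b c bW T0 smooth_rate_re smooth_rate_im smooth_terminal rate_re_le0).
exact (riccati_log cLs expLf ccinf_flow tF (fun _ _ _ => erefl) n tI).
Qed.

(** The equation [exp L = f] determines [L T] only up to multiples of [2 pi i]. Here [L T] and
    [v T * q] have the same derivative in [x] and agree at 0, hence everywhere. *)
Lemma log_terminal y : L T 0 = v T * RtoC (psum q 0) ->
  Cre (L T y) = 0 /\ Cim (L T y) = Cim (v T) * psum q y.
Proof.
move=> L0; have T1 : 0 <= T <= T by rewrite lexx (ltW T0).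
pose la x := Cim (v T) * psum q x.
have dla (x : R) : is_derive x 1 la (Cim (v T) * psum (pseries_diffs q) x).
  exact: (is_deriveZ (Cim (v T)) (is_derive_psum x sq)).
set dl := fun x => Cim (v T) * psum (pseries_diffs q) x in dla.
have fE x : flow T x = Cmk (cos (la x)) (sin (la x)) by exact: fk_flow_terminal.
have dc (x : R) : is_derive x 1 (fun x => Cre (flow T x)) (- sin (la x) * dl x).
  rewrite (_ : (fun x => _) = fun x => cos (la x)); last by apply/funext => z; rewrite fE.
  by have := @is_derive1_comp R cos la x _ _ (is_derive_cos _) (dla x); rewrite mulrC.
have ds (x : R) : is_derive x 1 (fun x => Cim (flow T x)) (cos (la x) * dl x).
  rewrite (_ : (fun x => _) = fun x => sin (la x)); last by apply/funext => z; rewrite fE.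
  by have := @is_derive1_comp R sin la x _ _ (is_derive_sin _) (dla x); rewrite mulrC.
have quot x : cder (flow T) x / flow T x = Cmk 0 (dl x).
  have -> : cder (flow T) x = flow T x * Cmk 0 (dl x).
    rewrite /cder (derive1_fun dc) (derive1_fun ds) fE.
    apply: complex_ext; rewrite ?CreM ?CimM /Cre /Cim /=; ring.
  rewrite mulrC; apply: (@mulKf R[i]); rewrite -expLf//; exact: cexp_neq0.
have dL (x : R) : is_derive x 1 (fun x => Cre (L T x)) 0 /\ is_derive x 1 (fun x => Cim (L T x)) (dl x).
  by have := is_derive_log cLs expLf ccinf_flow x T1; rewrite quot.
have d1 (x : R) : is_derive x 1 (fun x => Cre (L T x)) 0 by case: (dL x).
have d2 (x : R) : is_derive x 1 (fun x => Cim (L T x) - la x) 0.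
  by rewrite -(subrr (dl x)); apply: is_deriveB (dla x); case: (dL x).
have [z _ e1] := @mean_value_dist R _ _ 0 y d1; have [z' _ e2] := @mean_value_dist R _ _ 0 y d2.
split.
  move: e1; rewrite mul0r => /eqP; rewrite subr_eq0 => /eqP ->.
  by rewrite L0 Cre_mulRtoC v_im// mul0r.
move: e2; rewrite mul0r L0 Cim_mulRtoC subrr subr0 => /eqP; rewrite subr_eq0 => /eqP ->.
by [].
Qed.

End instantiation.

Theorem theorem6p12 (R : realType) (d : measure_display)
  (Omega : measurableType d) (P : probability Omega R) (W : R -> Omega -> R)
  (a b c T : R) (u1 u2 u3 v : R -> CC R) (p p2 p3 q : nat -> R)
  (X : R -> R -> R -> Omega -> R) (L : R -> R -> CC R) :
  is_brownian_motion P W ->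
  c != 0 -> 0 < T ->
  {within `[0, T], continuous u1} -> {within `[0, T], continuous u2} ->
  {within `[0, T], continuous u3} -> {within `[0, T], continuous v} ->
  (forall s, 0 <= s <= T -> Cre (u1 s) <= 0) ->
  (forall s, 0 <= s <= T -> Cre (u2 s) = 0) ->
  (forall s, 0 <= s <= T -> Cre (u3 s) = 0) ->
  (forall s, 0 <= s <= T -> Cre (v s) = 0) ->
  negligible_dfact p -> negligible_dfact p2 -> negligible_dfact p3 ->
  negligible_dfact q ->
  is_OU_flow W a b c T X ->
  let p1 := cauchy_prod p p in
  let f := fk_f P X T u1 u2 u3 v p1 p2 p3 q in
  (* f does not vanish *)
  (forall t x, 0 <= t <= T -> f t x != 0) ->
  (* L = log f : continuous on [0,T] x R, exp (log f) = f, log f(T,0) = v(T) q(0) *)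
  {within [set z : R * R | 0 <= z.1 <= T], continuous (fun z => L z.1 z.2)} ->
  (forall t x, 0 <= t <= T -> cexp (L t x) = f t x) ->
  L T 0 = v T * RtoC (psum q 0) ->
  let phi := phi_coef L T in
  let phit := fun (l : nat) (t : R) => RtoC (l.+1)%:R * phi l.+1 t in
  (* the x-derivatives of log f (T - t, .) at 0 exist to every order *)
  (forall t, 0 <= t <= T -> forall k,
     derivable (derive1n k (fun x => Cre (L (T - t) x))) 0 1 /\
     derivable (derive1n k (fun x => Cim (L (T - t) x))) 0 1) /\
  (* initial condition *)
  (forall k, phi k 0 = v T * RtoC (q k)) /\
  (* the Riccati-type system *)
  (forall k t, 0 <= t <= T ->
     has_deriv_within T (phi k) t
       (u1 (T - t) * RtoC (p1 k) + u2 (T - t) * RtoC (p2 k)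
          + u3 (T - t) * RtoC (p3 k)
        + RtoC (b * k%:R) * phi k t
        + RtoC (a * (k.+1)%:R) * phi k.+1 t
        + RtoC (c ^+ 2 * ((k.+2 * k.+1)%N)%:R / 2) * phi k.+2 t
        + RtoC (c ^+ 2 / 2) * \sum_(l < k.+1) phit l t * phit (k - l)%N t)).
Proof.
move=> bW _ T0 cu1 cu2 cu3 _ u1le u2im u3im vim /negligible_dfact_small sp
  /negligible_dfact_small sp2 /negligible_dfact_small sp3 /negligible_dfact_small sq flowX
  p1 f _ cL expL LT phi phit.
have ccL := ccinf_logf bW T0 cu1 cu2 cu3 u1le u2im u3im vim sp sp2 sp3 sq flowX cL expL.
have phiE k t : phi k t = ctc k (L (T - t)).
  by apply: complex_ext; rewrite /phi /phi_coef ?CreM ?CimM Cre_RtoC Cim_RtoC mul0r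
    ?subr0 ?addr0 /ctc /tc /Cre /Cim /= mulrC.
have TI t : 0 <= t <= T -> 0 <= T - t <= T.
  by move=> /andP[t0 tT]; rewrite subr_ge0 tT gerBl.
split; [|split].
- move=> t tI k; have [c1 c2] := ccL _ (TI t tI).
  split; first exact: (@ex_derive _ _ _ _ _ _ _ (cinf_derive (cinf_derive1n k c1) 0)).
  exact: (@ex_derive _ _ _ _ _ _ _ (cinf_derive (cinf_derive1n k c2) 0)).
- move=> k; rewrite phiE subr0.
  have Lx x := log_terminal bW T0 cu1 cu2 cu3 u1le u2im u3im vim sp sp2 sp3 sq flowX cL expL x LT.
  have T1 : 0 <= T <= T by rewrite lexx (ltW T0).
  apply: complex_ext; rewrite ?Cre_mulRtoC ?Cim_mulRtoC /ctc {1}/Cre {1}/Cim /=.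
    rewrite vim// mul0r (_ : (fun x => _) = fun=> 0); last by apply/funext => x; case: (Lx x).
    by rewrite tc_cst; case: k.
  rewrite (_ : (fun x => _) = fun x => Cim (v T) * psum q x); last by apply/funext => x; case: (Lx x).
  by rewrite tcZ ?tc_psum//; exact: cinf_psum.
- move=> k t tI; have tI' := TI t tI.
  have := riccati_logf bW T0 cu1 cu2 cu3 u1le u2im u3im vim sp sp2 sp3 sq flowX cL expL k tI'.
  (* Reversing time from [T - t] to [t] removes the minus sign of the backward system. *)
  move=> /(ctderiv_reversed tI).
  rewrite (_ : (fun s => ctc k (L (T - s))) = phi k); last by apply/funext => s; rewrite phiE.
  congr (has_deriv_within _ _ _ _).
  rewrite /riccati_rhs fk_rateE//; congr (_ + _ + _ + _ + _).
  + by rewrite phiE RtoCM RtoC_nat -[RHS]mulrA.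
  + by rewrite phiE RtoCM RtoC_nat -[RHS]mulrA.
  + rewrite phiE (_ : c ^+ 2 * (k.+2 * k.+1)%:R / 2 = c ^+ 2 / 2 * (k.+1%:R * k.+2%:R)).
      by rewrite (RtoCM (c ^+ 2 / 2)) (RtoCM k.+1%:R) !RtoC_nat -[RHS]mulrA /fD -[in RHS]mulrA.
    by rewrite natrM; field.
  + congr (_ * _); apply: eq_bigr => l _.
    by rewrite /phit !phiE !RtoC_nat.
Qed.
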